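(* Let $X$ be a reduced coherent scheme whose set of irreducible components is locally finite. Let $X^{(0)}$ be the set of generic points of irreducible components of $X$, set $$\Xi:=\coprod_{\eta\in X^{(0)}}\operatorname{Spec}\left(\kappa(\eta)^{\mathrm{perf}}\right),$$ and let $\pi\colon\Xi\to X$ be the natural morphism. Then the weak normalization of $X$ under $\pi\colon\Xi\to X$ is the topological rigidification $X_{\mathrm{trig}}$ of $X$.
   Context: A scheme is coherent if it is quasicompact and quasiseparated. The set of irreducible components of $X$ is locally finite if every quasicompact open subset of $X$ contains only finitely many irreducible components. $\kappa(\eta)^{\mathrm{perf}}$ denotes the perfect closure of the residue field $\kappa(\eta)$ (equal to $\kappa(\eta)$ in characteristic $0$). A morphism of schemes is a universal homeomorphism if every base change of it is a homeomorphism on underlying topological spaces. A coherent scheme $Y$ is topologically rigid if any universal homeomorphism $Y'\to Y$ with $Y'$ reduced is an isomorphism. The inclusion of topologically rigid schemes into coherent schemes (over a fixed coherent base) has a right adjoint $Y\mapsto Y_{\mathrm{trig}}$, the topological rigidification; explicitly, $Y_{\mathrm{trig}}$ is the limit in $Y$-schemes of all universal homeomorphisms $Z\to Y$. For a morphism $f\colon Y\to X$ of schemes, $\mathrm{UH}_f$ is the category of factorizations $Y\to X'\to X$ of $f$ such that $X'\to X$ is a universal homeomorphism. The weak normalization of $X$ under $Y$ (or relative to $f$) is the initial object of $\mathrm{UH}_f$, if it exists; it exists whenever $X$ is reduced and coherent and $f$ is dominant, quasicompact and quasiseparated. *)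

(* Defs.v *)
From HB Require Import structures.
From mathcomp Require Import all_boot all_order all_algebra generic_quotient.
From mathcomp Require Import all_classical topology.

Set Implicit Arguments.
Unset Strict Implicit.
Unset Printing Implicit Defensive.

Import GRing.Theory.
Local Open Scope classical_set_scope.
Local Open Scope ring_scope.

(* Rings of sections over the empty set are zero, so rings are [comPzRingType]
   throughout, and units are defined by hand since [GRing.unit] wants 1 <> 0. *)
Definition invertible (A : comPzRingType) (a : A) : Prop := exists b, a * b = 1.

Section Spectrum.
Variable A : comPzRingType.

Record prime_ideal := PrimeIdeal {
  pideal :> set A;
  pideal0 : pideal 0;
  pidealD : forall a b, pideal a -> pideal b -> pideal (a + b);
  pidealM : forall a b, pideal b -> pideal (a * b);
  pideal1 : ~ pideal 1;
  pideal_prime : forall a b, pideal (a * b) -> pideal a \/ pideal b }.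

Definition zariski_open (S : set prime_ideal) : Prop :=
  exists E : set A, S = [set P : prime_ideal | ~ E `<=` P].

Definition basic_open (f : A) : set prime_ideal := [set P : prime_ideal | ~ pideal P f].

(* [phi], always a ring morphism, exhibits B as the localization A_f. *)
Definition localization_away (B : comPzRingType) (f : A) (phi : A -> B) : Prop :=
  [/\ invertible (phi f),
      forall b, exists a n, b * phi f ^+ n = phi a
    & forall a, phi a = 0 -> exists n, f ^+ n * a = 0].

End Spectrum.

Record opens (T : topologicalType) := Opens {
  oset :> set T;
  oopen : open oset }.

Definition opreim (S T : topologicalType) (f : S -> T)
    (cf : forall V : set T, open V -> open (f @^-1` V)) (V : opens T) : opens S :=
  Opens (cf V (oopen V)).

Definition ointer (T : topologicalType) (U V : opens T) : opens T :=
  Opens (openI (oopen U) (oopen V)).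

Record ringed_space := RingedSpace {
  rs_top :> topologicalType;
  sec : opens rs_top -> comPzRingType;
  res : forall U V : opens rs_top, V `<=` U -> {rmorphism sec U -> sec V};
  res_id : forall (U : opens rs_top) (h : U `<=` U) (s : sec U), res h s = s;
  res_comp : forall (U V W : opens rs_top) (hVU : V `<=` U) (hWV : W `<=` V) (hWU : W `<=` U)
    (s : sec U), res hWV (res hVU s) = res hWU s;
  sheaf : forall (I : Type) (U : I -> opens rs_top) (V : opens rs_top)
    (hU : forall i, U i `<=` V), V `<=` \bigcup_i U i ->
    forall s : forall i, sec (U i),
    (forall i j, res (@subIsetl _ (U i) (U j) : ointer (U i) (U j) `<=` U i) (s i)
               = res (@subIsetr _ (U i) (U j) : ointer (U i) (U j) `<=` U j) (s j)) ->
    exists! t : sec V, forall i, res (hU i) t = s i }.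

(* Stalks are not formed: [germ_unit x s] says that x lies in the domain of s
   and that the germ of s at x is a unit of the stalk. *)
Definition germ_unit (X : ringed_space) (x : X) (U : opens X) (s : sec U) : Prop :=
  exists (V : opens X) (h : V `<=` U), oset V x /\ invertible (res h s).

(* A ring is local iff it is nonzero and its nonunits are stable under
   addition. *)
Definition local_stalks (X : ringed_space) : Prop :=
  forall (x : X) (U : opens X), oset U x ->
    ~ germ_unit x (0 : sec U) /\
    forall s t : sec U, germ_unit x (s + t) -> germ_unit x s \/ germ_unit x t.

Record lrs := LRS {
  lrs_space :> ringed_space;
  lrs_local : local_stalks lrs_space }.

(* (U, O_X|U) is isomorphic to Spec A: [g] is the homeomorphism Spec A -> U, and
   the structure sheaf of Spec A is given by D(f) |-> A_f on the basis of the
   D(f), so that an isomorphism of sheaves is a ring morphism A -> O_X(U) turning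
   each O_X(g(D(f))) into the localization A_f. *)
Definition affine_open (X : ringed_space) (U : opens X) : Prop :=
  exists (A : comPzRingType) (g : prime_ideal A -> X)
         (phi : {rmorphism A -> sec U}),
    [/\ injective g, range g = U,
        forall V : set X, V `<=` U -> open V <-> zariski_open (g @^-1` V)
      & forall (f : A) (W : opens X) (h : W `<=` U),
          W = g @` basic_open f :> set X ->
          localization_away f (fun a => res h (phi a))].

Record scheme := Scheme {
  sch_lrs :> lrs;
  sch_affine : forall x : sch_lrs, exists2 U : opens sch_lrs, oset U x & affine_open U }.

Record morphism (X Y : lrs) := Morphism {
  mfun :> X -> Y;
  mcts : forall V : set Y, open V -> open (mfun @^-1` V);
  msharp : forall V : opens Y, {rmorphism sec V -> sec (opreim mcts V)};
  msharp_res : forall (V W : opens Y) (h : W `<=` V)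
    (h' : opreim mcts W `<=` opreim mcts V) (s : sec V),
    msharp W (res h s) = res h' (msharp V s);
  mlocal : forall (x : X) (V : opens Y) (s : sec V),
    germ_unit x (msharp V s) -> germ_unit (mfun x) s }.

Lemma res_irr (X : ringed_space) (U V : opens X) (h h' : V `<=` U) (s : sec U) :
  res h s = res h' s.
Proof. by rewrite (Prop_irrelevance h h'). Qed.

(* The quotient of a disjoint union of rings A_i by a congruence for which any two
   A_i, A_j map to a common A_k compatibly with the congruence, when this
   quotient is a field. *)
Record field_system := FieldSystem {
  fidx : Type;
  fidx0 : fidx;
  fring : fidx -> comPzRingType;
  frel : forall i j, fring i -> fring j -> Prop;
  frel_refl : forall i (a : fring i), frel a a;
  frel_sym : forall i j (a : fring i) (b : fring j), frel a b -> frel b a;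
  frel_trans : forall i j k (a : fring i) (b : fring j) (c : fring k),
    frel a b -> frel b c -> frel a c;
  frel_add : forall i (a a' b b' : fring i),
    frel a a' -> frel b b' -> frel (a + b) (a' + b');
  frel_mul : forall i (a a' b b' : fring i),
    frel a a' -> frel b b' -> frel (a * b) (a' * b');
  frel_join : forall i j, exists k (f : {rmorphism fring i -> fring k})
    (g : {rmorphism fring j -> fring k}),
    (forall a, frel a (f a)) /\ (forall b, frel b (g b));
  frel_neq : forall i, ~ frel (1 : fring i) (0 : fring i);
  frel_inv : forall i (a : fring i), frel a (0 : fring i) \/
    exists k (f : {rmorphism fring i -> fring k}) (b : fring k),
      (forall a, frel a (f a)) /\ frel (f a * b) (1 : fring k) }.

Section FieldQuotient.
Local Open Scope quotient_scope.
Variable S : field_system.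

Definition fsum : Type := {i : fidx S & fring i}.
HB.instance Definition _ := gen_eqMixin fsum.
HB.instance Definition _ := gen_choiceMixin fsum.

Definition fsum_rel : rel fsum := fun u v => `[< frel (projT2 u) (projT2 v) >].

Lemma fsum_rel_equiv : equiv_class_of fsum_rel.
Proof.
split=> [u|u v|v u w].
- by apply/asboolP; exact: frel_refl.
- by apply/asboolP/asboolP; exact: frel_sym.
- by move=> /asboolP uv /asboolP vw; apply/asboolP; exact: frel_trans uv vw.
Qed.

Canonical fsum_equiv := EquivRelPack fsum_rel_equiv.

Definition fquot : Type := {eq_quot fsum_equiv}.
HB.instance Definition _ := Choice.on fquot.

Definition fproj (i : fidx S) (a : fring i) : fquot :=
  \pi_{eq_quot fsum_equiv} (existT _ i a).

Lemma fprojP i j (a : fring i) (b : fring j) : fproj a = fproj b <-> frel a b.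
Proof.
rewrite /fproj; split=> [/eqquotP/asboolP //|ab].
by apply/eqquotP/asboolP.
Qed.

Lemma fproj_surj (u : fquot) : exists i (a : fring i), u = fproj a.
Proof.
case E: (repr u) => [i a]; exists i, a.
by rewrite /fproj -E [RHS]reprK.
Qed.

Lemma fproj_surj2 (u v : fquot) :
  exists i (a b : fring i), u = fproj a /\ v = fproj b.
Proof.
have [i [a ->]] := fproj_surj u; have [j [b ->]] := fproj_surj v.
have [k [f [g [hf hg]]]] := frel_join i j.
by exists k, (f a), (g b); split; apply/fprojP.
Qed.

Lemma fproj_surj3 (u v w : fquot) :
  exists i (a b c : fring i), [/\ u = fproj a, v = fproj b & w = fproj c].
Proof.
have [i [a [b [-> ->]]]] := fproj_surj2 u v; have [j [c ->]] := fproj_surj w.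
have [k [f [g [hf hg]]]] := frel_join i j.
by exists k, (f a), (f b), (g c); split; apply/fprojP.
Qed.

Section Lift.
Variable op : forall R : comPzRingType, R -> R -> R.
Hypothesis op_rel : forall (i : fidx S) (a a' b b' : fring i),
  frel a a' -> frel b b' -> frel (op a b) (op a' b').
Hypothesis op_morph : forall (R R' : comPzRingType) (f : {rmorphism R -> R'}) a b,
  f (op a b) = op (f a) (f b).

Definition flift (u v : fquot) : fquot :=
  let w := projT2 (cid (fproj_surj2 u v)) in
  let a := projT1 (cid w) in
  fproj (op a (projT1 (cid (projT2 (cid w))))).

Lemma fliftE i (a b : fring i) : flift (fproj a) (fproj b) = fproj (op a b).
Proof.
rewrite /flift; case: cid => j /= w; case: cid => a' /= w'; case: cid => b' /=.
move=> [/fprojP aa' /fprojP bb']; apply/fprojP.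
have [k [f [g [hf hg]]]] := frel_join i j.
apply: (frel_trans (hg _)); apply: frel_sym; apply: (frel_trans (hf _)).
rewrite !op_morph; apply: op_rel.
- exact: frel_trans (frel_trans (frel_sym (hf a)) aa') (hg a').
- exact: frel_trans (frel_trans (frel_sym (hf b)) bb') (hg b').
Qed.
End Lift.

Definition fadd := flift (fun R : comPzRingType => @GRing.add R).
Definition fmul := flift (fun R : comPzRingType => @GRing.mul R).
Definition fzero : fquot := fproj (0 : fring (fidx0 S)).
Definition fone : fquot := fproj (1 : fring (fidx0 S)).
Definition fopp : fquot -> fquot := fmul (fproj (-1 : fring (fidx0 S))).

Lemma faddE i (a b : fring i) : fadd (fproj a) (fproj b) = fproj (a + b).
Proof. by apply: fliftE => *; [exact: frel_add|exact: rmorphD]. Qed.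

Lemma fmulE i (a b : fring i) : fmul (fproj a) (fproj b) = fproj (a * b).
Proof. by apply: fliftE => *; [exact: frel_mul|exact: rmorphM]. Qed.

Lemma fzeroE i : fproj (0 : fring i) = fzero.
Proof.
apply/fprojP; have [k [f [g [hf hg]]]] := frel_join i (fidx0 S).
by apply: (frel_trans (hf _)); apply: frel_sym; apply: (frel_trans (hg _));
  rewrite !rmorph0; exact: frel_refl.
Qed.

Lemma foneE i : fproj (1 : fring i) = fone.
Proof.
apply/fprojP; have [k [f [g [hf hg]]]] := frel_join i (fidx0 S).
by apply: (frel_trans (hf _)); apply: frel_sym; apply: (frel_trans (hg _));
  rewrite !rmorph1; exact: frel_refl.
Qed.

Lemma foppE i (a : fring i) : fopp (fproj a) = fproj (- a).
Proof.
have [k [f [g [hf hg]]]] := frel_join i (fidx0 S).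
have /fprojP -> := hf a; have /fprojP -> := hf (- a).
rewrite /fopp; have /fprojP -> := hg (-1).
by rewrite fmulE rmorphN rmorph1 mulN1r rmorphN.
Qed.

Lemma faddA : associative fadd.
Proof.
by move=> u v w; have [i [a [b [c [-> -> ->]]]]] := fproj_surj3 u v w;
  rewrite !faddE addrA.
Qed.

Lemma faddC : commutative fadd.
Proof.
by move=> u v; have [i [a [b [-> ->]]]] := fproj_surj2 u v; rewrite !faddE addrC.
Qed.

Lemma fadd0 : left_id fzero fadd.
Proof.
by move=> u; have [i [a ->]] := fproj_surj u; rewrite -(fzeroE i) faddE add0r.
Qed.

Lemma faddN : left_inverse fzero fopp fadd.
Proof.
by move=> u; have [i [a ->]] := fproj_surj u;
  rewrite foppE faddE addNr fzeroE.
Qed.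

Lemma fmulA : associative fmul.
Proof.
by move=> u v w; have [i [a [b [c [-> -> ->]]]]] := fproj_surj3 u v w;
  rewrite !fmulE mulrA.
Qed.

Lemma fmulC : commutative fmul.
Proof.
by move=> u v; have [i [a [b [-> ->]]]] := fproj_surj2 u v; rewrite !fmulE mulrC.
Qed.

Lemma fmul1 : left_id fone fmul.
Proof.
by move=> u; have [i [a ->]] := fproj_surj u; rewrite -(foneE i) fmulE mul1r.
Qed.

Lemma fmulDl : left_distributive fmul fadd.
Proof.
by move=> u v w; have [i [a [b [c [-> -> ->]]]]] := fproj_surj3 u v w;
  rewrite ?(faddE, fmulE) mulrDl.
Qed.

HB.instance Definition _ := GRing.isZmodule.Build fquot faddA faddC fadd0 faddN.

Lemma fone_neq0 : fone != fzero.
Proof. by apply/eqP => /fprojP; exact: frel_neq. Qed.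

HB.instance Definition _ :=
  GRing.Zmodule_isComNzRing.Build fquot fmulA fmulC fmul1 fmulDl fone_neq0.

Lemma finv_ex (u : fquot) : exists v : fquot, if u == 0 then v = 0 else v * u = 1.
Proof.
case: eqP => [_|]; first by exists 0.
have [i [a ->]] := fproj_surj u.
case: (frel_inv a) => [a0|[k [f [b [hf ab]]]]].
  by case; rewrite -[RHS](fzeroE i); apply/fprojP.
exists (fproj b); rewrite mulrC; have /fprojP -> := hf a.
rewrite [LHS]fmulE -[RHS](foneE k); exact/fprojP.
Qed.

Definition finv (u : fquot) : fquot := projT1 (cid (finv_ex u)).

Lemma fmulV (u : fquot) : u != 0 -> finv u * u = 1.
Proof. by rewrite /finv => /negPf u0; case: cid => v /=; rewrite u0. Qed.

Lemma finv0 : finv 0 = 0.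
Proof. by rewrite /finv; case: cid => v /=; rewrite eqxx. Qed.

HB.instance Definition _ := GRing.ComNzRing_isField.Build fquot fmulV finv0.

Section Projection.
Variable i : fidx S.

Lemma fproj_additive : zmod_morphism (@fproj i).
Proof. by move=> a b; rewrite -[RHS]/(fadd _ (fopp _)) foppE faddE. Qed.

Lemma fproj_multiplicative : monoid_morphism (@fproj i).
Proof. by split=> [|a b]; [exact: foneE|rewrite -[RHS]/(fmul _ _) fmulE]. Qed.

HB.instance Definition _ :=
  GRing.isZmodMorphism.Build (fring i) fquot (@fproj i) fproj_additive.
HB.instance Definition _ :=
  GRing.isMonoidMorphism.Build (fring i) fquot (@fproj i) fproj_multiplicative.
End Projection.

End FieldQuotient.

Section GermUnits.
Variables (X : ringed_space) (x : X).

Lemma germ_unit_res (U V : opens X) (h : V `<=` U) (s : sec U) :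
  oset V x -> germ_unit x (res h s) <-> germ_unit x s.
Proof.
move=> Vx; split=> [[W [hW [Wx [b hb]]]]|[W [hW [Wx [b hb]]]]].
  exists W, (subset_trans hW h); split=> //; exists b.
  by rewrite -(res_comp h hW).
exists (ointer V W), (@subIsetl _ V W); split=> //.
have hWI : ointer V W `<=` W by exact: subIsetr.
exists (res hWI b); rewrite (res_comp _ _ (subset_trans hWI hW)).
by rewrite -(res_comp hW hWI) -rmorphM hb rmorph1.
Qed.

Lemma germ_unitMr (U : opens X) (s t : sec U) :
  germ_unit x (s * t) -> germ_unit x t.
Proof.
move=> [V [h [Vx [b hb]]]]; exists V, h; split=> //; exists (res h s * b).
by rewrite -hb rmorphM mulrA [res h t * _]mulrC.
Qed.

Lemma germ_unit1 (U : opens X) : oset U x -> germ_unit x (1 : sec U).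
Proof.
move=> Ux; exists U, (@subset_refl _ U); split=> //.
by exists 1; rewrite rmorph1 mulr1.
Qed.

End GermUnits.

Section ResidueField.
Variables (X : lrs) (x : X).

Definition res_idx : Type := {U : opens X | oset U x}.
Definition resIdx (U : opens X) (Ux : oset U x) : res_idx :=
  exist (fun U : opens X => oset U x) U Ux.
Definition res_ring (U : res_idx) : comPzRingType := sec (sval U).

Definition res_rel (U V : res_idx) (s : res_ring U) (t : res_ring V) : Prop :=
  ~ germ_unit x (res (@subIsetl _ (sval U) (sval V) : ointer _ _ `<=` _) s
               - res (@subIsetr _ (sval U) (sval V) : ointer _ _ `<=` _) t).

Let nonunit (U : opens X) (s : sec U) := ~ germ_unit x s.

Lemma nonunitD (U : opens X) (s t : sec U) : oset U x ->
  nonunit s -> nonunit t -> nonunit (s + t).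
Proof.
by move=> Ux ns nt; case: (lrs_local Ux) => _ /(_ s t) h /h[].
Qed.

Lemma nonunitM (U : opens X) (s t : sec U) : nonunit t -> nonunit (s * t).
Proof. by move=> nt /germ_unitMr. Qed.

Lemma nonunitB (U : opens X) (s t : sec U) : nonunit (s - t) -> nonunit (t - s).
Proof. by move=> /(nonunitM (s := -1)); rewrite mulN1r opprB. Qed.

Lemma nonunit0 (U : opens X) : oset U x -> nonunit (0 : sec U).
Proof. by move=> Ux; case: (lrs_local Ux). Qed.

Lemma res_relP (U V : res_idx) (s : res_ring U) (t : res_ring V)
    (W : opens X) (hU : W `<=` sval U) (hV : W `<=` sval V) : oset W x ->
  res_rel s t <-> nonunit (res hU s - res hV t).
Proof.
move=> Wx; have hW : W `<=` ointer (sval U) (sval V) by move=> y Wy; split; auto.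
rewrite /res_rel /nonunit -(germ_unit_res hW) // rmorphB.
by rewrite (res_comp _ hW hU) (res_comp _ hW hV).
Qed.

Lemma res_rel_refl (U : res_idx) (s : res_ring U) : res_rel s s.
Proof.
apply/(res_relP _ _ (@subset_refl _ _) (@subset_refl _ _) (svalP U)).
by rewrite subrr; exact: nonunit0 (svalP U).
Qed.

Lemma res_rel_sym (U V : res_idx) (s : res_ring U) (t : res_ring V) :
  res_rel s t -> res_rel t s.
Proof.
have Ix : oset (ointer (sval U) (sval V)) x by split; [exact: (svalP U)|exact: (svalP V)].
have hU : ointer (sval U) (sval V) `<=` sval U by exact: subIsetl.
have hV : ointer (sval U) (sval V) `<=` sval V by exact: subIsetr.
by move=> /(res_relP _ _ hU hV Ix)/nonunitB h; apply/(res_relP _ _ hV hU Ix).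
Qed.

Lemma res_rel_trans (U V W : res_idx)
    (s : res_ring U) (t : res_ring V) (u : res_ring W) :
  res_rel s t -> res_rel t u -> res_rel s u.
Proof.
pose I := ointer (ointer (sval U) (sval V)) (sval W).
have Ix : oset I x by split; [split; [exact: (svalP U)|exact: (svalP V)]|exact: (svalP W)].
have hU : I `<=` sval U by move=> y [[]].
have hV : I `<=` sval V by move=> y [[]].
have hW : I `<=` sval W by move=> y [].
move=> /(res_relP _ _ hU hV Ix) h1 /(res_relP _ _ hV hW Ix) h2.
apply/(res_relP _ _ hU hW Ix).
by have := nonunitD Ix h1 h2; rewrite addrA subrK.
Qed.

Lemma res_rel_same (U : res_idx) (s t : res_ring U) :
  res_rel s t <-> nonunit (s - t : sec (sval U)).
Proof.
rewrite (res_relP _ _ (@subset_refl _ _) (@subset_refl _ _) (svalP U)).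
by rewrite !res_id.
Qed.

Lemma res_rel_add (U : res_idx) (s s' t t' : res_ring U) :
  res_rel s s' -> res_rel t t' -> res_rel (s + t) (s' + t').
Proof.
move=> /res_rel_same h /res_rel_same h'; apply/res_rel_same; rewrite /=.
by rewrite opprD addrACA; exact: nonunitD (svalP U) h h'.
Qed.

Lemma res_rel_mul (U : res_idx) (s s' t t' : res_ring U) :
  res_rel s s' -> res_rel t t' -> res_rel (s * t) (s' * t').
Proof.
move=> /res_rel_same h /res_rel_same h'; apply/res_rel_same.
have -> : s * t - s' * t' = t * (s - s') + s' * (t - t').
  by rewrite !mulrBr addrA [t * s]mulrC [t * s']mulrC subrK.
by apply: (nonunitD (svalP U)); exact: nonunitM.
Qed.

Lemma res_relE (U V : res_idx) (h : sval V `<=` sval U) (s : res_ring U) :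
  res_rel s (res h s : res_ring V).
Proof.
apply/(res_relP _ _ h (@subset_refl _ _) (svalP V)).
by rewrite res_id subrr; exact: nonunit0 (svalP V).
Qed.

Lemma res_rel_join (U V : res_idx) : exists (W : res_idx)
    (f : {rmorphism res_ring U -> res_ring W})
    (g : {rmorphism res_ring V -> res_ring W}),
  (forall s, res_rel s (f s)) /\ (forall t, res_rel t (g t)).
Proof.
have Ix : oset (ointer (sval U) (sval V)) x by split; [exact: (svalP U)|exact: (svalP V)].
exists (resIdx Ix).
exists (res (@subIsetl _ (sval U) (sval V) : ointer _ _ `<=` _)).
exists (res (@subIsetr _ (sval U) (sval V) : ointer _ _ `<=` _)).
by split=> s; exact: res_relE.
Qed.

Lemma res_rel_neq (U : res_idx) : ~ res_rel (1 : res_ring U) (0 : res_ring U).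
Proof.
by move=> /res_rel_same; rewrite subr0 => /(_ (germ_unit1 (svalP U))).
Qed.

Lemma res_rel_inv (U : res_idx) (s : res_ring U) : res_rel s (0 : res_ring U) \/
  exists (V : res_idx) (f : {rmorphism res_ring U -> res_ring V}) (t : res_ring V),
    (forall a, res_rel a (f a)) /\ res_rel (f s * t) (1 : res_ring V).
Proof.
case: (pselect (res_rel s (0 : res_ring U))) => [|ns]; [by left|right].
have : germ_unit x (s : sec (sval U)).
  by apply: contrapT => h; apply: ns; apply/res_rel_same; rewrite subr0.
move=> [V [h [Vx [t st]]]]; exists (resIdx Vx), (res h), t; split.
  by move=> a; exact: res_relE.
by rewrite [_ * _]st; exact: res_rel_refl.
Qed.

Definition residue_system : field_system :=
  @FieldSystem res_idx (@resIdx (Opens openT) I) res_ring res_rel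
    res_rel_refl res_rel_sym res_rel_trans res_rel_add res_rel_mul
    res_rel_join res_rel_neq res_rel_inv.

(* kappa(x): sections s, t near x are identified when s - t is not a unit of the
   stalk, i.e. lies in its maximal ideal. *)
Definition residue_field : fieldType := fquot residue_system.

Definition residue_eval (U : opens X) (Ux : oset U x) :
    {rmorphism sec U -> residue_field} :=
  let S := residue_system in
  (@fproj S (resIdx Ux) : {rmorphism @fring S (resIdx Ux) -> fquot S}).

Lemma residue_eval_eq0 (U : opens X) (Ux : oset U x) (s : sec U) :
  residue_eval Ux s = 0 <-> ~ germ_unit x s.
Proof.
rewrite -[0](fzeroE (S := residue_system) (resIdx Ux)).
by rewrite [_ = _]fprojP [frel _ _]res_rel_same subr0.
Qed.

End ResidueField.

Section PerfectClosure.
Variable K : fieldType.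

(* The characteristic exponent: p in characteristic p > 0, and 1 otherwise. *)
Definition char_exponent : nat :=
  if pselect (exists p, p \in [pchar K]) is left h then projT1 (cid h) else 1%N.

Lemma frobD n (a b : K) :
  (a + b) ^+ (char_exponent ^ n) = a ^+ (char_exponent ^ n) + b ^+ (char_exponent ^ n).
Proof.
rewrite /char_exponent; case: pselect => [h|_]; last by rewrite exp1n.
case: cid => p /= pK; elim: n => [//|n IHn].
by rewrite expnSr !exprM IHn -!(pFrobenius_autE pK) pFrobenius_autD_comm //;
  exact: mulrC.
Qed.

Lemma frobN n (a : K) : (- a) ^+ (char_exponent ^ n) = - a ^+ (char_exponent ^ n).
Proof.
apply/eqP; rewrite -addr_eq0 -frobD addNr expr0n expn_eq0.
rewrite /char_exponent; case: pselect => [h|//].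
by case: cid => p /= /andP[/prime_gt0]; case: p.
Qed.

Lemma frob_inj n : injective (fun a : K => a ^+ (char_exponent ^ n)).
Proof.
move=> a b /= ab; apply/eqP; rewrite -subr_eq0.
have : (a - b) ^+ (char_exponent ^ n) == 0 by rewrite frobD frobN ab subrr.
by rewrite expf_eq0 => /andP[].
Qed.

Definition frob n (a : K) : K := a ^+ (char_exponent ^ n).

Lemma frob_additive n : zmod_morphism (frob n).
Proof. by move=> a b; rewrite /frob frobD frobN. Qed.

Lemma frob_multiplicative n : monoid_morphism (frob n).
Proof. by split=> [|a b]; rewrite /frob ?expr1n ?exprMn. Qed.

HB.instance Definition _ n :=
  GRing.isZmodMorphism.Build K K (frob n) (frob_additive n).
HB.instance Definition _ n :=
  GRing.isMonoidMorphism.Build K K (frob n) (frob_multiplicative n).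

Lemma frobC m n a : frob m (frob n a) = frob n (frob m a).
Proof. by rewrite /frob -!exprM mulnC. Qed.

Lemma frob_comp m n a : frob m (frob n a) = frob (n + m) a.
Proof. by rewrite /frob -exprM expnD. Qed.

Definition perf_ring (n : nat) : comPzRingType := K.

Definition perf_rel (m n : nat) (a : perf_ring m) (b : perf_ring n) : Prop :=
  frob n a = frob m b.

Lemma perf_rel_refl n (a : perf_ring n) : perf_rel a a.
Proof. by []. Qed.

Lemma perf_rel_sym m n (a : perf_ring m) (b : perf_ring n) :
  perf_rel a b -> perf_rel b a.
Proof. by []. Qed.

Lemma perf_rel_trans m n k (a : perf_ring m) (b : perf_ring n) (c : perf_ring k) :
  perf_rel a b -> perf_rel b c -> perf_rel a c.
Proof.
rewrite /perf_rel => ab bc; apply: (@frob_inj n); rewrite -!/(frob _ _).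
by rewrite frobC ab frobC bc frobC.
Qed.

Lemma perf_rel_add n (a a' b b' : perf_ring n) :
  perf_rel a a' -> perf_rel b b' -> perf_rel (a + b) (a' + b').
Proof. by move=> /frob_inj -> /frob_inj ->. Qed.

Lemma perf_rel_mul n (a a' b b' : perf_ring n) :
  perf_rel a a' -> perf_rel b b' -> perf_rel (a * b) (a' * b').
Proof. by move=> /frob_inj -> /frob_inj ->. Qed.

Lemma perf_rel_join m n : exists k
    (f : {rmorphism perf_ring m -> perf_ring k})
    (g : {rmorphism perf_ring n -> perf_ring k}),
  (forall a, perf_rel a (f a)) /\ (forall b, perf_rel b (g b)).
Proof.
exists (m + n)%N, (frob n : {rmorphism K -> K}), (frob m : {rmorphism K -> K}).
by split=> a; rewrite /perf_rel frob_comp // addnC.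
Qed.

Lemma perf_rel_neq n : ~ perf_rel (1 : perf_ring n) (0 : perf_ring n).
Proof. by move=> /frob_inj /eqP; rewrite (oner_eq0 K). Qed.

Lemma perf_rel_inv n (a : perf_ring n) : perf_rel a (0 : perf_ring n) \/
  exists k (f : {rmorphism perf_ring n -> perf_ring k}) (b : perf_ring k),
    (forall c, perf_rel c (f c)) /\ perf_rel (f a * b) (1 : perf_ring k).
Proof.
have [->|a0] := eqVneq (a : K) 0; [by left|right].
exists n, (idfun : {rmorphism K -> K}), (a : K)^-1; split=> //.
by rewrite /perf_rel /= [X in frob n X](divff a0).
Qed.

Definition perfect_system : field_system :=
  @FieldSystem nat 0%N perf_ring perf_rel
    perf_rel_refl perf_rel_sym perf_rel_trans perf_rel_add perf_rel_mul
    perf_rel_join perf_rel_neq perf_rel_inv.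

(* With p the characteristic exponent, the class of a in the n-th copy of K
   stands for the p^n-th root of a. *)
Definition perfect_closure : fieldType := fquot perfect_system.

Definition to_perfect_closure : {rmorphism K -> perfect_closure} :=
  let S := perfect_system in
  (@fproj S 0%N : {rmorphism @fring S 0%N -> fquot S}).

End PerfectClosure.

Section PerfectClosureSpec.
Variable K : fieldType.

Lemma char_exponentE (p : nat) : p \in [pchar K] -> char_exponent K = p.
Proof.
move=> pK; rewrite /char_exponent; case: pselect => [h|[]]; last by exists p.
by case: cid => q /= qK; have := pcharf_eq pK q; rewrite qK => /esym/eqP.
Qed.

Lemma perfect_closure_perfect (p : nat) : p \in [pchar perfect_closure K] ->
  forall u : perfect_closure K, exists v, v ^+ p = u.
Proof.
rewrite (fmorph_pchar (to_perfect_closure K)) => pK u.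
have [n [a ->]] := fproj_surj u.
exists (@fproj (perfect_system K) n.+1 a); rewrite -rmorphXn.
apply/fprojP; rewrite /= /perf_rel /frob (char_exponentE pK) -exprM.
by rewrite -expnS.
Qed.

Lemma perfect_closure_radicial (u : perfect_closure K) :
  exists n a, u ^+ (char_exponent K ^ n) = to_perfect_closure K a.
Proof.
have [n [a ->]] := fproj_surj u; exists n, a; rewrite -rmorphXn.
by apply/fprojP; rewrite /= /perf_rel /frob expn0 expr1.
Qed.

End PerfectClosureSpec.

Section CoproductOfSpectra.
Variables (I : choiceType) (K : I -> fieldType).

Definition fsec (U : set I) : Type := forall i, U i -> K i.

Section Ring.
Variable U : set I.

HB.instance Definition _ := gen_eqMixin (fsec U).
HB.instance Definition _ := gen_choiceMixin (fsec U).

Definition fsec0 : fsec U := fun _ _ => 0.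
Definition fsec1 : fsec U := fun _ _ => 1.
Definition fsecN (s : fsec U) : fsec U := fun i Ui => - s i Ui.
Definition fsecD (s t : fsec U) : fsec U := fun i Ui => s i Ui + t i Ui.
Definition fsecM (s t : fsec U) : fsec U := fun i Ui => s i Ui * t i Ui.

Lemma fsecP (s t : fsec U) : (forall i Ui, s i Ui = t i Ui) -> s = t.
Proof. by move=> st; apply: functional_extensionality_dep => i; apply/funext. Qed.

Lemma fsecDA : associative fsecD.
Proof. by move=> *; apply: fsecP => *; exact: addrA. Qed.
Lemma fsecDC : commutative fsecD.
Proof. by move=> *; apply: fsecP => *; exact: addrC. Qed.
Lemma fsecD0 : left_id fsec0 fsecD.
Proof. by move=> *; apply: fsecP => *; exact: add0r. Qed.
Lemma fsecDN : left_inverse fsec0 fsecN fsecD.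
Proof. by move=> *; apply: fsecP => *; exact: addNr. Qed.
Lemma fsecMA : associative fsecM.
Proof. by move=> *; apply: fsecP => *; exact: mulrA. Qed.
Lemma fsecMC : commutative fsecM.
Proof. by move=> *; apply: fsecP => *; exact: mulrC. Qed.
Lemma fsecM1 : left_id fsec1 fsecM.
Proof. by move=> *; apply: fsecP => *; exact: mul1r. Qed.
Lemma fsecMDl : left_distributive fsecM fsecD.
Proof. by move=> *; apply: fsecP => *; exact: mulrDl. Qed.

HB.instance Definition _ :=
  GRing.isZmodule.Build (fsec U) fsecDA fsecDC fsecD0 fsecDN.
HB.instance Definition _ :=
  GRing.Zmodule_isComPzRing.Build (fsec U) fsecMA fsecMC fsecM1 fsecMDl.

End Ring.

Definition fres (U V : set I) (h : V `<=` U) (s : fsec U) : fsec V :=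
  fun i Vi => s i (h i Vi).

Section Restriction.
Variables (U V : set I) (h : V `<=` U).

Lemma fres_additive : zmod_morphism (fres h).
Proof. by []. Qed.
Lemma fres_multiplicative : monoid_morphism (fres h).
Proof. by []. Qed.

HB.instance Definition _ :=
  GRing.isZmodMorphism.Build (fsec U) (fsec V) (fres h) fres_additive.
HB.instance Definition _ :=
  GRing.isMonoidMorphism.Build (fsec U) (fsec V) (fres h) fres_multiplicative.
End Restriction.

Let T : topologicalType := discrete_topology I.

Lemma fopen (V : set T) : open V.
Proof. exact: (@discrete_open (discrete_topology I)). Qed.
Arguments fopen V : clear implicits.

Lemma fsheaf (J : Type) (U : J -> opens T) (V : opens T)
    (hU : forall j, U j `<=` V) : V `<=` \bigcup_j U j ->
  forall s : forall j, fsec (U j),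
  (forall j k, fres (@subIsetl _ (U j) (U k)) (s j)
             = fres (@subIsetr _ (U j) (U k)) (s k)) ->
  exists! t : fsec V, forall j, fres (hU j) t = s j.
Proof.
move=> cV s ss.
have cov i : oset V i -> {j | oset (U j) i}.
  by move=> Vi; apply: cid; have [j _ Uji] := cV i Vi; exists j.
exists (fun i Vi => s _ i (svalP (cov i Vi))); split=> [j|t ht].
  apply: fsecP => i Uji; rewrite /fres.
  have := congr1 (fun t => t i (conj (svalP (cov i (hU j i Uji))) Uji)) (ss _ j).
  rewrite /fres => e; transitivity (s j i (subIsetr
    (conj (svalP (cov i (hU j i Uji))) Uji))).
    by rewrite -e; congr (s _ i _); exact: Prop_irrelevance.
  by congr (s _ i _); exact: Prop_irrelevance.
apply: fsecP => i Vi; rewrite -ht /fres.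
by congr (t i _); exact: Prop_irrelevance.
Qed.

Definition coprod_spec_rs : ringed_space.
refine (@RingedSpace T (fun U => fsec U)
  (fun U V h => (fres h : {rmorphism fsec U -> fsec V})) _ _ fsheaf).
- by move=> U h s; apply: fsecP => i Ui; congr (s i _); exact: Prop_irrelevance.
- by move=> U V W hVU hWV hWU s; apply: fsecP => i Wi; congr (s i _);
    exact: Prop_irrelevance.
Defined.

Lemma coprod_germ_unit (i : I) (U : opens T) (Ui : oset U i) (s : fsec U) :
  @germ_unit coprod_spec_rs i U s <-> s i Ui != 0.
Proof.
split=> [[V [h [Vi [b hb]]]]|si].
  have : s i (h i Vi) * b i Vi = 1 := congr1 (fun t : fsec V => t i Vi) hb.
  rewrite (Prop_irrelevance (h i Vi) Ui) => sb; apply/eqP => si0.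
  by move/eqP: sb; rewrite si0 mul0r eq_sym oner_eq0.
pose V : opens T := Opens (fopen [set i]).
have h : V `<=` U by move=> j ->.
exists V, h; split=> //; exists (fun j Vj => (s j (h j Vj))^-1).
have key j (Uj : oset U j) : j = i -> s j Uj != 0.
  by move=> ji; subst j; rewrite (Prop_irrelevance Uj Ui).
by apply: fsecP => j Vj; apply: divff; exact: key.
Qed.

Lemma coprod_local : local_stalks coprod_spec_rs.
Proof.
move=> i U Ui; split=> [/(coprod_germ_unit Ui)/eqP //|s t].
move=> /(coprod_germ_unit Ui) st.
have [si|si] := eqVneq (s i Ui) 0; [right|left]; apply/(coprod_germ_unit Ui) => //.
have {}st : s i Ui + t i Ui != 0 := st.
by move: st; rewrite si add0r.
Qed.

Lemma field_prime_ideal (F : fieldType) (P : prime_ideal F) (a : F) :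
  pideal P a <-> a = 0.
Proof.
split=> [Pa|->]; last exact: pideal0.
by apply: contrapT => /eqP a0; apply: (@pideal1 _ P); rewrite -(mulVf a0);
  exact: pidealM.
Qed.

Lemma prime_ideal_eq (A : comPzRingType) (P Q : prime_ideal A) :
  pideal P = pideal Q -> P = Q.
Proof.
case: P Q => P p0 pD pM p1 pp [Q q0 qD qM q1 qp] /= PQ; subst Q.
by f_equal; exact: Prop_irrelevance.
Qed.

Definition zero_prime (F : fieldType) : prime_ideal F.
refine (@PrimeIdeal F [set 0] _ _ _ _ _) => //=.
- by move=> a b -> ->; rewrite addr0.
- by move=> a b ->; rewrite mulr0.
- by move=> /eqP; rewrite oner_eq0.
- by move=> a b /eqP; rewrite mulf_eq0 => /orP[]/eqP ->; [left|right].
Defined.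

Lemma coprod_affine (i : I) (U : opens T) : oset U = [set i] ->
  @affine_open coprod_spec_rs U.
Proof.
move=> Ui; exists (K i), (fun=> i).
have Uj j : oset U j -> i = j by rewrite Ui => ->.
pose phi (a : K i) : fsec U := fun j h => eq_rect i (fun j => K j) a j (Uj j h).
have addphi : zmod_morphism phi.
  by move=> a b; apply: fsecP => j h; rewrite /phi [RHS]/(_ + - _); case: _ / (Uj j h).
have mulphi : monoid_morphism phi.
  split=> [|a b]; apply: fsecP => j h; rewrite /phi ?[RHS]/(_ * _);
    rewrite -?[RHS]/(1 : K j); by case: _ / (Uj j h).
pose mphi := GRing.isMonoidMorphism.Build (K i) (fsec U) phi mulphi.
pose aphi := GRing.isZmodMorphism.Build (K i) (fsec U) phi addphi.
pose rphi : {rmorphism K i -> fsec U} := HB.pack phi aphi mphi.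
exists rphi; split.
- move=> P Q _; apply: prime_ideal_eq; apply/seteqP.
  by split=> a /field_prime_ideal ->; exact: pideal0.
- rewrite Ui; apply/seteqP; split=> [j [P _ <-] //|j ->].
  by exists (zero_prime (K i)).
- move=> V VU; split=> _; last exact: fopen.
  have [Vi|Vi] := pselect (V i).
    exists [set 1]; apply/seteqP; split=> // P _ /=.
    by move=> /(_ 1 erefl); exact: pideal1.
  by exists set0; apply/seteqP; split=> P /= h //; case: h => a [].
move=> f W h Wf.
have [f0|f0] := eqVneq f 0.
  have W0 : oset W = set0.
    rewrite Wf; apply/seteqP; split=> // j [P /= Pf _].
    by apply: Pf; rewrite f0; exact: pideal0.
  have triv (s t : fsec W) : s = t.
    by apply: fsecP => j Wj; exfalso; rewrite W0 in Wj.
  split=> [|b|a _]; first by exists 0; exact: triv.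
    by exists 0, 0%N; exact: triv.
  by exists 1%N; rewrite f0 expr1 mul0r.
have Wi : oset W i.
  by rewrite Wf; exists (zero_prime (K i)) => //= f0'; rewrite f0' eqxx in f0.
split.
- exists (fres h (phi f^-1)).
  by rewrite -[LHS](rmorphM (fres h)) -(rmorphM rphi) divff // !rmorph1.
- move=> b; exists (b i Wi), 0%N; rewrite expr0 mulr1.
  apply: fsecP => j Wj; rewrite [RHS]/(eq_rect _ _ _ _ _).
  move: (Uj j _) => ij; case: _ / ij in Wj *.
  by congr (b i _); exact: Prop_irrelevance.
- move=> a a0; exists 0%N; rewrite expr0 mul1r.
  have := congr1 (fun s : fsec W => s i Wi) a0.
  rewrite [LHS]/(eq_rect _ _ _ _ _).
  by rewrite (Prop_irrelevance (Uj i (h i Wi)) erefl).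
Qed.

(* The coproduct of the Spec (K i): a discrete space whose sections over U are
   the families in the product of the K i, i in U. *)
Definition coprod_spec : scheme.
refine (@Scheme (LRS coprod_local) _) => i.
by exists (Opens (fopen [set i])) => //; exact: coprod_affine.
Defined.

Section ToScheme.
Variables (X : scheme) (x : I -> X).
Variable phi : forall i, {rmorphism residue_field (x i) -> K i}.

Lemma coprod_map_cts (V : set X) : open V -> open ((x : T -> X) @^-1` V).
Proof. by move=> _; exact: fopen. Qed.

Definition coprod_map_sharp (V : opens X) (s : sec V) :
    fsec (opreim coprod_map_cts V) :=
  fun i Vi => phi i (residue_eval Vi s).

Lemma coprod_map_additive V : zmod_morphism (@coprod_map_sharp V).
Proof.
move=> s t; apply: fsecP => i Vi.
transitivity (phi i (residue_eval Vi s - residue_eval Vi t)).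
  by congr (phi i _); exact: rmorphB.
exact: rmorphB.
Qed.

Lemma coprod_map_multiplicative V : monoid_morphism (@coprod_map_sharp V).
Proof.
split=> [|s t]; apply: fsecP => i Vi.
  transitivity (phi i 1); last exact: rmorph1.
  by congr (phi i _); exact: rmorph1.
transitivity (phi i (residue_eval Vi s * residue_eval Vi t)).
  by congr (phi i _); exact: rmorphM.
exact: rmorphM.
Qed.

HB.instance Definition _ V :=
  GRing.isZmodMorphism.Build (sec V) (fsec (opreim coprod_map_cts V))
    (@coprod_map_sharp V) (@coprod_map_additive V).
HB.instance Definition _ V :=
  GRing.isMonoidMorphism.Build (sec V) (fsec (opreim coprod_map_cts V))
    (@coprod_map_sharp V) (@coprod_map_multiplicative V).

Lemma residue_eval_res (y : X) (V W : opens X) (h : W `<=` V) (Vy : oset V y)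
  (Wy : oset W y) (s : sec V) : residue_eval Wy (res h s) = residue_eval Vy s.
Proof.
by apply/esym/fprojP; exact: (@res_relE X y (resIdx Vy) (resIdx Wy) h s).
Qed.

(* The point x i of X, with values in K i through phi i : kappa(x i) -> K i. *)
Definition coprod_map : morphism coprod_spec X.
refine (@Morphism coprod_spec X x coprod_map_cts
  (fun V => (@coprod_map_sharp V :
     {rmorphism sec V -> fsec (opreim coprod_map_cts V)})) _ _).
- move=> V W h h' s; apply: fsecP => i Wi.
  rewrite [LHS]/(phi i _) [RHS]/(phi i _); congr (phi i _).
  exact: residue_eval_res.
- move=> i V s hs.
  have Vi : oset (opreim coprod_map_cts V) i.
    by case: hs => W [h [Wi _]]; exact: h.
  move: hs => /(coprod_germ_unit Vi); rewrite [X in X != 0]/(phi i _) fmorph_eq0.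
  by move=> /eqP h; apply: contrapT => /(residue_eval_eq0 Vi).
Defined.
End ToScheme.

End CoproductOfSpectra.

Definition mid (X : lrs) : morphism X X.
refine (@Morphism X X idfun (fun V oV => oV)
  (fun V => res ((fun x Vx => Vx) : opreim (f := idfun) (fun V oV => oV) V `<=` V))
  _ _).
- move=> V W h h' s; have hWV : opreim (f := idfun) (fun V oV => oV) W `<=` V.
    by move=> x /h.
  by rewrite (res_comp _ _ hWV) (res_comp _ _ hWV).
- by move=> x V s [W [h [Wx hs]]]; exists W, h; split=> //; move: hs; rewrite res_comp.
Defined.

Definition mcomp (X Y Z : lrs) (g : morphism Y Z) (f : morphism X Y) : morphism X Z.
refine (@Morphism X Z (g \o f) (fun V oV => mcts f (mcts g oV))
  (fun V => (msharp f (opreim (mcts g) V) \o msharp g V : {rmorphism _ -> _})) _ _).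
- move=> V W h h' s /=.
  have hg : opreim (mcts g) W `<=` opreim (mcts g) V by move=> y /h.
  by rewrite (msharp_res h hg) (msharp_res hg h').
- by move=> x V s /(@mlocal _ _ f _ (opreim (mcts g) V))/mlocal.
Defined.

Lemma rmorphism_ext (A B : comPzRingType) (f g : {rmorphism A -> B}) :
  f =1 g -> f = g.
Proof.
case: f g => [f cf] [g cg] /= /funext fg; subst g; congr GRing.RMorphism.Pack.
case: cf cg => [[a] [b]] [[c] [d]].
by rewrite (Prop_irrelevance a c) (Prop_irrelevance b d).
Qed.

Lemma morphism_ext (X Y : lrs) (f g : morphism X Y) : f =1 g ->
  (forall (V : opens Y) (s : sec V) (W : opens X)
     (h : W `<=` opreim (mcts f) V) (h' : W `<=` opreim (mcts g) V),
     res h (msharp f V s) = res h' (msharp g V s)) ->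
  f = g.
Proof.
case: f g => [f cf sf rf lf] [g cg sg rg lg] /= /funext fg fsg; subst g.
have ?: cf = cg by exact: Prop_irrelevance.
subst cg; have ?: sf = sg.
  apply: functional_extensionality_dep => V; apply: rmorphism_ext => s.
  have h : opreim cf V `<=` opreim cf V by exact: subset_refl.
  by have := fsg V s (opreim cf V) h h; rewrite !res_id.
by subst sg; rewrite (Prop_irrelevance rf rg) (Prop_irrelevance lf lg).
Qed.

Definition isomorphism (X Y : lrs) (f : morphism X Y) : Prop :=
  exists g : morphism Y X, mcomp g f = mid X /\ mcomp f g = mid Y.

Definition is_pullback (P X T Y : scheme) (p : morphism P X) (q : morphism P T)
    (f : morphism X Y) (g : morphism T Y) : Prop :=
  mcomp f p = mcomp g q /\
  forall (Z : scheme) (a : morphism Z X) (b : morphism Z T),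
    mcomp f a = mcomp g b ->
    exists! u : morphism Z P, mcomp p u = a /\ mcomp q u = b.

Definition homeomorphism (S T : topologicalType) (f : S -> T) : Prop :=
  bijective f /\ forall U : set S, open (f @` U) <-> open U.

Definition universal_homeomorphism (X Y : scheme) (f : morphism X Y) : Prop :=
  forall (T P : scheme) (g : morphism T Y) (p : morphism P X) (q : morphism P T),
    is_pullback p q f g -> homeomorphism q.

(* [cover_compact] is quasi-compactness: no Hausdorff condition is included.
   For schemes, the diagonal is quasi-compact iff any two quasi-compact opens
   have a quasi-compact intersection. *)
Definition quasicompact (X : scheme) : Prop := cover_compact [set: X].

Definition quasiseparated (X : scheme) : Prop :=
  forall U V : set X, open U -> open V -> cover_compact U -> cover_compact V ->
    cover_compact (U `&` V).

Definition coherent (X : scheme) : Prop := quasicompact X /\ quasiseparated X.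

Definition reduced (X : scheme) : Prop :=
  forall (U : opens X) (s : sec U) (n : nat), s ^+ n = 0 -> s = 0.

Definition irreducible (T : topologicalType) (Z : set T) : Prop :=
  Z !=set0 /\ forall C D : set T, closed C -> closed D ->
    Z `<=` C `|` D -> Z `<=` C \/ Z `<=` D.

Definition irreducible_component (T : topologicalType) (Z : set T) : Prop :=
  irreducible Z /\ forall Z' : set T, irreducible Z' -> Z `<=` Z' -> Z' = Z.

(* The irreducible components of an open U are the traces on U of the
   components of X that meet U. *)
Definition locally_finite_components (X : scheme) : Prop :=
  forall U : set X, open U -> cover_compact U ->
    finite_set [set Z : set X | irreducible_component Z /\ Z `&` U !=set0].

Definition generic_points (X : scheme) : set X :=
  [set x | irreducible_component (closure [set x])].

Section Xi.
Variable X : scheme.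

Let point (eta : set_type (@generic_points X)) : X := set_val eta.

Definition Xi : scheme :=
  coprod_spec (fun eta => perfect_closure (residue_field (point eta))).

Definition Xi_map : morphism Xi X :=
  coprod_map (fun eta => to_perfect_closure (residue_field (point eta))).

End Xi.

Definition topologically_rigid (Y : scheme) : Prop :=
  coherent Y /\
  forall (Y' : scheme) (f : morphism Y' Y),
    reduced Y' -> universal_homeomorphism f -> isomorphism f.

(* (Y --i--> W --p--> X) is an initial object of UH_f. *)
Definition weak_normalization (Y X : scheme) (f : morphism Y X) (W : scheme)
    (i : morphism Y W) (p : morphism W X) : Prop :=
  [/\ mcomp p i = f, universal_homeomorphism p
    & forall (X' : scheme) (i' : morphism Y X') (p' : morphism X' X),
        mcomp p' i' = f -> universal_homeomorphism p' ->
        exists! u : morphism W X', mcomp u i = i' /\ mcomp p' u = p].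

(* p : W -> X is the counit at X of the right adjoint to the inclusion of
   topologically rigid schemes into coherent schemes. *)
Definition topological_rigidification (X W : scheme) (p : morphism W X) : Prop :=
  topologically_rigid W /\
  forall (T : scheme) (g : morphism T X), topologically_rigid T ->
    exists! u : morphism T W, mcomp p u = g.

(* Main.v *)
(* For a point x of X let K(x) be the perfect closure of kappa(x), with characteristic
   exponent p. The absolute weak normalization X^awn has the space of X, and its sections
   are the functions b with values b(x) in K(x) such that, near every x, some b^(p^k) differs
   from a regular function by a function a power of which is integral over the ideal of the
   regular germs vanishing at x. It is a reduced scheme, functorial in X, the projection
   X^awn -> X is injective with purely inseparable residue extensions, and
   (X^awn)^awn = X^awn. If P is the pullback of this projection along T -> X, then
   functoriality gives maps P^awn -> T^awn -> P, so that T^awn -> P and P -> T are inverse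
   homeomorphisms: the projection is a universal homeomorphism.

   Conversely let f : Y -> X be a universal homeomorphism. After base change along the
   affine line, injectivity shows that the residue extensions of f are purely inseparable,
   and closedness shows that a section vanishing at y is, near f(y), integral over the ideal
   of f(y). So the sections of Y are functions on X of the above kind, and X^awn -> X factors
   through f; the factorization is unique because X^awn is reduced and f is radicial. Thus
   X^awn is initial among all universal homeomorphisms over X, hence also among those under
   Xi. If T is topologically rigid then T^awn = T, so every T -> X lifts uniquely to X^awn. *)

From HB Require Import structures.
From mathcomp Require Import all_boot all_order all_algebra generic_quotient.
From mathcomp Require Import all_classical topology ring.
Require Import Defs.

Set Implicit Arguments.
Unset Strict Implicit.
Unset Printing Implicit Defensive.

Import GRing.Theory.
Local Open Scope classical_set_scope.
Local Open Scope ring_scope.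

(** * Integral dependence over an ideal *)

(** Apart from the identity, a universal homeomorphism is exploited on a single base change, [Spec
    A[X]] over an affine chart. Its pullback square has to be verified against every scheme, which
    is why maps into an affine open are matched with ring morphisms. The chart must be an affine
    open with affine preimage; the homeomorphism itself supplies one.

    Sections are functions valued in the fields K(x), so glueing costs nothing and equality is
    pointwise. The price is that the scheme axioms must be recovered: that a section with nonzero
    value is a unit nearby, and that affine opens stay affine.

    The error term is asked to be integral over the ideal of germs vanishing at x, and not merely
    over the regular germs. It then vanishes at x, so b(x)^(p^k) is a regular value; and it
    satisfies a relation whose coefficients vanish at x, which can be cleared of denominators and
    read modulo a prime. The exponent p varies with x, so residue characteristics may be mixed: p is
    itself a function vanishing at x, which makes the Frobenius power additive up to an admissible
    error. *)

Section PrimeExistence.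
Variable A : comPzRingType.

Definition is_ideal (I : set A) : Prop :=
  [/\ I 0, forall a b, I a -> I b -> I (a + b) & forall a b, I b -> I (a * b)].

Lemma prime_avoiding (I S : set A) : is_ideal I ->
  S 1 -> (forall a b, S a -> S b -> S (a * b)) -> (forall a, I a -> ~ S a) ->
  exists2 P : prime_ideal A, I `<=` P & forall a, pideal P a -> ~ S a.
Proof.
move=> [I0 ID IM] S1 SM IS.
pose good (J : set A) := is_ideal J /\ I `<=` J /\ (forall a, J a -> ~ S a).
have Iid : is_ideal I by split.
(* Zorn's lemma is applied to all chains, and the union of the empty chain is empty, hence not an
   ideal; the alternative [set0] admits it. *)
pose P (J : set A) := J = set0 \/ good J.
have [F FP Ftot|J [PJ Jmax]] := @Zorn_bigcup A P.
  have [[J0 [FJ0 gJ0]]|none] := pselect (exists J, F J /\ good J); last first.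
    left; apply/seteqP; split=> // a [J FJ Ja].
    by case: (FP J FJ) => [J0|gJ]; [rewrite J0 in Ja|case: none; exists J].
  right; have [[J00 _ _] [IJ0 _]] := gJ0.
  split; first split.
  - by exists J0.
  - move=> a b [J FJ Ja] [K FK Kb].
    have gJ : good J by case: (FP J FJ) => // E; rewrite E in Ja.
    have gK : good K by case: (FP K FK) => // E; rewrite E in Kb.
    case: (Ftot J K FJ FK) => h.
      by exists K => //; case: gK => [[_ KD _] _]; apply: KD => //; exact: h.
    by exists J => //; case: gJ => [[_ JD _] _]; apply: JD => //; exact: h.
  - move=> a b [J FJ Jb]; exists J => //.
    case: (FP J FJ) => [E|[[_ _ JM] _]]; [by rewrite E in Jb|exact: JM].
  - split=> [a Ia|a [J FJ Ja]]; first by exists J0 => //; exact: IJ0.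
    by case: (FP J FJ) => [E|[_ [_ h]]]; [rewrite E in Ja|exact: h].
have gJ : good J.
  case: PJ => // J0; exfalso; apply: (Jmax I); last by right; split=> //; split.
  rewrite J0; split=> // h; exact: (h 0 I0).
case: gJ => [[J0 JD JM] [IJ JS]].
(* By maximality, enlarging [J] by an element outside it produces an ideal that meets [S]. *)
have key a : ~ J a -> exists2 r, S r & exists c d, J d /\ r = c * a + d.
  move=> Ja; pose J' := [set r | exists c d, J d /\ r = c * a + d].
  have JJ' : J `<=` J' by move=> d Jd; exists 0, d; rewrite mul0r add0r.
  have J'a : J' a by exists 1, 0; rewrite mul1r addr0.
  apply: contrapT => none; apply: (Jmax J'); first by split=> // h; apply: Ja; exact: h.
  right; split; first split.
  - exact: JJ'.
  - move=> _ _ [c [d [Jd ->]]] [c' [d' [Jd' ->]]].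
    by exists (c + c'), (d + d'); split; [exact: JD|rewrite mulrDl addrACA].
  - move=> r _ [c [d [Jd ->]]]; exists (r * c), (r * d).
    by split; [exact: JM|rewrite mulrDr mulrA].
  - split=> [x Ix|r [c [d [Jd rE]]] Sr]; first exact/JJ'/IJ.
    by apply: none; exists r => //; exists c, d.
have J1 : ~ J 1 by move=> /JS.
have Jprime a b : J (a * b) -> J a \/ J b.
  move=> Jab; have [|Ja] := pselect (J a); [by left|right].
  apply: contrapT => Jb; have [r Sr [c [d [Jd rE]]]] := key a Ja.
  have [r' Sr' [c' [d' [Jd' rE']]]] := key b Jb.
  apply: (JS (r * r')); last exact: SM.
  rewrite rE rE' mulrDl mulrDr -addrA; apply: (JD).
    by rewrite mulrACA; exact: JM.
  by apply: JD; [exact: JM|rewrite mulrC; exact: JM].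
by exists (PrimeIdeal J0 JD JM J1 Jprime).
Qed.

(** Used by contraposition: a power of [f] lies in [I] once every prime containing [I] contains [f].
    With [I] an ideal of denominators or an annihilator, this takes the place of most finite
    covering arguments. *)
Lemma prime_avoiding_powers (I : set A) (f : A) : is_ideal I ->
  (forall n, ~ I (f ^+ n)) -> exists2 P : prime_ideal A, I `<=` P & ~ pideal P f.
Proof.
move=> Iid If; have [||a Ia [n an]|P IP PS] :=
  @prime_avoiding I [set r | exists n, r = f ^+ n] Iid.
- by exists 0%N; rewrite expr0.
- by move=> _ _ [m ->] [n ->]; exists (m + n)%N; rewrite exprD.
- by apply: (If n); rewrite -an.
by exists P => // Pf; apply: (PS f Pf); exists 1%N.
Qed.

Lemma ideal_sum (I : set A) J (r : seq J) (p : pred J) (F : J -> A) : is_ideal I ->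
  (forall j, p j -> I (F j)) -> I (\sum_(j <- r | p j) F j).
Proof. by move=> [I0 ID _] h; elim/big_ind: _. Qed.

Lemma prime_ideal_is_ideal (P : prime_ideal A) : is_ideal P.
Proof. by split; [exact: pideal0|exact: pidealD|exact: pidealM]. Qed.

Lemma pidealX (P : prime_ideal A) a n : pideal P (a ^+ n) -> pideal P a.
Proof.
elim: n => [|n IHn]; first by rewrite expr0 => /pideal1.
by rewrite exprS => /pideal_prime[].
Qed.

Lemma pidealN (P : prime_ideal A) a : pideal P a -> pideal P (- a).
Proof. by rewrite -mulN1r; exact: pidealM. Qed.

End PrimeExistence.

Section Integral.
Variable R : comPzRingType.
Implicit Types (S E : set R) (a b c r u : R).

Inductive span S E : R -> Prop :=
| span0 : span S E 0
| span_cons s u r : S s -> E u -> span S E r -> span S E (s * u + r).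

(** Integrality in module form: multiplication by [c] sends the finite family [E] into its span with
    coefficients in [S], and [1 \in E] makes the module faithful. The same formula serves for a
    subring and for an ideal, and its stability under sums and products needs no resultants. *)
Definition integral S c : Prop := exists E : seq R,
  1 \in E /\ forall u, u \in E -> span S [set` E] (c * u).

(* For an ideal I: some power of c satisfies an equation of integral dependence over I. *)
Definition rad_integral I c : Prop := exists n, integral I (c ^+ n.+1).

Lemma span1 S E s u : S s -> E u -> span S E (s * u).
Proof. by move=> Ss Eu; rewrite -[_ * _]addr0; apply: span_cons => //; exact: span0. Qed.

Lemma spanD S E r r' : span S E r -> span S E r' -> span S E (r + r').
Proof. by elim=> [|s u t Ss Eu _ IH] h; rewrite ?add0r // -addrA; apply: span_cons; auto. Qed.

Lemma spanW S S' E E' r : S `<=` S' -> E `<=` E' -> span S E r -> span S' E' r.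
Proof.
by move=> hS hE; elim=> [|s u t Ss Eu _ IH]; [exact: span0|apply: span_cons => //; auto].
Qed.

Lemma span_sum S E J (s : seq J) (p : pred J) (F : J -> R) :
  (forall j, p j -> span S E (F j)) -> span S E (\sum_(j <- s | p j) F j).
Proof. by move=> h; elim/big_ind: _ => //; [exact: span0|exact: spanD]. Qed.

Lemma spanM (S S' S'' E E' E'' : set R) r r' :
  (forall s s', S s -> S' s' -> S'' (s * s')) ->
  (forall u u', E u -> E' u' -> E'' (u * u')) ->
  span S E r -> span S' E' r' -> span S'' E'' (r * r').
Proof.
move=> hS hE; elim=> [|s u t Ss Eu _ IH] h; first by rewrite mul0r; exact: span0.
rewrite mulrDl; apply: spanD; last exact: IH.
elim: h => [|s' u' t' Ss' Eu' _ IH']; first by rewrite mulr0; exact: span0.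
by rewrite mulrDr mulrACA; apply: spanD => //; apply: span1; auto.
Qed.

Lemma integralW S S' c : S `<=` S' -> integral S c -> integral S' c.
Proof. by move=> h [E [E1 cE]]; exists E; split=> // u /cE; exact: spanW. Qed.

Section Subring.
Variable A : set R.
Hypotheses (A1 : A 1) (AN1 : A (- 1)).
Hypotheses (AD : forall a b, A a -> A b -> A (a + b))
           (AM : forall a b, A a -> A b -> A (a * b)).

Let AX a n : A a -> A (a ^+ n).
Proof. by move=> Aa; elim: n => [|n IHn]; rewrite ?expr0 // exprS; exact: AM. Qed.

Lemma integral_id a : A a -> integral A a.
Proof.
move=> Aa; exists [:: 1]; split=> [|u]; rewrite !inE // => /eqP ->.
by apply: span1 => //=; rewrite inE.
Qed.

Section Ideal.
Variable I : set R.
Hypotheses (I0 : I 0) (IA : I `<=` A) (ID : forall a b, I a -> I b -> I (a + b))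
           (IM : forall a b, A a -> I b -> I (a * b)).

Let spanX (S S' S'' : set R) (E E' : seq R) r r' :
  (forall s s', S s -> S' s' -> S'' (s * s')) ->
  span S [set` E] r -> span S' [set` E'] r' ->
  span S'' [set` [seq u * v | u <- E, v <- E']] (r * r').
Proof.
move=> hS; apply: spanM => // u u' Eu Eu'; exact: allpairs_f.
Qed.

Let one_in (E E' : seq R) : 1 \in E -> 1 \in E' ->
  1 \in [seq u * v | u <- E, v <- E'].
Proof. by move=> E1 E'1; rewrite -[X in X \in _]mulr1; exact: allpairs_f. Qed.

Let span_in (E : seq R) u : u \in E -> span A [set` E] u.
Proof. by move=> Eu; rewrite -[u]mul1r; exact: span1. Qed.

Lemma integral_idealI a : I a -> integral I a.
Proof.
move=> Ia; exists [:: 1]; split=> [|u]; rewrite !inE // => /eqP ->.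
by apply: span1 => //=; rewrite inE.
Qed.

(** The pairwise products of the two witnessing families witness the sum: each summand moves one
    factor and leaves the other alone. *)
Lemma integral_idealD c c' : integral I c -> integral I c' -> integral I (c + c').
Proof.
move=> [E [E1 cE]] [E' [E'1 cE']]; exists [seq u * v | u <- E, v <- E'].
split=> [|_ /allpairsP[[u v] [/= Eu Ev ->]]]; first exact: one_in.
rewrite mulrDl mulrA [c' * _]mulrCA; apply: spanD.
  apply: (spanX _ (cE _ Eu) (span_in Ev)) => s s' Is As'.
  by rewrite mulrC; exact: IM.
by apply: (spanX _ (span_in Eu) (cE' _ Ev)).
Qed.

Lemma integral_idealM c d : integral A c -> integral I d -> integral I (c * d).
Proof.
move=> [E [E1 cE]] [E' [E'1 dE']]; exists [seq u * v | u <- E, v <- E'].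
split=> [|_ /allpairsP[[u v] [/= Eu Ev ->]]]; first exact: one_in.
by rewrite mulrACA; apply: (spanX _ (cE _ Eu) (dE' _ Ev)).
Qed.

Lemma integral_ideal_sum J (s : seq J) (p : pred J) (F : J -> R) :
  (forall j, p j -> integral I (F j)) -> integral I (\sum_(j <- s | p j) F j).
Proof.
move=> h; elim/big_ind: _ => //; [exact: integral_idealI|exact: integral_idealD].
Qed.

Lemma span_scale (E : set R) h r : I h -> span A E r -> span I E (h * r).
Proof.
move=> Ih; elim=> [|s u t As Eu _ IH]; first by rewrite mulr0; exact: span0.
by rewrite mulrDr mulrA; apply: span_cons => //; rewrite mulrC; exact: IM.
Qed.

(** The family is 1, c, ..., c^M, and higher powers reduce by the equation. The coefficients lie in
    [I] but not in the increasing powers of [I] that an equation of integral dependence over [I]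
    requires, so the conclusion is about c^(M+1) and not about c. *)
Lemma monic_integral c M (h : nat -> R) : (forall i, I (h i)) ->
  c ^+ M.+1 = \sum_(i < M.+1) h i * c ^+ i -> integral I (c ^+ M.+1).
Proof.
move=> Ih cM; exists [seq c ^+ i | i <- iota 0 M.+1].
set E := [seq _ | _ <- _]; have inE i : (i < M.+1)%N -> [set` E] (c ^+ i).
  by move=> iM; apply: map_f; rewrite mem_iota.
split; first by have := inE 0%N isT; rewrite expr0.
move=> _ /mapP[k _ ->]; rewrite -exprD; elim/ltn_ind: k => k IHk.
rewrite exprD cM mulr_suml; apply: span_sum => i _; rewrite -mulrA -exprD.
have [ik|ik] := ltnP (i + k) M.+1; first exact: span1 (Ih _) (inE _ ik).
apply: span_scale => //; rewrite -(subnKC ik).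
apply: (spanW IA (@subset_refl _ _)); apply: IHk.
by rewrite ltn_subLR // ltn_add2r ltn_ord.
Qed.

Definition powers c : set R := [set r | exists j, r = c ^+ j].

Let PE c : forall u u', powers c u -> powers c u' -> powers c (u * u').
Proof. by move=> _ _ [i ->] [j ->]; exists (i + j)%N; rewrite exprD. Qed.

Let span_coord (E : seq R) r : span I [set` E] r ->
  exists2 m : 'I_(size E) -> R, (forall j, I (m j)) & r = \sum_j m j * E`_j.
Proof.
elim=> [|s u t Is Eu _ [m Im ->]].
  by exists (fun=> 0) => //; rewrite big1 // => j _; rewrite mul0r.
have ku : (index u E < size E)%N by rewrite index_mem.
pose k := Ordinal ku; exists (fun j => m j + (j == k)%:R * s).
  move=> j; apply: ID => //; case: eqP => _; rewrite ?mul1r ?mul0r //.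
rewrite [RHS](eq_bigr (fun j => (j == k)%:R * s * E`_j + m j * E`_j)); last first.
  by move=> j _; rewrite mulrDl addrC.
rewrite big_split /=; congr (_ + _).
rewrite (bigD1 k) //= eqxx mul1r nth_index // big1 ?addr0 //.
by move=> j /negPf ->; rewrite !mul0r.
Qed.

(** Determinant trick. The matrix c - m kills the vector of the family, one entry of which is 1, so
    its determinant is 0. As m has entries in [I], the determinant is also congruent to the
    corresponding power of c; [rho] is this congruence modulo I A[c], carried through the Leibniz
    formula. *)
Lemma integral_power c : integral I c -> exists d, span I (powers c) (c ^+ d.+1).
Proof.
move=> [E [E1 cE]]; have k0P : (index 1%R E < size E)%N by rewrite index_mem.
pose k0 := Ordinal k0P.
have /choice[m /all_and2[Im mE]] : forall i : 'I_(size E), exists m : 'I_(size E) -> R,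
    (forall j, I (m j)) /\ c * E`_i = \sum_j m j * E`_j.
  by move=> i; have [m ? ?] := span_coord (cE _ (mem_nth 0 (ltn_ord i))); exists m.
pose rho (x y : R) := [/\ span A (powers c) x, span A (powers c) y &
   span I (powers c) (x - y)].
have rhoD x y x' y' : rho x y -> rho x' y' -> rho (x + x') (y + y').
  move=> [h1 h2 h3] [h1' h2' h3']; split; try exact: spanD.
  by rewrite opprD addrACA; exact: spanD.
have rhoM x y x' y' : rho x y -> rho x' y' -> rho (x * x') (y * y').
  move=> [h1 h2 h3] [h1' h2' h3']; split; try exact: (spanM AM (@PE c)).
  rewrite -(subrK (y * x') (x * x')) -addrA -mulrBl -mulrBr; apply: spanD.
    apply: (spanM _ (@PE c) h3 h1') => s s' Is As'; by rewrite mulrC; exact: IM.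
  exact: (spanM IM (@PE c) h2 h3').
have rhoA x : A x -> rho x x.
  have x1 y : A y -> span A (powers c) y.
    by move=> Ay; rewrite -[y]mulr1; apply: span1 => //; exists 0%N; rewrite expr0.
  by move=> Ax; split; rewrite ?subrr; [exact: x1|exact: x1|exact: span0].
have rhoI x : I x -> rho x 0.
  move=> Ix; have [h1 _ _] := rhoA x (IA Ix); split => //; first exact: span0.
  rewrite subr0 -[x]mulr1; apply: span1 => //; by exists 0%N; rewrite expr0.
have rhoc : rho c c.
  have h : span A (powers c) c.
    by rewrite -[X in span _ _ X]mul1r; apply: span1 => //; exists 1%N; rewrite expr1.
  by split=> //; rewrite subrr; exact: span0.
pose M := \matrix_(i, j) (c *+ (i == j) - m i j).
have [_ _] : rho (\det M) (\det (c%:M : 'M_(size E))).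
  rewrite /determinant; elim/big_ind2: _ => [|*|s _]; [by apply: rhoI|exact: rhoD|].
  apply: (rhoM).
    by apply: (rhoA); apply: AX.
  elim/big_ind2: _ => [|*|i _]; [by apply: (rhoA)|exact: rhoM|].
  rewrite !mxE; case: (_ == _); rewrite ?mulr1n ?mulr0n.
    rewrite -[X in rho _ X]addr0; apply: (rhoD) => //; rewrite -mulN1r -(mulr0 (-1)).
    by apply: (rhoM); [exact: rhoA|exact: rhoI].
  rewrite sub0r -mulN1r -(mulr0 (-1)); apply: (rhoM); [exact: rhoA|exact: rhoI].
have -> : \det M = 0.
  pose v : 'cV_(size E) := \col_j E`_j.
  have Mv : M *m v = 0.
    apply/colP => i; rewrite !mxE.
    under eq_bigr do rewrite !mxE mulrBl.
    rewrite sumrB -mE (bigD1 i) //= eqxx mulr1n big1 ?addr0 ?subrr // => j.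
    by rewrite eq_sym => /negPf ->; rewrite mulr0n mul0r.
  have : (\det M)%:M *m v = 0 by rewrite -mul_adj_mx -mulmxA Mv mulmx0.
  move=> /colP/(_ k0); rewrite mul_scalar_mx !mxE nth_index //.
  by rewrite mulr1.
rewrite det_scalar sub0r; move=> h; exists (size E).-1.
rewrite prednK; last exact: (leq_ltn_trans (leq0n _) k0P).
rewrite -[X in span _ _ X]opprK -mulN1r.
have AI : forall s s', A s -> I s' -> I (s * s') by exact: IM.
apply: (spanM AI (@PE c) _ h); rewrite -[X in span _ _ X]mulr1.
by apply: span1 => //; exists 0%N; rewrite expr0.
Qed.

(** On the family u c^k with k <= n, multiplication by c shifts k, and at k = n it falls back on the
    relation for c^(n+1) u. *)
Lemma integral_root c n : integral A (c ^+ n.+1) -> integral A c.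
Proof.
move=> [E [E1 cE]]; exists [seq u * c ^+ k | u <- E, k <- iota 0 n.+1].
have E1' u k : u \in E -> (k < n.+1)%N ->
    u * c ^+ k \in [seq u * c ^+ k | u <- E, k <- iota 0 n.+1].
  by move=> uE kn; apply: allpairs_f => //; rewrite mem_iota.
split=> [|_ /allpairsP[[u k] [uE + ->]]].
  by have := E1' 1 0%N E1 isT; rewrite expr0 mulr1.
rewrite mem_iota add0n /= mulrCA -exprS leq_eqVlt => /orP[/eqP[->]|kn].
  rewrite mulrC; apply: spanW (cE _ uE) => // v Ev.
  by rewrite /= -[v]mulr1 -(expr0 c); exact: E1'.
by rewrite -[_ * _]mul1r; apply: span1 => //; exact: E1'.
Qed.

End Ideal.
End Subring.

(* The germs of regular functions at a point, the ideal of those vanishing there,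
   and the characteristic exponent of the residue field. *)
Record germ_ring := GermRing {
  gring : set R;
  gideal : set R;
  gexp : nat;
  gring1 : gring 1;
  gringN1 : gring (- 1);
  gringD : forall a b, gring a -> gring b -> gring (a + b);
  gringM : forall a b, gring a -> gring b -> gring (a * b);
  gideal0 : gideal 0;
  gideal_sub : gideal `<=` gring;
  gidealD : forall a b, gideal a -> gideal b -> gideal (a + b);
  gidealM : forall a b, gring a -> gideal b -> gideal (a * b);
  gexpP : gexp = 1%N \/ prime gexp /\ gideal gexp%:R }.

(** * Weakly normal germs over an abstract ring of regular germs *)

Section GermRing.
Variable G : germ_ring.
Local Notation A := (gring G).
Local Notation I := (gideal G).
Local Notation e := (gexp G).
Local Notation rad := (rad_integral I).

Let A1 : A 1 := gring1 G.
Let AN1 : A (- 1) := gringN1 G.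
Let AD := @gringD G.
Let AM := @gringM G.
Let I0 : I 0 := gideal0 G.
Let IA := @gideal_sub G.
Let ID := @gidealD G.
Let IM := @gidealM G.

Let A0 : A 0. Proof. by rewrite -(subrr 1); exact: AD. Qed.
Let AX a n : A a -> A (a ^+ n).
Proof. by move=> Aa; elim: n => [|n IHn]; rewrite ?expr0 // exprS; exact: AM. Qed.

Lemma rad_id a : I a -> rad a.
Proof. by move=> Ia; exists 0%N; exact: integral_idealI. Qed.

Lemma rad_integral_integral c : rad c -> integral A c.
Proof. by move=> [n /(integralW IA)/(integral_root A1)]. Qed.

Lemma integralD c c' : integral A c -> integral A c' -> integral A (c + c').
Proof. exact: (integral_idealD A1 AM). Qed.

Lemma integralM c c' : integral A c -> integral A c' -> integral A (c * c').
Proof. exact: (integral_idealM AM). Qed.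

Lemma integralX c n : integral A c -> integral A (c ^+ n).
Proof.
move=> ic; elim: n => [|n IHn]; first by rewrite expr0; exact: integral_id.
by rewrite exprS; exact: integralM.
Qed.

Lemma integralN c : integral A c -> integral A (- c).
Proof. by rewrite -mulN1r; apply: integralM; exact: integral_id. Qed.

Lemma integralB c c' : integral A c -> integral A c' -> integral A (c - c').
Proof. by move=> h /integralN; exact: integralD. Qed.

Lemma integral_sum J (s : seq J) (p : pred J) (F : J -> R) :
  (forall j, p j -> integral A (F j)) -> integral A (\sum_(j <- s | p j) F j).
Proof.
by move=> h; elim/big_ind: _ => //; [exact: integral_id|exact: integralD].
Qed.

Lemma integralMn c n : integral A c -> integral A (c *+ n).
Proof.
move=> ic; elim: n => [|n IHn]; first by rewrite mulr0n; exact: integral_id.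
by rewrite mulrS; exact: integralD.
Qed.

Let rad_int c : rad c -> integral A c. Proof. exact: rad_integral_integral. Qed.

Lemma radM c d : integral A c -> rad d -> rad (c * d).
Proof.
move=> ic [n hd]; exists n; rewrite exprMn; apply: (integral_idealM IM) => //.
exact: integralX.
Qed.

Lemma radD c d : rad c -> rad d -> rad (c + d).
Proof.
move=> rc rd; have [ic id] := (rad_int rc, rad_int rd).
(* Every term of the expansion of (c + d)^(m+n+1) contains c^(m+1) or d^(n+1), multiplied by
   something integral over [A]. *)
case: rc rd => [m hc] [n hd]; exists (m + n)%N; rewrite exprDn.
apply: (integral_ideal_sum A1 I0 IM) => -[i /= _] _; rewrite -mulr_natl.
apply: (integral_idealM IM) => //.
  by rewrite -[_%:R]/(1 *+ _); apply: integralMn; exact: integral_id.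
have [ni|ni] := ltnP n i.
  rewrite -(subnK ni) exprD mulrA; apply: (integral_idealM IM) => //.
  by apply: integralM; exact: integralX.
have mi : (m.+1 <= (m + n).+1 - i)%N by rewrite leq_subRL; [rewrite addnC -addSn leq_add2l|rewrite ltnW // ltnS (leq_trans ni) // leq_addl].
rewrite -(subnK mi) exprD mulrAC; apply: (integral_idealM IM) => //.
by apply: integralM; exact: integralX.
Qed.

Lemma rad_root c n : rad (c ^+ n.+1) -> rad c.
Proof.
by move=> [m]; rewrite -exprM mulnS addSn => h; exists (n + (n.+1 * m))%N.
Qed.

Lemma rad0 : rad 0. Proof. exact: rad_id. Qed.

Lemma rad_sum J (s : seq J) (p : pred J) (F : J -> R) :
  (forall j, p j -> rad (F j)) -> rad (\sum_(j <- s | p j) F j).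
Proof. by move=> h; elim/big_ind: _ => //; [exact: rad0|exact: radD]. Qed.

Lemma radN c : rad c -> rad (- c).
Proof. by rewrite -mulN1r; apply: radM; exact: integral_id. Qed.

Lemma rad_span S E r : S `<=` rad -> E `<=` integral A -> span S E r -> rad r.
Proof.
move=> hS hE; elim=> [|s u t Ss Eu _ IH]; first exact: rad0.
by apply: radD => //; rewrite mulrC; apply: radM; [exact: hE|exact: hS].
Qed.

Lemma rad_exp u v n : integral A u -> integral A v ->
  rad (u - v) -> rad (u ^+ n - v ^+ n).
Proof.
move=> iu iv h; rewrite subrXX mulrC; apply: radM => //.
by apply: integral_sum => i _; apply: integralM; exact: integralX.
Qed.

(** The working form of [rad]: a relation for c alone with coefficients in [I]. Unlike a witnessing
    family, it can be evaluated at a point, multiplied by denominators, or have another element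
    substituted for c. *)
Lemma rad_power c : rad c -> exists d, span I (powers c) (c ^+ d.+1).
Proof.
move=> [n /(integral_power A1 AN1 AM I0 IA ID IM)[d h]].
exists (n + (n.+1 * d))%N; move: h; rewrite -exprM mulnS addSn; apply: spanW => //.
by move=> _ [j ->]; exists (n.+1 * j)%N; rewrite exprM.
Qed.

Let eI := @gexpP G.

(* The germs of sections of the absolute weak normalization: up to a power of the
   characteristic exponent, a regular germ plus a germ integral over the maximal ideal. *)
Definition wsub b : Prop := exists k a, A a /\ rad (b ^+ (e ^ k) - a).

Let e_gt0 k : exists n, (e ^ k)%N = n.+1.
Proof.
exists (e ^ k).-1; rewrite prednK // expn_gt0.
by case: eI => [->|[/prime_gt0 -> _]].
Qed.

Lemma wsub_integral b : wsub b -> integral A b.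
Proof.
move=> [k [a [Aa /rad_int h]]]; have [n en] := e_gt0 k.
apply: (integral_root A1 (n := n)); rewrite -en -(subrK a (b ^+ _)).
by apply: integralD => //; exact: integral_id.
Qed.

Lemma wsub_id a : A a -> wsub a.
Proof.
by move=> Aa; exists 0%N, a; split=> //; rewrite expn0 expr1 subrr; exact: rad0.
Qed.

Lemma rad_wsub c : rad c -> wsub c.
Proof. by move=> h; exists 0%N, 0; split=> //; rewrite subr0 expn0 expr1. Qed.

(** The exponent is 1 or a prime lying in [I]. In the second case it divides the middle binomial
    coefficients, so the cross terms are integral elements times an element of [I]. *)
Lemma wsub_frobenius k u v : integral A u -> integral A v ->
  rad ((u + v) ^+ (e ^ k) - (u ^+ (e ^ k) + v ^+ (e ^ k))).
Proof.
case: eI => [->|[pe Ie]] iu iv.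
  by rewrite exp1n !expr1 subrr; exact: rad0.
elim: k => [|k IHk]; first by rewrite expn0 !expr1 subrr; exact: rad0.
have iuk := integralX (e ^ k) iu; have ivk := integralX (e ^ k) iv.
rewrite expnSr !exprM; set x := (u + v) ^+ _; set y := u ^+ _; set z := v ^+ _.
rewrite -(subrK ((y + z) ^+ e) (x ^+ e)) -addrA; apply: radD.
  apply: rad_exp => //; [exact/integralX/integralD|exact: integralD].
have [p ep] : exists p, e = p.+1 by exists e.-1; rewrite prednK // prime_gt0.
rewrite ep in pe Ie *; clear ep.
have -> : (y + z) ^+ p.+1 - (y ^+ p.+1 + z ^+ p.+1) =
    \sum_(i < p) y ^+ (p - i) * z ^+ i.+1 *+ 'C(p.+1, i.+1).
  rewrite exprDn big_ord_recl big_ord_recr /= subn0 expr0 mulr1 bin0 mulr1n.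
  rewrite /bump /= add1n subnn expr0 mul1r binn mulr1n [X in _ + X - _]addrC.
  by rewrite [y ^+ _ + (_ + _)]addrA [LHS]addrC addKr; apply: eq_bigr => i _; rewrite add1n subSS.
apply: rad_sum => i _.
have /dvdnP[m ->] : (p.+1 %| 'C(p.+1, i.+1))%N.
  by apply: prime_dvd_bin => //=; rewrite ltnS.
rewrite mulrnA -mulr_natr; apply: radM; last exact: rad_id.
by apply: integralMn; apply: integralM; exact: integralX.
Qed.

Let wsub_raise b k a j : integral A b -> A a -> rad (b ^+ (e ^ k) - a) ->
  rad (b ^+ (e ^ (k + j)) - a ^+ (e ^ j)).
Proof.
by move=> ib Aa h; rewrite expnD exprM; apply: rad_exp => //;
  [exact: integralX|exact: integral_id].
Qed.

Lemma wsub_common b b' : wsub b -> wsub b' -> exists k a a',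
  [/\ A a, A a', rad (b ^+ (e ^ k) - a) & rad (b' ^+ (e ^ k) - a')].
Proof.
move=> wb wb'; have [ib ib'] := (wsub_integral wb, wsub_integral wb').
case: wb wb' => k [a [Aa h]] [k' [a' [Aa' h']]].
exists (k + k')%N, (a ^+ (e ^ k')), (a' ^+ (e ^ k)); split; try exact: AX.
  exact: wsub_raise.
by rewrite addnC; exact: wsub_raise.
Qed.

Lemma wsubD b b' : wsub b -> wsub b' -> wsub (b + b').
Proof.
move=> wb wb'; have [ib ib'] := (wsub_integral wb, wsub_integral wb').
have [k [a [a' [Aa Aa' h h']]]] := wsub_common wb wb'.
exists k, (a + a'); split; first exact: AD.
rewrite -(subrK (b ^+ (e ^ k) + b' ^+ (e ^ k)) ((b + b') ^+ _)) -addrA.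
apply: radD; first exact: wsub_frobenius.
by rewrite opprD addrACA; exact: radD.
Qed.

Lemma wsubM b b' : wsub b -> wsub b' -> wsub (b * b').
Proof.
move=> wb wb'; have [ib ib'] := (wsub_integral wb, wsub_integral wb').
have [k [a [a' [Aa Aa' h h']]]] := wsub_common wb wb'.
exists k, (a * a'); split; first exact: AM.
rewrite exprMn -(subrK (b' ^+ (e ^ k) * a) (_ * _)) -addrA; apply: radD.
  by rewrite [X in X - _]mulrC -mulrBr; apply: radM => //; exact: integralX.
by rewrite [X in X - _]mulrC -mulrBr; apply: radM => //; exact: integral_id.
Qed.

Section Transitivity.

Let works (F : seq R) s := forall f, f \in F -> span A [set` F] (s * f).
Let mulseq (F F' : seq R) := [seq u * v | u <- F, v <- F'].

Let works_mulr F F' s : works F' s -> works (mulseq F F') s.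
Proof.
move=> h _ /allpairsP[[u v] [/= Fu Fv ->]]; rewrite mulrCA.
have := h v Fv; have : span A [set` F] u by rewrite -[u]mul1r; exact: span1.
move=> hv hu; apply: (spanM AM _ hv hu) => x y Fx Fy; exact: allpairs_f.
Qed.

Let mulseq1 (F F' : seq R) : 1 \in F -> 1 \in F' -> 1 \in mulseq F F'.
Proof. by move=> F1 F'1; rewrite -[X in X \in _]mulr1; exact: allpairs_f. Qed.

Let fam (E F : seq R) r := forall f, f \in F -> span A [set` mulseq E F] (r * f).

Let fam_mull (E F F' : seq R) r : fam E F r -> fam E (mulseq F F') r.
Proof.
move=> h _ /allpairsP[[u v] [/= Fu Fv ->]]; rewrite mulrA.
have := h u Fu; have : span A [set` F'] v by rewrite -[v]mul1r; exact: span1.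
move=> hv hu; apply: (spanM AM _ hu hv) => _ y /allpairsP[[p q] [/= Ep Fq ->]] Fy.
by rewrite -mulrA; apply: allpairs_f => //; exact: allpairs_f.
Qed.

Let fam_mulr (E F F' : seq R) r : fam E F' r -> fam E (mulseq F F') r.
Proof.
move=> h _ /allpairsP[[u v] [/= Fu Fv ->]]; rewrite mulrCA.
have := h v Fv; have : span A [set` F] u by rewrite -[u]mul1r; exact: span1.
move=> hv hu; apply: (spanM AM _ hv hu) => x _ Fx /allpairsP[[p q] [/= Ep Fq ->]].
by rewrite mulrCA; apply: allpairs_f => //; exact: allpairs_f.
Qed.

(** Only finitely many coefficients from [S] occur in the relations for c. Multiplying their
    witnessing families gives one [F] with (c u) F inside the [A]-span of E F for every u in [E];
    then E F is a family for c over [A]. *)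
Lemma integral_trans S c : S `<=` integral A -> integral S c -> integral A c.
Proof.
move=> hS [E [E1 cE]].
have one r : span S [set` E] r -> exists F, 1 \in F /\ fam E F r.
  elim=> [|s u t Ss Eu _ [F [F1 hF]]].
    by exists [:: 1]; split; [rewrite inE|move=> f _; rewrite mul0r; exact: span0].
  have [F' [F'1 sF']] := hS s Ss.
  exists (mulseq F F'); split; first exact: mulseq1.
  move=> f Ff; rewrite mulrDl; apply: spanD; last exact: (fam_mull hF).
  have := (@works_mulr F F' s sF') f Ff => h.
  have hu : span A [set` E] u by rewrite -[u]mul1r; exact: span1.
  rewrite mulrAC mulrC; apply: (spanM AM _ hu h) => x y Ex Fy; exact: allpairs_f.
have all (L : seq R) : (forall r, r \in L -> span S [set` E] r) ->
    exists F, 1 \in F /\ forall r, r \in L -> fam E F r.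
  elim: L => [_|r L IHL hL]; first by exists [:: 1]; rewrite inE.
  have [|F [F1 hF]] := IHL; first by move=> q qL; apply: hL; rewrite inE qL orbT.
  have [|F' [F'1 hF']] := one r; first by apply: hL; rewrite mem_head.
  exists (mulseq F F'); split=> [|q]; first exact: mulseq1.
  by rewrite inE => /orP[/eqP ->|/hF]; [exact: fam_mulr|exact: fam_mull].
have [|F [F1 hF]] := all [seq c * u | u <- E].
  by move=> _ /mapP[u uE ->]; exact: cE.
exists (mulseq E F); split; first exact: mulseq1.
move=> _ /allpairsP[[u v] [/= Eu Fv ->]]; rewrite mulrA; apply: hF => //.
exact: map_f.
Qed.

End Transitivity.
End GermRing.
(** The algebraic core of idempotence. Two successive approximations, b^(e^k) by a and a^(e^k') by
    a0, compose; the first error is integral over the larger ideal only, and [rad_power] brings it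
    down to [G]. *)
Lemma wsub_trans (G G' : germ_ring) b : gexp G' = gexp G ->
  gring G' `<=` wsub G -> gideal G' `<=` rad_integral (gideal G) ->
  wsub G' b -> wsub G b.
Proof.
move=> he hA hI wb.
have intA : gring G' `<=` integral (gring G) by move=> a /hA; exact: wsub_integral.
have ib : integral (gring G) b by apply: integral_trans intA _; exact: wsub_integral wb.
case: wb => k [a [A'a h]].
have ic := integral_trans intA (rad_integral_integral h).
have [d hd] := rad_power h.
have rc : rad_integral (gideal G) (b ^+ (gexp G' ^ k) - a).
  apply: (@rad_root G _ d); apply: rad_span hd => // _ [j ->]; exact: integralX.
have [k' [a0 [Aa0 h0]]] := hA a A'a.
exists (k + k')%N, a0; split=> //.
rewrite expnD exprM -(subrK (a ^+ (gexp G ^ k')) (_ ^+ _ ^+ _)) -addrA; apply: radD => //.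
by apply: rad_exp; [exact: integralX|exact: intA|rewrite -he].
Qed.

End Integral.

Section IntegralMorphism.
Variables (R R' : comPzRingType) (f : {rmorphism R -> R'}).

Lemma span_morph (S E : set R) (S' E' : set R') r :
  (forall s, S s -> S' (f s)) -> (forall u, E u -> E' (f u)) ->
  span S E r -> span S' E' (f r).
Proof.
move=> hS hE; elim=> [|s u t Ss Eu _ IH]; first by rewrite rmorph0; exact: span0.
by rewrite rmorphD rmorphM; apply: span_cons; auto.
Qed.

Lemma integral_morph (S : set R) (S' : set R') c :
  (forall s, S s -> S' (f s)) -> integral S c -> integral S' (f c).
Proof.
move=> hS [E [E1 cE]]; exists (map f E); split.
  by rewrite -(rmorph1 f); exact: map_f.
move=> _ /mapP[u uE ->]; rewrite -rmorphM; apply: span_morph (cE u uE) => // v Ev.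
exact: map_f.
Qed.

Lemma wsub_morph (G : germ_ring R) (G' : germ_ring R') b :
  (forall a, gring G a -> gring G' (f a)) ->
  (forall a, gideal G a -> gideal G' (f a)) -> gexp G = gexp G' ->
  wsub G b -> wsub G' (f b).
Proof.
move=> hA hI he [k [a [Aa [n h]]]]; exists k, (f a); split; first exact: hA.
by exists n; rewrite -he -rmorphXn -rmorphB -rmorphXn; exact: integral_morph h.
Qed.

End IntegralMorphism.

(** * Affine opens and reduced schemes *)

Section RingFacts.

Lemma invertibleM (A : comPzRingType) (a b : A) :
  invertible (a * b) <-> invertible a /\ invertible b.
Proof.
split=> [[c abc]|[[a' aa'] [b' bb']]].
  by split; [exists (b * c)|exists (a * c)]; rewrite -abc ?mulrA // [b * a]mulrC.
by exists (a' * b'); rewrite mulrACA aa' bb' mulr1.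
Qed.

Lemma invertibleX (A : comPzRingType) (a : A) n : invertible a -> invertible (a ^+ n).
Proof. by move=> [b ab]; exists (b ^+ n); rewrite -exprMn ab expr1n. Qed.

Lemma invertible_morph (A B : comPzRingType) (f : {rmorphism A -> B}) (a : A) :
  invertible a -> invertible (f a).
Proof. by move=> [b ab]; exists (f b); rewrite -rmorphM ab rmorph1. Qed.

Lemma invertible_field (K : fieldType) (a : K) : invertible a <-> a != 0.
Proof.
split=> [[b]|a0]; last by exists a^-1; rewrite divff.
by move=> ab; apply/eqP => a0; move/eqP: ab; rewrite a0 mul0r eq_sym oner_eq0.
Qed.

Lemma invertible_cancel (A : comPzRingType) (u a b : A) :
  invertible u -> a * u = b * u -> a = b.
Proof.
by move=> [v uv] /(congr1 (fun x => x * v)); rewrite -!mulrA uv !mulr1.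
Qed.

Definition contraction (A B : comPzRingType) (f : {rmorphism A -> B})
  (P : prime_ideal B) : prime_ideal A.
refine (@PrimeIdeal A [set a | pideal P (f a)] _ _ _ _ _) => /=.
- by rewrite rmorph0; exact: pideal0.
- by move=> a b; rewrite rmorphD; exact: pidealD.
- by move=> a b; rewrite rmorphM; exact: pidealM.
- by rewrite rmorph1; exact: pideal1.
- by move=> a b; rewrite rmorphM; exact: pideal_prime.
Defined.

End RingFacts.

Section Sections.
Variable X : ringed_space.

Lemma germ_unit_dom (x : X) (U : opens X) (s : sec U) : germ_unit x s -> oset U x.
Proof. by move=> [V [h [Vx _]]]; exact: h. Qed.

Lemma open_germ_unit (U : opens X) (s : sec U) : open [set x : X | germ_unit x s].
Proof.
rewrite (_ : [set _ | _] = \bigcup_(V in [set V : opens X |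
    exists h : V `<=` U, invertible (res h s)]) V).
  by apply: bigcup_open => V _; exact: oopen.
apply/seteqP; split=> [x [V [h [Vx inv]]]|x [V [h inv] Vx]].
  by exists V => //; exists h.
by exists V, h.
Qed.

Definition nonvan (U : opens X) (s : sec U) : opens X := Opens (open_germ_unit s).

Lemma nonvan_sub (U : opens X) (s : sec U) : nonvan s `<=` U.
Proof. by move=> x /germ_unit_dom. Qed.

Lemma germ_unitM (x : X) (U : opens X) (s t : sec U) :
  germ_unit x (s * t) <-> germ_unit x s /\ germ_unit x t.
Proof.
split=> [st|[[V [h [Vx sV]]] [W [k [Wx tW]]]]].
  by split; [move: st; rewrite mulrC|move: st] => /germ_unitMr.
have hI : ointer V W `<=` V by exact: subIsetl.
have kI : ointer V W `<=` W by exact: subIsetr.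
exists (ointer V W), (subset_trans hI h); split; first by split.
rewrite rmorphM; apply/invertibleM; split.
  by rewrite -(res_comp h hI); exact: invertible_morph.
rewrite (res_irr _ (subset_trans kI k)) -(res_comp k kI).
exact: invertible_morph.
Qed.

Lemma germ_unitX (x : X) (U : opens X) (s : sec U) n :
  germ_unit x s -> germ_unit x (s ^+ n).
Proof.
move=> sx; elim: n => [|n IHn]; last by rewrite exprS; apply/germ_unitM.
by rewrite expr0; apply: germ_unit1; exact: germ_unit_dom sx.
Qed.

(** The sheaf axiom is applied to the family of all opens on which s and t agree: both glue the same
    data. *)
Lemma sec_local_eq (U : opens X) (s t : sec U) :
  (forall x, oset U x -> exists (V : opens X) (h : V `<=` U),
     oset V x /\ res h s = res h t) -> s = t.
Proof.
move=> st; pose I := {VH : {V : opens X & V `<=` U} |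
   res (projT2 VH) s = res (projT2 VH) t}.
pose V (i : I) := projT1 (sval i); pose h (i : I) : V i `<=` U := projT2 (sval i).
have cov : U `<=` \bigcup_(i : I) V i.
  by move=> x /st[W [k [Wx e]]]; exists (exist _ (existT _ W k) e).
have [|r [_ ru]] := @sheaf X I V U h cov (fun i => res (h i) s).
  move=> i j; have hU : ointer (V i) (V j) `<=` U by move=> x [/(h i)].
  by rewrite !(res_comp _ _ hU).
by rewrite -(ru s) // -(ru t) // => i; rewrite (svalP i).
Qed.

(** Inverses are unique, so local inverses agree on overlaps and glue. *)
Lemma invertible_germ_unit (U V : opens X) (h : V `<=` U) (s : sec U) :
  (forall x, oset V x -> germ_unit x s) -> invertible (res h s).
Proof.
move=> sV.
pose I := {W : opens X & {hb : W `<=` V & {b | res hb (res h s) * b = 1}}}.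
pose W (i : I) := projT1 i; pose hW (i : I) : W i `<=` V := projT1 (projT2 i).
pose b (i : I) : sec (W i) := sval (projT2 (projT2 i)).
have bE i : res (hW i) (res h s) * b i = 1 by exact: svalP (projT2 (projT2 i)).
have cov : V `<=` \bigcup_(i : I) W i.
  move=> x Vx; have [W0 [k [W0x [b0 sb]]]] := sV x Vx.
  have kI : ointer V W0 `<=` V by exact: subIsetl.
  have kI' : ointer V W0 `<=` W0 by exact: subIsetr.
  have e : res kI (res h s) * res kI' b0 = 1.
    have kU : ointer V W0 `<=` U by move=> y [/h].
    by rewrite (res_comp _ _ kU) -(res_comp k kI' kU) -rmorphM sb rmorph1.
  by exists (existT _ (ointer V W0) (existT _ kI (exist _ (res kI' b0) e))).
have uniq (Y : opens X) (u v w : sec Y) : u * v = 1 -> u * w = 1 -> v = w.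
  by move=> uv uw; rewrite -[v]mulr1 -uw mulrA [v * u]mulrC uv mul1r.
have [|t [tE _]] := @sheaf X I W V hW cov b.
  move=> i j; have p : ointer (W i) (W j) `<=` W i by exact: subIsetl.
  have q : ointer (W i) (W j) `<=` W j by exact: subIsetr.
  rewrite (res_irr _ p) (res_irr _ q).
  have pV : ointer (W i) (W j) `<=` V by move=> x [/hW].
  apply: (uniq _ (res pV (res h s))).
    by rewrite -(res_comp (hW i) p) -rmorphM bE rmorph1.
  by rewrite -(res_comp (hW j) q) -rmorphM bE rmorph1.
exists t; apply: sec_local_eq => x /cov[i _ Wx]; exists (W i), (hW i).
by split=> //; rewrite rmorphM tE bE rmorph1.
Qed.

End Sections.

Section AffineCharts.
Variable X : lrs.

Lemma germ_unit0 (x : X) (U : opens X) : oset U x -> ~ germ_unit x (0 : sec U).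
Proof. by move=> Ux; case: (lrs_local Ux). Qed.

Lemma nongerm_unitD (x : X) (U : opens X) (s t : sec U) : oset U x ->
  ~ germ_unit x s -> ~ germ_unit x t -> ~ germ_unit x (s + t).
Proof. by move=> Ux ns nt; case: (lrs_local Ux) => _ /(_ s t) h /h[]. Qed.

Definition point_prime (x : X) (U : opens X) (Ux : oset U x) : prime_ideal (sec U).
refine (@PrimeIdeal (sec U) [set s | ~ germ_unit x s] _ _ _ _ _) => /=.
- exact: germ_unit0.
- by move=> a b; exact: nongerm_unitD.
- by move=> a b nb /germ_unitM[].
- by apply; exact: germ_unit1.
- move=> a b nab; have [|a'] := pselect (germ_unit x a); last by left.
  by move=> a'; right=> b'; apply/nab/germ_unitM.
Defined.

(* [affine_open] with A = O_X(U): the points of U are the primes of O_X(U), the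
   nonvanishing loci form a basis of U, and O_X(X_s) is the localization at s. *)
Definition affine (U : opens X) : Prop :=
  [/\ forall (x : X) (V : set X), oset U x -> open V -> V x ->
        exists s : sec U, germ_unit x s /\ nonvan s `<=` V,
      forall Q : prime_ideal (sec U), exists x : X, oset U x /\
        forall s, pideal Q s <-> ~ germ_unit x s,
      forall x y : X, oset U x -> oset U y ->
        (forall s : sec U, germ_unit x s <-> germ_unit y s) -> x = y
    & forall (s : sec U) (W : opens X) (h : W `<=` U),
        (forall x, oset W x <-> germ_unit x s) -> localization_away s (res h)].

Lemma affineP (U : opens X) : affine_open U <-> affine U.
Proof.
split=> [[A [g [phi [inj rg op loc]]]]|[base prim inj loc]].
  have gU P : oset U (g P) by rewrite -rg.
  have surj x : oset U x -> exists P, x = g P by rewrite -rg => -[P _ <-]; exists P.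
  (* Since D(1) is everything, localizing at 1 shows that [phi] is an isomorphism; this allows [A]
     to be replaced by O_X(U). *)
  have [_ phi_surj phi_inj] : localization_away (1 : A) (phi : A -> sec U).
    have e : U = g @` basic_open 1 :> set X.
      rewrite -rg; apply/seteqP; split=> _ [P _ <-]; exists P => //; exact: pideal1.
    have [h1 h2 h3] := loc 1 U (@subset_refl _ U) e.
    split=> [|b|a a0].
    - by exists 1; rewrite rmorph1 mulr1.
    - by have [a [n h]] := h2 b; exists a, n; move: h; rewrite !res_id.
    - by apply: h3; rewrite res_id.
  have {}phi_surj b : exists a, b = phi a.
    by have [a [n]] := phi_surj b; rewrite rmorph1 expr1n mulr1; exists a.
  have oD a : open (g @` basic_open a).
    apply/op; first by move=> _ [P _ <-].
    exists [set a]; apply/seteqP; split=> [P [Q nQ /inj QP]|P /= nP].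
      by subst Q => h; apply: nQ; exact: h.
    by exists P => // Pa; apply: nP => _ ->.
  pose D a : opens X := Opens (oD a).
  have DU a : D a `<=` U by move=> _ [P _ <-].
  (* If the germ is a unit, then a is invertible on some D(f) containing P. Comparing fractions, a
     multiple of a equals a power of f, so a in P would force f in P. *)
  have gerP P a : germ_unit (g P) (phi a) <-> ~ pideal P a.
    split=> [[V [h [VP inv]]] Pa|nPa]; last first.
      exists (D a), (DU a); split; first by exists P.
      by have [] := loc a (D a) (DU a) erefl.
    have [E EV] : zariski_open (g @^-1` V) by apply/op => //; exact: oopen.
    have : (g @^-1` V) P by [].
    rewrite EV /= => /existsNP[f /not_implyP[Ef nPf]].
    have fV : D f `<=` V.
      move=> _ [Q nQ <-]; have : (g @^-1` V) Q by rewrite EV => /(_ f Ef).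
      by [].
    have [_ l2 l3] := loc f (D f) (DU f) erefl.
    have := @invertible_morph _ _ (res fV) _ inv.
    rewrite (res_comp _ _ (DU f)) => -[b]; have [c [n bc]] := l2 b.
    move=> /(congr1 (fun t => t * res (DU f) (phi f) ^+ n)).
    rewrite -mulrA bc mul1r -rmorphM -!rmorphXn -!rmorphM => e.
    have [|m] := l3 (a * c - f ^+ n); first by rewrite !rmorphB e subrr.
    move=> /eqP; rewrite mulrBr subr_eq0 -exprD => /eqP e'.
    apply: nPf; apply: (@pidealX _ P f (m + n)); rewrite -e'.
    by rewrite [a * c]mulrC mulrA; exact: pidealM.
  split.
  - move=> x V /surj[P ->] oV VP.
    have [E EV] : zariski_open (g @^-1` (V `&` U)).
      by apply/op; [move=> y []|apply: openI => //; exact: oopen].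
    have : (g @^-1` (V `&` U)) P by [].
    rewrite EV /= => /existsNP[f /not_implyP[Ef nPf]].
    exists (phi f); split; first exact/gerP.
    move=> y fy; have /surj[Q yQ] := germ_unit_dom fy; subst y.
    have : (g @^-1` (V `&` U)) Q by rewrite EV => /(_ f Ef) Qf; move/gerP: fy.
    by case.
  - move=> Q; exists (g (contraction phi Q)); split=> // s.
    by have [a ->] := phi_surj s; split=> [Qa /gerP|]; [exact|move=> /gerP/contrapT].
  - move=> x y /surj[P ->] /surj[Q ->] h; congr g; apply: prime_ideal_eq.
    apply/seteqP; split=> a Pa; apply: contrapT => /gerP; [|].
      by move=> /h/gerP.
    by move=> /h/gerP.
  - move=> s W h Ws; have [a sa] := phi_surj s; subst s.
    have We : W = g @` basic_open a :> set X.
      apply/seteqP; split=> [x Wx|_ [P nPa <-]]; last exact/Ws/gerP.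
      by have /surj[P xP] := h x Wx; subst x; exists P => //; exact/gerP/Ws.
    have [l1 l2 l3] := loc a W h We; split=> // [b|b b0].
      by have [c [n e]] := l2 b; exists (phi c), n.
    have [c bc] := phi_surj b; subst b; have [n e] := l3 c b0; exists n.
    by rewrite -rmorphXn -rmorphM e rmorph0.
pose g (Q : prime_ideal (sec U)) := sval (cid (prim Q)).
have gU Q : oset U (g Q) by rewrite /g; case: cid => x /= [].
have gE Q s : pideal Q s <-> ~ germ_unit (g Q) s by rewrite /g; case: cid => x /= [_ ->].
have gE' Q s : germ_unit (g Q) s <-> ~ pideal Q s.
  by split=> [h /gE|h]; [exact|apply: contrapT => /gE].
have gsurj x (Ux : oset U x) : g (point_prime Ux) = x.
  by apply: inj => // s; rewrite gE' /=; split=> [/contrapT|h h'].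
exists (sec U), g, (idfun : {rmorphism sec U -> sec U}); split.
- move=> P Q PQ; apply: prime_ideal_eq; apply/seteqP.
  by split=> s /gE h; apply/gE; move: h; rewrite PQ.
- by apply/seteqP; split=> [_ [P _ <-] //|x Ux]; exists (point_prime Ux).
- move=> V VU; split=> [oV|[E EV]].
    exists [set s | nonvan s `<=` V]; apply/seteqP; split=> [P VP|P /existsNP[s]].
      have [s [sP sV]] := base (g P) V (gU P) oV VP => /(_ s sV) /gE; exact.
    by move=> /not_implyP[sV nPs]; apply: sV; exact/gE'.
  rewrite (_ : V = \bigcup_(s in E) nonvan s).
    by apply: bigcup_open => s _; exact: oopen.
  apply/seteqP; split=> [x Vx|x [s Es sx]].
    have Ux := VU x Vx; have : (g @^-1` V) (point_prime Ux) by rewrite /= gsurj.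
    rewrite EV => /existsNP[s /not_implyP[Es ns]]; exists s => //.
    exact: contrapT.
  have Ux := germ_unit_dom sx; have : (g @^-1` V) (point_prime Ux).
    by rewrite EV => /(_ s Es); exact.
  by rewrite /= gsurj.
- move=> f W h Wf; apply: loc => x; rewrite Wf; split=> [[P nPf <-]|xf].
    exact/gE'.
  by exists (point_prime (germ_unit_dom xf)); [apply|exact: gsurj].
Qed.

(** A section t over W satisfies t s^k = a for some a over U. Hence t and a are units at the same
    points of W, and the locus of t is the locus of a s in U, to which the axioms of U apply. *)
Lemma affine_nonvan (U W : opens X) (s : sec U) : affine U ->
  (forall x, oset W x <-> germ_unit x s) -> affine W.
Proof.
move=> [base prim inj loc] Ws.
have h : W `<=` U by move=> x /Ws/germ_unit_dom.
have gh x (a : sec U) : oset W x -> germ_unit x (res h a) <-> germ_unit x a.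
  exact: germ_unit_res.
have [is_ l2 l3] := loc s W h Ws.
have sX n : invertible (res h s ^+ n) by exact: invertibleX.
have gt x (t : sec W) a n : oset W x -> t * res h s ^+ n = res h a ->
    germ_unit x t <-> germ_unit x a.
  move=> Wx e; rewrite -(gh x a Wx) -e germ_unitM.
  split=> [tx|[] //]; split=> //; apply: germ_unitX.
  by apply/gh => //; exact/Ws.
split.
- move=> x V Wx oV Vx.
  have [|||a [ax aV]] := base x (V `&` W).
  + exact: (h x Wx).
  + by apply: openI => //; exact: oopen.
  + by [].
  exists (res h a); split; first exact/gh.
  by move=> y ay; have Wy := germ_unit_dom ay; case: (aV y) => //; exact/(gh y a Wy).
- move=> Q; have [x [Ux Qx]] := prim (contraction (res h) Q).
  have Wx : oset W x.
    apply/Ws; apply: contrapT => sx; have /= Qs := (Qx s).2 sx; apply: (@pideal1 _ Q).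
    by case: is_ => b <-; rewrite mulrC; exact: pidealM.
  exists x; split=> // t; have [a [n e]] := l2 t.
  rewrite (gt x t a n Wx e) -Qx /= -e; split=> [|/pideal_prime[] //].
    by rewrite mulrC; exact: pidealM.
  move=> /pidealX Qs; exfalso; apply: (@pideal1 _ Q).
  by case: is_ => b <-; rewrite mulrC; exact: pidealM.
- move=> x y Wx Wy xy; apply: inj; [exact: (h x Wx)|exact: (h y Wy)|] => a.
  by rewrite -!gh.
- move=> t W' h' W't.
  have [a [k tk]] := l2 t; have hU : W' `<=` U by move=> x /h'/h.
  have Was x : oset W' x <-> germ_unit x (a * s).
    rewrite W't germ_unitM; split=> [tx|[ax sx]].
      have Wx := germ_unit_dom tx; split; last exact/Ws.
      exact/(gt x t a k Wx tk).
    by apply/(gt x t a k _ tk) => //; exact/Ws.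
  have [m1 m2 m3] := loc (a * s) W' hU Was.
  have asE : res hU (a * s) = res h' (t * res h s ^+ k.+1).
    by rewrite exprSr mulrA tk -rmorphM (res_comp _ _ hU).
  split.
  + by move: m1; rewrite asE rmorphM => /invertibleM[].
  + move=> b; have [c [n e]] := m2 b.
    have [v sv] := sX (k.+1 * n)%N.
    have sv' : res h' (res h s) ^+ (k.+1 * n) * res h' v = 1.
      by rewrite -rmorphXn -rmorphM sv rmorph1.
    exists (res h c * v), n.
    rewrite [RHS]rmorphM (res_comp _ _ hU) -e asE rmorphM rmorphXn exprMn -exprM.
    by rewrite -!mulrA sv' mulr1.
  + move=> c c0; have [d [n e]] := l2 c.
    have [|N dN] := m3 d.
      by rewrite -(res_comp h h') -e rmorphM c0 mul0r.
    exists N; apply: (invertible_cancel (sX (n + k.+1 * N)%N)); rewrite mul0r.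
    have -> : t ^+ N * c * res h s ^+ (n + k.+1 * N) =
        (t * res h s ^+ k.+1) ^+ N * (c * res h s ^+ n).
      by rewrite exprMn -exprM exprD [res h s ^+ n * _]mulrC mulrACA.
    by rewrite e exprSr mulrA tk -rmorphM -rmorphXn -rmorphM dN rmorph0.
Qed.

End AffineCharts.

Lemma affine_basis (X : scheme) (x : X) (V : set X) : open V -> V x ->
  exists U : opens X, [/\ oset U x, U `<=` V & affine U].
Proof.
move=> oV Vx; have [U Ux /affineP aU] := sch_affine x.
have [base _ _ _] := aU; have [s [sx sV]] := base x V Ux oV Vx.
exists (nonvan s); split=> //; exact: (affine_nonvan (s := s) aU).
Qed.

Lemma affine_nilpotent (X : scheme) (U : opens X) (s : sec U) : affine U ->
  (forall x, ~ germ_unit x s) -> exists n, s ^+ n = 0.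
Proof.
move=> [_ prim _ _] sx; apply: contrapT => nil.
have [||Q _ nQ] := @prime_avoiding_powers (sec U) [set 0] s.
- by split=> // [a b -> ->|a b ->]; rewrite ?addr0 ?mulr0.
- by move=> n sn; apply: nil; exists n.
by have [x [_ Qx]] := prim Q; apply: nQ; exact/Qx.
Qed.

Lemma reduced_sec_eq0 (X : scheme) (U : opens X) (s : sec U) : reduced X ->
  (forall x, ~ germ_unit x s) -> s = 0.
Proof.
move=> redX sx; apply: sec_local_eq => x Ux.
have [V [Vx VU aV]] := affine_basis (oopen U) Ux.
exists V, VU; split=> //; rewrite rmorph0.
have [y|n] := affine_nilpotent aV (s := res VU s); last exact: redX.
by move=> sy; have /germ_unit_res h := germ_unit_dom sy; move: sy => /h; exact: sx.
Qed.

(** * Values of sections in perfect residue fields *)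

Section QuotientLift.
Variables (S : field_system) (L : fieldType).
Variable theta : forall i : fidx S, {rmorphism fring i -> L}.
Hypothesis theta_rel : forall i j (a : fring i) (b : fring j),
  frel a b -> theta i a = theta j b.

Definition fquot_fun (u : fquot S) : L :=
  let w := projT2 (cid (fproj_surj u)) in theta _ (projT1 (cid w)).

Lemma fquot_funE i (a : fring i) : fquot_fun (fproj a) = theta i a.
Proof.
rewrite /fquot_fun; case: cid => j /= w; case: cid => b /= /fprojP ab.
exact/esym/theta_rel.
Qed.

Lemma fquot_fun_additive : zmod_morphism fquot_fun.
Proof.
move=> u v; have [i [a [b [-> ->]]]] := fproj_surj2 u v.
by rewrite -(rmorphB (@fproj S i)) !fquot_funE rmorphB.
Qed.

Lemma fquot_fun_multiplicative : monoid_morphism fquot_fun.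
Proof.
split=> [|u v].
  rewrite -(rmorph1 (@fproj S (fidx0 S))) fquot_funE; exact: rmorph1.
have [i [a [b [-> ->]]]] := fproj_surj2 u v.
by rewrite -(rmorphM (@fproj S i)) !fquot_funE rmorphM.
Qed.

HB.instance Definition _ :=
  GRing.isZmodMorphism.Build (fquot S) L fquot_fun fquot_fun_additive.
HB.instance Definition _ :=
  GRing.isMonoidMorphism.Build (fquot S) L fquot_fun fquot_fun_multiplicative.

Definition fquot_lift : {rmorphism fquot S -> L} := fquot_fun.

End QuotientLift.

Lemma char_exponent_morph (K L : fieldType) (f : {rmorphism K -> L}) :
  char_exponent L = char_exponent K.
Proof.
have [[p pK]|nK] := pselect (exists p, p \in [pchar K]).
  by rewrite (char_exponentE pK); apply: char_exponentE; rewrite (fmorph_pchar f).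
rewrite /char_exponent; case: pselect => [h|_].
  by exfalso; case: h => p; rewrite (fmorph_pchar f) => pK; case: nK; exists p.
by case: pselect.
Qed.

Lemma char_exponentP (K : fieldType) : char_exponent K = 1%N \/
  prime (char_exponent K) /\ (char_exponent K)%:R = 0 :> K.
Proof.
have [[p pK]|nK] := pselect (exists p, p \in [pchar K]).
  by right; rewrite (char_exponentE pK); move: pK => /andP[-> /eqP].
by left; rewrite /char_exponent; case: pselect.
Qed.

Section PerfectMap.
Variables (K L : fieldType) (f : {rmorphism K -> L}).

Let theta n : {rmorphism perf_ring K n -> perfect_closure L} :=
  let S := perfect_system L in
  ((@fproj S n : {rmorphism @fring S n -> fquot S}) \o
    (f : {rmorphism perf_ring K n -> @fring S n})).

Let theta_rel (m n : nat) (a : perf_ring K m) (b : perf_ring K n) :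
  perf_rel a b -> theta m a = theta n b.
Proof.
move=> ab; apply/fprojP; rewrite /= /perf_rel /frob (char_exponent_morph f).
by rewrite -!rmorphXn; congr (f _).
Qed.

Definition perfect_map : {rmorphism perfect_closure K -> perfect_closure L} :=
  @fquot_lift (perfect_system K) (perfect_closure L) theta theta_rel.

Lemma perfect_mapE a : perfect_map (to_perfect_closure K a) = to_perfect_closure L (f a).
Proof. exact: (@fquot_funE (perfect_system K)). Qed.

End PerfectMap.

Section Values.
Variable X : lrs.
Implicit Types (x : X) (U V W : opens X).

(* The perfect closure of kappa(x) is kept behind an opaque isomorphism: unfolding
   the arithmetic of the quotient makes conversion tests diverge. *)
Lemma kperf_subproof x : {K : fieldType &
  {to : {rmorphism perfect_closure (residue_field x) -> K} &
  {from : {rmorphism K -> perfect_closure (residue_field x)} |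
    cancel to from /\ cancel from to}}}.
Proof. by exists (perfect_closure (residue_field x)), idfun, idfun. Qed.

Definition kperf x : fieldType := projT1 (kperf_subproof x).

Definition perfect_kperf x : {rmorphism perfect_closure (residue_field x) -> kperf x} :=
  projT1 (projT2 (kperf_subproof x)).

Definition kperf_perfect x : {rmorphism kperf x -> perfect_closure (residue_field x)} :=
  sval (projT2 (projT2 (kperf_subproof x))).

Lemma perfect_kperfK x : cancel (@perfect_kperf x) (@kperf_perfect x).
Proof. by case: (svalP (projT2 (projT2 (kperf_subproof x)))). Qed.

Lemma kperf_perfectK x : cancel (@kperf_perfect x) (@perfect_kperf x).
Proof. by case: (svalP (projT2 (projT2 (kperf_subproof x)))). Qed.

Definition to_kperf x : {rmorphism residue_field x -> kperf x} :=
  (@perfect_kperf x \o to_perfect_closure (residue_field x)).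

Definition chexp x : nat := char_exponent (residue_field x).

(** Extension by 0 outside U lets sections over different opens live in one ring of total
    functions. *)
Definition value U (s : sec U) x : kperf x :=
  if pselect (oset U x) is left Ux
  then to_kperf _ (residue_eval Ux s) else 0.

Lemma value_in U (s : sec U) x (Ux : oset U x) :
  value s x = to_kperf _ (residue_eval Ux s).
Proof.
by rewrite /value; case: pselect => // Ux'; rewrite (Prop_irrelevance Ux' Ux).
Qed.

Lemma value_out U (s : sec U) x : ~ oset U x -> value s x = 0.
Proof. by rewrite /value; case: pselect. Qed.

Lemma value_eq0 U (s : sec U) x : value s x = 0 <-> ~ germ_unit x s.
Proof.
have [Ux|nUx] := pselect (oset U x); last first.
  by rewrite value_out //; split=> // _ /germ_unit_dom.
rewrite (value_in _ Ux) -(residue_eval_eq0 Ux); split=> [/eqP|->].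
  by rewrite fmorph_eq0 => /eqP.
exact: rmorph0.
Qed.

Lemma valueB U (s t : sec U) x : value (s - t) x = value s x - value t x.
Proof.
rewrite /value; case: pselect => [Ux|_]; last by rewrite subr0.
by rewrite !rmorphB.
Qed.

Lemma value0 U x : value (0 : sec U) x = 0.
Proof. by rewrite /value; case: pselect => // Ux; rewrite !rmorph0. Qed.

Lemma valueN U (s : sec U) x : value (- s) x = - value s x.
Proof. by rewrite -sub0r valueB value0 sub0r. Qed.

Lemma valueD U (s t : sec U) x : value (s + t) x = value s x + value t x.
Proof. by rewrite -[t]opprK valueB !valueN !opprK. Qed.

Lemma valueM U (s t : sec U) x : value (s * t) x = value s x * value t x.
Proof.
rewrite /value; case: pselect => [Ux|_]; last by rewrite mulr0.
by rewrite !rmorphM.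
Qed.

Lemma value1 U x : oset U x -> value (1 : sec U) x = 1.
Proof. by move=> Ux; rewrite (value_in _ Ux) !rmorph1. Qed.

Lemma valueX U (s : sec U) x n : oset U x -> value (s ^+ n) x = value s x ^+ n.
Proof. by move=> Ux; rewrite !(value_in _ Ux) !rmorphXn. Qed.

Lemma value_sum U J (r : seq J) (F : J -> sec U) x :
  value (\sum_(j <- r) F j) x = \sum_(j <- r) value (F j) x.
Proof.
by elim: r => [|j r IHr]; rewrite ?big_nil ?value0 // !big_cons valueD IHr.
Qed.

Lemma value_res U V (h : V `<=` U) (s : sec U) x :
  oset V x -> value (res h s) x = value s x.
Proof.
move=> Vx; rewrite (value_in _ Vx) (value_in _ (h x Vx)).
by congr (to_kperf _ _); apply/esym/fprojP;
  exact: (@res_relE X x (resIdx (h x Vx)) (resIdx Vx) h s).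
Qed.

Lemma kperf_root x (u : kperf x) : exists k U (s : sec U),
  oset U x /\ u ^+ (chexp x ^ k) = value s x.
Proof.
have [k [a ua]] := perfect_closure_radicial (@kperf_perfect x u).
have [[U Ux] [s sa]] := fproj_surj a; subst a.
exists k, U, s; split=> //; rewrite (value_in _ Ux) -[u in LHS]kperf_perfectK.
by rewrite -rmorphXn; congr (@perfect_kperf x _); exact: ua.
Qed.

Lemma kperf_exp_inj x k : injective (fun u : kperf x => u ^+ (chexp x ^ k)).
Proof.
rewrite /chexp -(char_exponent_morph (@to_kperf x)).
exact: frob_inj.
Qed.

End Values.

Section ValueMap.
Variables (Z X : lrs) (f : morphism Z X) (z : Z).

Let theta (U : res_idx (f z)) : {rmorphism res_ring U -> residue_field z} :=
  (residue_eval (svalP U : oset (opreim (mcts f) (sval U)) z) \o msharp f (sval U)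
    : {rmorphism sec (sval U) -> residue_field z}).

Let theta_rel (U V : res_idx (f z)) (s : res_ring U) (t : res_ring V) :
  res_rel s t -> theta U s = theta V t.
Proof.
move=> st; have Ux : oset (sval U) (f z) := svalP U.
have Vx : oset (sval V) (f z) := svalP V.
apply/fprojP; rewrite /=.
pose I := ointer (sval U) (sval V).
have hU : I `<=` sval U by exact: subIsetl.
have hV : I `<=` sval V by exact: subIsetr.
have Ix : oset I (f z) by split.
have hU' : opreim (mcts f) I `<=` opreim (mcts f) (sval U) by move=> y [].
have hV' : opreim (mcts f) I `<=` opreim (mcts f) (sval V) by move=> y [].
apply/(@res_relP _ z (@resIdx Z z (opreim (mcts f) (sval U)) (svalP U))
  (@resIdx Z z (opreim (mcts f) (sval V)) (svalP V)) _ _ _ hU' hV' Ix).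
move/(res_relP _ _ hU hV Ix): st => st h; apply: st; apply: (mlocal (m := f)).
by rewrite rmorphB (msharp_res hU hU') (msharp_res hV hV').
Qed.

Definition residue_map : {rmorphism residue_field (f z) -> residue_field z} :=
  @fquot_lift (residue_system (f z)) (residue_field z) theta theta_rel.

Lemma residue_mapE (U : opens X) (s : sec U) (Ux : oset U (f z)) :
  residue_map (residue_eval Ux s)
  = residue_eval (Ux : oset (opreim (mcts f) U) z) (msharp f U s).
Proof.
apply: etrans (@fquot_funE (residue_system (f z)) (residue_field z) theta theta_rel
  (resIdx Ux) s) _.
by rewrite /= /theta /=; congr (residue_eval _ _); exact: Prop_irrelevance.
Qed.

Definition kmap : {rmorphism kperf (f z) -> kperf z} :=
  (@perfect_kperf Z z \o (perfect_map residue_map \o @kperf_perfect X (f z))).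

Lemma kmapE (U : opens X) (s : sec U) : kmap (value s (f z)) = value (msharp f U s) z.
Proof.
have [Ux|nUx] := pselect (oset U (f z)); last by rewrite !value_out ?rmorph0.
rewrite (value_in _ Ux) (value_in (U := opreim (mcts f) U) _ Ux).
by rewrite /= perfect_kperfK perfect_mapE residue_mapE.
Qed.

Lemma chexp_map : chexp z = chexp (f z).
Proof. exact: char_exponent_morph residue_map. Qed.

End ValueMap.

Lemma mcomp_fun (X Y Z : lrs) (g : morphism Y Z) (f : morphism X Y) (x : X) :
  mcomp g f x = g (f x).
Proof. by []. Qed.

Lemma mid_fun (X : lrs) (x : X) : mid X x = x.
Proof. by []. Qed.

Lemma msharp_mid (X : lrs) (V W : opens X) (s : sec V)
    (h : W `<=` opreim (mcts (mid X)) V) (h0 : W `<=` V) :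
  res h (msharp (mid X) V s) = res h0 s.
Proof. exact: res_comp. Qed.

Lemma msharp_congr (Z X : lrs) (f g : morphism Z X) (V : opens X) (s : sec V)
    (W : opens Z) (h : W `<=` opreim (mcts f) V) (h' : W `<=` opreim (mcts g) V) :
  f = g -> res h (msharp f V s) = res h' (msharp g V s).
Proof. by move=> fg; subst g; exact: res_irr. Qed.

Section Radicial.

(* The residue field extensions of f are purely inseparable. *)
Definition radicial (Y X : lrs) (f : morphism Y X) : Prop :=
  forall (y : Y) (V : opens Y) (s : sec V), oset V y ->
    exists k (W : opens X) (a : sec W), oset W (f y) /\
      value s y ^+ (chexp y ^ k) = value (msharp f W a) y.

(** The two maps agree on points by injectivity. The values of the two pullbacks of a section agree
    after raising to a power of p, hence agree, because this power is injective on a field;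
    reducedness of Z passes from values to sections. *)
Lemma radicial_mono (Z : scheme) (Y X : lrs) (f : morphism Y X) (g1 g2 : morphism Z Y) :
  injective f -> radicial f -> reduced Z -> mcomp f g1 = mcomp f g2 -> g1 = g2.
Proof.
move=> inj rad redZ fg.
have g12 : g1 =1 g2.
  move=> z; apply: inj.
  by have := congr1 (fun h : morphism Z X => mfun h z) fg.
apply: morphism_ext => // V s W h h'; apply/eqP; rewrite -subr_eq0; apply/eqP.
apply: reduced_sec_eq0 => // z; rewrite -value_eq0 => //.
have [Wz|nWz] := pselect (oset W z); last exact: value_out.
rewrite valueB !value_res //; apply/eqP; rewrite subr_eq0; apply/eqP.
have Vy : oset V (g1 z) by exact: h.
have [k [T [a [Ta sa]]]] := rad (g1 z) V s Vy.
have V2 : oset V (g2 z) by exact: h'.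
have sa2 : value s (g2 z) ^+ (chexp (g2 z) ^ k) = value (msharp f T a) (g2 z).
  by rewrite -g12.
apply: (@kperf_exp_inj _ z k); rewrite /= -!kmapE -!rmorphXn.
rewrite {1}(chexp_map g1) sa (chexp_map g2) sa2 !kmapE.
have Tz : oset (opreim (mcts (mcomp f g1)) T) z by [].
have k2 : opreim (mcts (mcomp f g1)) T `<=` opreim (mcts (mcomp f g2)) T.
  by rewrite fg.
have e := msharp_congr (V := T) a (@subset_refl _ _) k2 fg.
have := congr1 (fun s => value s z) e; rewrite !value_res //.
Qed.

End Radicial.

(** * Sheaves of functions *)

Section TotalFunctions.
Variables (T : Type) (K : T -> comPzRingType).

Definition tfun : Type := forall x, K x.

HB.instance Definition _ := gen_eqMixin tfun.
HB.instance Definition _ := gen_choiceMixin tfun.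

Let tadd (f g : tfun) : tfun := fun x => f x + g x.
Let tmul (f g : tfun) : tfun := fun x => f x * g x.
Let topp (f : tfun) : tfun := fun x => - f x.
Let tzero : tfun := fun x => 0.
Let tone : tfun := fun x => 1.

Lemma tfunP (f g : tfun) : (forall x, f x = g x) -> f = g.
Proof. exact: functional_extensionality_dep. Qed.

Lemma tfun_eq (f g : tfun) x : f = g -> f x = g x.
Proof. by move=> ->. Qed.

Let taddA : associative tadd. Proof. by move=> *; apply: tfunP => x; exact: addrA. Qed.
Let taddC : commutative tadd. Proof. by move=> *; apply: tfunP => x; exact: addrC. Qed.
Let tadd0 : left_id tzero tadd. Proof. by move=> *; apply: tfunP => x; exact: add0r. Qed.
Let taddN : left_inverse tzero topp tadd.
Proof. by move=> *; apply: tfunP => x; exact: addNr. Qed.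
Let tmulA : associative tmul. Proof. by move=> *; apply: tfunP => x; exact: mulrA. Qed.
Let tmulC : commutative tmul. Proof. by move=> *; apply: tfunP => x; exact: mulrC. Qed.
Let tmul1 : left_id tone tmul. Proof. by move=> *; apply: tfunP => x; exact: mul1r. Qed.
Let tmulD : left_distributive tmul tadd.
Proof. by move=> *; apply: tfunP => x; exact: mulrDl. Qed.

HB.instance Definition _ := GRing.isZmodule.Build tfun taddA taddC tadd0 taddN.
HB.instance Definition _ := GRing.Zmodule_isComPzRing.Build tfun tmulA tmulC tmul1 tmulD.

Lemma tfunD (f g : tfun) x : (f + g) x = f x + g x. Proof. by []. Qed.
Lemma tfunM (f g : tfun) x : (f * g) x = f x * g x. Proof. by []. Qed.
Lemma tfunN (f : tfun) x : (- f) x = - f x. Proof. by []. Qed.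
Lemma tfun0 x : (0 : tfun) x = 0. Proof. by []. Qed.
Lemma tfun1 x : (1 : tfun) x = 1. Proof. by []. Qed.
Lemma tfunX (f : tfun) n x : (f ^+ n) x = f x ^+ n.
Proof. by elim: n => [|n IHn]; rewrite ?expr0 // !exprS tfunM IHn. Qed.
Lemma tfun_sum J (r : seq J) (F : J -> tfun) x :
  (\sum_(j <- r) F j) x = \sum_(j <- r) F j x.
Proof. by elim: r => [|j r IHr]; rewrite ?big_nil // !big_cons tfunD IHr. Qed.

Definition tfunE := (tfunD, tfunM, tfunN, tfun0, tfun1, tfunX).

End TotalFunctions.

(* A sheaf of functions with values in the rings [ld_K x], cut out by the subrings
   [ld_germ x] of the functions allowed near x. *)
Record local_data := LocalData {
  ld_top :> topologicalType;
  ld_K : ld_top -> comPzRingType;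
  ld_germ : ld_top -> set (tfun ld_K);
  ld1 : forall x, ld_germ x 1;
  ldN1 : forall x, ld_germ x (- 1);
  ldD : forall x b b', ld_germ x b -> ld_germ x b' -> ld_germ x (b + b');
  ldM : forall x b b', ld_germ x b -> ld_germ x b' -> ld_germ x (b * b');
  ld_loc : forall x b b' (V : opens ld_top), oset V x ->
    (forall y, oset V y -> b y = b' y) -> ld_germ x b -> ld_germ x b';
  ld_inv : forall x b (V : opens ld_top), oset V x ->
    (forall y, oset V y -> ld_germ y b) -> invertible (b x) ->
    exists (W : opens ld_top) b', oset W x /\
      forall y, oset W y -> ld_germ y b' /\ b y * b' y = 1;
  ld_neq0 : forall x, ~ invertible (0 : ld_K x);
  ld_local : forall x (u v : ld_K x), invertible (u + v) -> invertible u \/ invertible v }.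

Section LocalSheaf.
Variable D : local_data.
Implicit Types U V : opens D.

(** The value 0 is imposed outside U so that a section is a total function carrying no membership
    proofs, and agreement on U is equality. *)
Record lsec U := LSec {
  lval :> forall x : D, @ld_K D x;
  lval_germ : forall x, oset U x -> ld_germ x (lval : tfun (@ld_K D));
  lval_out : forall x, ~ oset U x -> lval x = 0 }.

HB.instance Definition _ U := gen_eqMixin (lsec U).
HB.instance Definition _ U := gen_choiceMixin (lsec U).

Lemma lsecP U (s t : lsec U) : (forall x, oset U x -> s x = t x) -> s = t.
Proof.
case: s t => s gs os [t gt ot] /= st.
have ?: s = t.
  apply: tfunP => x; have [|nU] := pselect (oset U x); first exact: st.
  by rewrite os // ot.
by subst t; rewrite (Prop_irrelevance gs gt) (Prop_irrelevance os ot).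
Qed.

Section Cut.
Variables (U : opens D) (b : tfun (@ld_K D)).
Hypothesis bU : forall x, oset U x -> ld_germ x b.

(* Opaque, so that conversion tests between sections do not unfold them. *)
Lemma lmk_subproof : {s : lsec U | forall x, oset U x -> s x = b x}.
Proof.
pose c : tfun (@ld_K D) := fun x => if pselect (oset U x) then b x else 0.
have cU x : oset U x -> ld_germ x c.
  by move=> Ux; apply: (ld_loc Ux _ (bU Ux)) => y Uy; rewrite /c; case: pselect.
have c0 x : ~ oset U x -> c x = 0 by rewrite /c; case: pselect.
by exists (LSec cU c0) => x Ux; rewrite /= /c; case: pselect.
Qed.

Definition lmk : lsec U := sval lmk_subproof.

Lemma lmkE x : oset U x -> lmk x = b x.
Proof. exact: svalP lmk_subproof x. Qed.

End Cut.

Section Ring.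
Variable U : opens D.

Lemma ld0 x : ld_germ x (0 : tfun (@ld_K D)).
Proof. by rewrite -(subrr 1); apply: ldD; [exact: ld1|exact: ldN1]. Qed.

Lemma ldN x (b : tfun (@ld_K D)) : ld_germ x b -> ld_germ x (- b).
Proof. by rewrite -mulN1r; apply: ldM; exact: ldN1. Qed.

(** The ring operations are sealed together and known only by their pointwise equations, again to
    keep conversion from unfolding them. *)
Lemma lsec_ops_subproof : {ops : (lsec U -> lsec U -> lsec U) * (lsec U -> lsec U -> lsec U)
    * (lsec U -> lsec U) * lsec U * lsec U | let: (add, mul, opp, zero, one) := ops in
  [/\ forall s t x, oset U x -> add s t x = s x + t x,
      forall s t x, oset U x -> mul s t x = s x * t x,
      forall s x, oset U x -> opp s x = - s x,
      forall x, oset U x -> zero x = 0 & forall x, oset U x -> one x = 1]}.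
Proof.
exists (fun s t => lmk (fun x Ux => ldD (lval_germ s Ux) (lval_germ t Ux)),
  fun s t => lmk (fun x Ux => ldM (lval_germ s Ux) (lval_germ t Ux)),
  fun s => lmk (fun x Ux => ldN (lval_germ s Ux)),
  lmk (fun x Ux => ld0 x), lmk (fun x Ux => ld1 x)).
by split=> *; rewrite lmkE.
Qed.

Let ladd := let: (add, _, _, _, _) := sval lsec_ops_subproof in add.
Let lmul := let: (_, mul, _, _, _) := sval lsec_ops_subproof in mul.
Let lopp := let: (_, _, opp, _, _) := sval lsec_ops_subproof in opp.
Let lzero := let: (_, _, _, zero, _) := sval lsec_ops_subproof in zero.
Let lone := let: (_, _, _, _, one) := sval lsec_ops_subproof in one.

Let laddE s t x : oset U x -> ladd s t x = s x + t x.
Proof. by rewrite /ladd; case: lsec_ops_subproof => -[[[[? ?] ?] ?] ?] /= [h *]; exact: h. Qed.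
Let lmulE s t x : oset U x -> lmul s t x = s x * t x.
Proof. by rewrite /lmul; case: lsec_ops_subproof => -[[[[? ?] ?] ?] ?] /= [_ h *]; exact: h. Qed.
Let loppE s x : oset U x -> lopp s x = - s x.
Proof. by rewrite /lopp; case: lsec_ops_subproof => -[[[[? ?] ?] ?] ?] /= [_ _ h *]; exact: h. Qed.
Let lzeroE x : oset U x -> lzero x = 0.
Proof. by rewrite /lzero; case: lsec_ops_subproof => -[[[[? ?] ?] ?] ?] /= [_ _ _ h *]; exact: h. Qed.
Let loneE x : oset U x -> lone x = 1.
Proof. by rewrite /lone; case: lsec_ops_subproof => -[[[[? ?] ?] ?] ?] /= [_ _ _ _ h]; exact: h. Qed.

Let laddA : associative ladd.
Proof.
by move=> *; apply: lsecP => x Ux; rewrite ?(laddE, lmulE, loppE, lzeroE, loneE) // addrA.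
Qed.
Let laddC : commutative ladd.
Proof.
by move=> *; apply: lsecP => x Ux; rewrite ?(laddE, lmulE, loppE, lzeroE, loneE) // addrC.
Qed.
Let ladd0 : left_id lzero ladd.
Proof.
by move=> *; apply: lsecP => x Ux; rewrite ?(laddE, lmulE, loppE, lzeroE, loneE) // add0r.
Qed.
Let laddN : left_inverse lzero lopp ladd.
Proof.
by move=> *; apply: lsecP => x Ux; rewrite ?(laddE, lmulE, loppE, lzeroE, loneE) // addNr.
Qed.
Let lmulA : associative lmul.
Proof.
by move=> *; apply: lsecP => x Ux; rewrite ?(laddE, lmulE, loppE, lzeroE, loneE) // mulrA.
Qed.
Let lmulC : commutative lmul.
Proof.
by move=> *; apply: lsecP => x Ux; rewrite ?(laddE, lmulE, loppE, lzeroE, loneE) // mulrC.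
Qed.
Let lmul1 : left_id lone lmul.
Proof.
by move=> *; apply: lsecP => x Ux; rewrite ?(laddE, lmulE, loppE, lzeroE, loneE) // mul1r.
Qed.
Let lmulD : left_distributive lmul ladd.
Proof.
by move=> *; apply: lsecP => x Ux; rewrite ?(laddE, lmulE, loppE, lzeroE, loneE) // mulrDl.
Qed.

HB.instance Definition _ := GRing.isZmodule.Build (lsec U) laddA laddC ladd0 laddN.
HB.instance Definition _ :=
  GRing.Zmodule_isComPzRing.Build (lsec U) lmulA lmulC lmul1 lmulD.

Lemma lsecD (s t : lsec U) x : (s + t) x = s x + t x.
Proof.
have [Ux|nU] := pselect (oset U x); first exact: laddE.
by rewrite !lval_out // addr0.
Qed.

Lemma lsecM (s t : lsec U) x : (s * t) x = s x * t x.
Proof.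
have [Ux|nU] := pselect (oset U x); first exact: lmulE.
by rewrite !lval_out // mulr0.
Qed.

Lemma lsecN (s : lsec U) x : (- s) x = - s x.
Proof.
have [Ux|nU] := pselect (oset U x); first exact: loppE.
by rewrite !lval_out // oppr0.
Qed.

Lemma lsec0 x : (0 : lsec U) x = 0.
Proof. by have [Ux|nU] := pselect (oset U x); [exact: lzeroE|rewrite lval_out]. Qed.

Lemma lsec1 x : oset U x -> (1 : lsec U) x = 1.
Proof. exact: loneE. Qed.

Lemma lsecX (s : lsec U) n x : oset U x -> (s ^+ n) x = s x ^+ n.
Proof.
by move=> Ux; elim: n => [|n IHn]; rewrite ?expr0 ?lsec1 // !exprS lsecM IHn.
Qed.

End Ring.

Definition lres U V (h : V `<=` U) (s : lsec U) : lsec V :=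
  lmk (fun x Vx => lval_germ s (h x Vx)).

Lemma lresE U V (h : V `<=` U) (s : lsec U) x : oset V x -> lres h s x = s x.
Proof. exact: lmkE. Qed.

Section Restriction.
Variables (U V : opens D) (h : V `<=` U).

Lemma lres_additive : zmod_morphism (lres h).
Proof.
by move=> s t; apply: lsecP => x Vx; rewrite !(lresE, lsecD, lsecN).
Qed.

Lemma lres_multiplicative : monoid_morphism (lres h).
Proof.
split=> [|s t]; apply: lsecP => x Vx; last by rewrite !(lresE, lsecM).
by rewrite lresE // !lsec1 //; exact: h.
Qed.

HB.instance Definition _ := GRing.isZmodMorphism.Build _ _ (lres h) lres_additive.
HB.instance Definition _ := GRing.isMonoidMorphism.Build _ _ (lres h) lres_multiplicative.
End Restriction.

Lemma lsheaf (J : Type) (U : J -> opens D) (V : opens D)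
    (hU : forall j, U j `<=` V) : V `<=` \bigcup_j U j ->
  forall s : forall j, lsec (U j),
  (forall j k, lres (@subIsetl _ (U j) (U k) : ointer (U j) (U k) `<=` U j) (s j)
             = lres (@subIsetr _ (U j) (U k) : ointer (U j) (U k) `<=` U k) (s k)) ->
  exists! t : lsec V, forall j, lres (hU j) t = s j.
Proof.
move=> cV s ss.
have sE j k x : oset (U j) x -> oset (U k) x -> s j x = s k x.
  move=> jx kx; have := congr1 (fun t : lsec _ => t x) (ss j k).
  by rewrite !lresE.
(* The glued function takes at x the value of any section defined there, and 0 if there is none. It
   is allowed because being allowed is a local condition. *)
pose b : tfun (@ld_K D) := fun x =>
  if pselect (exists j, oset (U j) x) is left h then s (projT1 (cid h)) x else 0.
have bE j x : oset (U j) x -> b x = s j x.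
  move=> jx; rewrite /b; case: pselect => [h|[]]; last by exists j.
  by apply: sE => //; case: cid.
have bV x : oset V x -> ld_germ x b.
  move=> /cV[j _ jx]; apply: (ld_loc jx _ (lval_germ (s j) jx)) => y jy.
  by rewrite (bE j).
exists (lmk bV); split=> [j|t ht]; apply: lsecP => x.
  by move=> jx; rewrite lresE // lmkE ?(bE j) //; exact: hU jx.
move=> Vx; have [j _ jx] := cV x Vx; rewrite lmkE // (bE j) //.
by rewrite -ht lresE.
Qed.

Definition lspace_rs : ringed_space.
refine (@RingedSpace D (fun U => lsec U)
  (fun U V h => (lres h : {rmorphism lsec U -> lsec V})) _ _ lsheaf).
- by move=> U h s; apply: lsecP => x Ux; exact: lresE.
- move=> U V W hVU hWV hWU s; apply: lsecP => x Wx.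
  by rewrite [LHS]lresE // [RHS]lresE // [LHS]lresE //; exact: hWV.
Defined.

Lemma lgerm_unitP (x : lspace_rs) U (s : lsec U) : oset U x ->
  @germ_unit lspace_rs x U s <-> invertible (s x).
Proof.
move=> Ux; split=> [[V [h [Vx [b]]]]|inv].
  move=> /(congr1 (fun t : lsec V => t x)) sb.
  exists (b x); move: sb; rewrite [LHS]lsecM (lsec1 Vx) => <-.
  by congr (_ * _); exact/esym/lresE.
have [W [b' [Wx Wb]]] := ld_inv Ux (lval_germ s) inv.
pose V := ointer U W.
have h : V `<=` U by exact: subIsetl.
have gV y : oset V y -> ld_germ y b' by move=> [_ /Wb[]].
exists V, h; split; first by split.
exists (lmk gV); apply: lsecP => y Vy.
rewrite [LHS]lsecM (lsec1 Vy) lmkE // [X in X * _]lresE //.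
by case: Vy => _ /Wb[].
Qed.

Lemma lspace_local : local_stalks lspace_rs.
Proof.
move=> x U Ux; split=> [/(lgerm_unitP _ Ux)|s t].
  by rewrite [X in invertible X]lsec0; exact: ld_neq0.
move=> /(lgerm_unitP _ Ux); rewrite [X in invertible X]lsecD => /ld_local.
by case=> h; [left|right]; apply/(lgerm_unitP _ Ux).
Qed.

Definition lspace : lrs := LRS lspace_local.

End LocalSheaf.

(** * The absolute weak normalization *)

Section RegularGerms.
Variable X : lrs.
Implicit Types (x : X) (U V W : opens X).

Let K x : comPzRingType := kperf x.
Let R : Type := tfun K.
Implicit Types r b c : tfun K.

Definition reg x : set (tfun K) := [set r | exists V (s : sec V),
  oset V x /\ forall y, oset V y -> r y = value s y].

Definition vreg x : set (tfun K) := [set r | reg x r /\ r x = 0].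

Let tot : opens X := Opens openT.

Lemma reg1 x : reg x 1.
Proof. by exists tot, 1; split=> // y Vy; rewrite value1. Qed.

Lemma regN1 x : reg x (- 1).
Proof. by exists tot, (- 1); split=> // y Vy; rewrite valueN value1. Qed.

Let reg_op x (op : forall A : comPzRingType, A -> A -> A) :
  (forall U (s t : sec U) y, value (op _ s t) y = op (K y) (value s y) (value t y)) ->
  forall (r r' : tfun K), reg x r -> reg x r' ->
  reg x (fun y => op (K y) (r y) (r' y)).
Proof.
move=> opE r r' [V [s [Vx rs]]] [V' [s' [V'x rs']]].
have h : ointer V V' `<=` V by exact: subIsetl.
have h' : ointer V V' `<=` V' by exact: subIsetr.
exists (ointer V V'), (op _ (res h s) (res h' s')); split=> // y Iy.
by rewrite opE !value_res // rs ?rs' //; [exact: h'|exact: h].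
Qed.

Lemma regD x r r' : reg x r -> reg x r' -> reg x (r + r').
Proof. by apply: (reg_op (op := fun A => @GRing.add A)) => *; exact: valueD. Qed.

Lemma regM x r r' : reg x r -> reg x r' -> reg x (r * r').
Proof. by apply: (reg_op (op := fun A => @GRing.mul A)) => *; exact: valueM. Qed.

Lemma reg_loc x r r' V : oset V x -> (forall y, oset V y -> r y = r' y) ->
  reg x r -> reg x r'.
Proof.
move=> Vx rr' [W [s [Wx rs]]].
have h : ointer V W `<=` W by exact: subIsetr.
exists (ointer V W), (res h s); split=> // y [Vy Wy].
by rewrite value_res // -rs // rr'.
Qed.

Lemma reg_value U (s : sec U) x : oset U x -> reg x (value s).
Proof. by exists U, s. Qed.

Lemma reg0 x : reg x 0.
Proof. by rewrite -(subrr 1); apply: regD; [exact: reg1|exact: regN1]. Qed.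

Lemma regN x r : reg x r -> reg x (- r).
Proof. by rewrite -mulN1r; apply: regM; exact: regN1. Qed.

Lemma regX x r n : reg x r -> reg x (r ^+ n).
Proof.
by move=> hr; elim: n => [|n IHn]; rewrite ?expr0 ?exprS; [exact: reg1|exact: regM].
Qed.

Lemma vreg0 x : vreg x 0. Proof. by split=> //; exact: reg0. Qed.
Lemma vreg_reg x : vreg x `<=` reg x. Proof. by move=> r []. Qed.
Lemma vregD x r r' : vreg x r -> vreg x r' -> vreg x (r + r').
Proof. by move=> [h r0] [h' r0']; split; [exact: regD|rewrite tfunD r0 r0' addr0]. Qed.
Lemma vregM x r r' : reg x r -> vreg x r' -> vreg x (r * r').
Proof. by move=> h [h' r0']; split; [exact: regM|rewrite tfunM r0' mulr0]. Qed.

(** A function that is zero near x lies in the ideal, whatever its values elsewhere. Conditions on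
    total functions thus become conditions on germs: identities valid only near x may be corrected
    by such an error. *)
Lemma vreg_local x r V : oset V x -> (forall y, oset V y -> r y = 0) -> vreg x r.
Proof.
move=> Vx r0; split; last exact: r0.
by apply: (reg_loc Vx _ (reg0 x)) => y Vy; rewrite r0.
Qed.

Lemma vreg_chexp x : chexp x = 1%N \/ prime (chexp x) /\ vreg x (chexp x)%:R.
Proof.
have [|[pr e0]] := char_exponentP (residue_field x); first by left.
right; split=> //; split.
  elim: (chexp x) => [|n IHn]; first exact: reg0.
  by rewrite mulrS; apply: regD => //; exact: reg1.
have natE n : (n%:R : tfun K) x = n%:R by elim: n => // n IHn; rewrite !mulrS tfunD IHn.
rewrite natE; have := congr1 (@to_kperf X x) e0.
by rewrite rmorph_nat rmorph0.
Qed.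

Lemma reg_inv x r : reg x r -> r x <> 0 -> exists (W : opens X) r',
  [/\ oset W x, reg x r' & forall y, oset W y -> r y * r' y = 1].
Proof.
move=> [V [s [Vx rs]]]; rewrite rs // => /eqP s0.
have sx : germ_unit x s by apply: contrapT => /value_eq0/eqP; rewrite (negPf s0).
have [|s' ss'] := @invertible_germ_unit X V (nonvan s) (@nonvan_sub _ _ s) s; first by [].
exists (nonvan s), (value s'); split=> //; first exact: reg_value.
move=> y sy; rewrite rs; last exact: germ_unit_dom sy.
by rewrite -(value_res (@nonvan_sub _ _ s)) // -valueM ss' value1.
Qed.

Definition regular_germs x : germ_ring (tfun K) :=
  GermRing (@reg1 x) (@regN1 x) (@regD x) (@regM x) (@vreg0 x) (@vreg_reg x)
    (@vregD x) (@vregM x) (vreg_chexp x).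

Definition awn_germ x : set (tfun K) := wsub (regular_germs x).

Let rad x : set (tfun K) := rad_integral (gideal (regular_germs x)).

Lemma awn_reg x r : reg x r -> awn_germ x r.
Proof. exact: (@wsub_id _ (regular_germs x)). Qed.
Lemma awn1 x : awn_germ x 1. Proof. exact/awn_reg/reg1. Qed.
Lemma awnN1 x : awn_germ x (- 1). Proof. exact/awn_reg/regN1. Qed.
Lemma awnD x b b' : awn_germ x b -> awn_germ x b' -> awn_germ x (b + b').
Proof. exact: wsubD. Qed.
Lemma awnM x b b' : awn_germ x b -> awn_germ x b' -> awn_germ x (b * b').
Proof. exact: wsubM. Qed.
Lemma awn_integral x b : awn_germ x b -> integral (gring (regular_germs x)) b.
Proof. exact: wsub_integral. Qed.
Lemma awn_rad x b : rad_integral (gideal (regular_germs x)) b -> awn_germ x b.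
Proof. exact: rad_wsub. Qed.

Lemma awn_loc x b b' V : oset V x -> (forall y, oset V y -> b y = b' y) ->
  awn_germ x b -> awn_germ x b'.
Proof.
move=> Vx bb' hb; have -> : b' = (b' - b) + b by rewrite subrK.
apply: (awnD _ hb); apply: awn_reg; apply: vreg_reg; apply: (vreg_local Vx) => y Vy.
by rewrite tfunD tfunN bb' // subrr.
Qed.

Lemma span_vreg_eq0 x E r : span (gideal (regular_germs x)) E r -> r x = 0.
Proof.
elim=> // s u t [_ s0] _ _ IH.
by rewrite tfunD tfunM s0 mul0r add0r.
Qed.

Lemma rad_eq0 x c : rad_integral (gideal (regular_germs x)) c -> c x = 0.
Proof.
move=> /rad_power[d].
move=> /span_vreg_eq0; rewrite tfunX => /eqP; rewrite expf_eq0 => /andP[_ /eqP //].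
Qed.

Lemma awn_power x b : awn_germ x b -> exists k a, [/\ reg x a,
  rad_integral (gideal (regular_germs x)) (b ^+ (chexp x ^ k) - a) & b x ^+ (chexp x ^ k) = a x].
Proof.
move=> [k [a [ra h]]]; exists k, a; split=> //; apply/eqP; rewrite -subr_eq0.
by rewrite -(tfunX b) -tfunN -tfunD; apply/eqP; exact: rad_eq0.
Qed.

Lemma chexp_gt0 x k : (0 < chexp x ^ k)%N.
Proof. by rewrite expn_gt0; case: (vreg_chexp x) => [->|[/prime_gt0 ->]]. Qed.

(** Substitution of -a for c in a polynomial with coefficients vanishing at x. The result [r'] is
    regular and differs from r by a multiple of -a - c, which is -b^q in the application, where c =
    b^q - a. *)
Lemma span_powers_shift x c a r : integral (gring (regular_germs x)) c -> reg x a ->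
  span (gideal (regular_germs x)) (powers c) r -> exists r' S,
    [/\ reg x r', r' x = 0, integral (gring (regular_germs x)) S & r' - r = (- a - c) * S].
Proof.
move=> ic ra; elim=> [|h u t [hr h0] [j ->] _ [r' [S [rr' r'0 iS E]]]].
  exists 0, 0; split.
  - exact: reg0.
  - by [].
  - by apply: integral_id; exact: reg0.
  - by rewrite subrr mulr0.
pose s : tfun K := \sum_(i < j) (- a) ^+ (j.-1 - i) * c ^+ i.
exists (h * (- a) ^+ j + r'), (h * s + S); split.
- by apply: regD => //; apply: regM => //; exact/regX/regN.
- by rewrite tfunD tfunM h0 mul0r add0r.
- apply: integralD => //; apply: integralM; first exact: integral_id.
  apply: integral_sum => i _.
  by apply: integralM; apply: integralX; [exact/integral_id/regN|].
- by rewrite opprD addrACA -mulrBr subrXX E mulrDr mulrCA.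
Qed.

(** Write b^q = a + c. Substituting -a for c in the relation for c^(d+1) changes it by a multiple of
    b^q. This exhibits the regular function [w], equal to (-a)^(d+1) at x and hence nonzero there,
    as b^q times an integral element; inverting [w] gives an inverse of b that is integral over the
    regular germs. *)
Lemma awn_inv x b : awn_germ x b -> b x <> 0 -> exists (W : opens X) b',
  [/\ oset W x, awn_germ x b' & forall y, oset W y -> b y * b' y = 1].
Proof.
move=> hb bx0; have ib := awn_integral hb.
have [k [a [ra hc ax]]] := awn_power hb; move: hc ax.
set q := (chexp x ^ k)%N => hc ax; set c := b ^+ q - a in hc.
have ic : integral (gring (regular_germs x)) c by exact: rad_integral_integral hc.
have [d hd] := rad_power hc.
have [r' [S [rr' r'0 iS E]]] := span_powers_shift ic ra hd.
pose S' : tfun K := \sum_(i < d.+1) (- a) ^+ (d - i) * c ^+ i.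
pose w : tfun K := (- a) ^+ d.+1 - r'.
have iS' : integral (gring (regular_germs x)) S'.
  apply: integral_sum => i _.
  by apply: integralM; apply: integralX; [exact/integral_id/regN|].
have wE : w = b ^+ q * (S - S').
  have -> : w = (- a) ^+ d.+1 - c ^+ d.+1 - (r' - c ^+ d.+1).
    by rewrite opprB addrA subrK.
  by rewrite subrXX E -mulrBr /c opprB addKr mulNr -mulrN opprB.
have rw : reg x w by apply: regD; [exact/regX/regN|exact: regN].
have ax0 : a x <> 0.
  by rewrite -ax => /eqP; rewrite expf_eq0 => /andP[_ /eqP].
have w0 : w x <> 0.
  rewrite /w tfunD tfunN r'0 subr0 tfunX tfunN => /eqP.
  by rewrite expf_eq0 oppr_eq0 => /andP[_ /eqP].
have [W [w' [Wx rw' ww']]] := reg_inv rw w0.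
have [W' [a' [W'x ra' aa']]] := reg_inv ra ax0.
pose T := S - S'; pose b' := b ^+ q.-1 * T * w'.
have q0 : q = q.-1.+1 by rewrite prednK // chexp_gt0.
have bb' y : oset W y -> b y * b' y = 1.
  move=> Wy; rewrite -(ww' y Wy) wE -/T /b'.
  have -> : b ^+ q = b * b ^+ q.-1 by rewrite -exprS -q0.
  by rewrite !tfunM !mulrA.
have ib' : integral (gring (regular_germs x)) b'.
  apply: integralM; last exact: integral_id.
  apply: integralM; first exact: integralX.
  exact: integralB.
exists W, b'; split=> //; exists k, a'; split=> //; rewrite -/q.
(* Where b' and a' invert b and a, 1/b^q - 1/a = -c/(a b^q). Thus [z] is zero near x, and the error
   of b' is c times an integral factor. *)
pose z := (b' ^+ q - a') + b' ^+ q * a' * c.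
have -> : b' ^+ q - a' = z - b' ^+ q * a' * c by rewrite /z addrK.
apply: radD; last first.
  apply: radN; apply: radM => //.
  by apply: integralM; [exact: integralX|exact: integral_id].
apply: rad_id; apply: (@vreg_local x z (ointer W W')) => // y [Wy W'y].
have e1 : b y ^+ q * b' y ^+ q = 1 by rewrite -exprMn bb' // expr1n.
rewrite /z /c !tfunE mulrBr.
have -> : b' y ^+ q * a' y * b y ^+ q = a' y by rewrite mulrAC [X in X * _]mulrC e1 mul1r.
have -> : b' y ^+ q * a' y * a y = b' y ^+ q.
  by rewrite -mulrA [X in _ * X]mulrC aa' // mulr1.
by rewrite addrA subrK subrr.
Qed.

Definition awn_data : local_data.
refine (@LocalData X K awn_germ awn1 awnN1 awnD awnM awn_loc _ _ _).
- move=> x b V Vx bV /invertible_field/eqP bx.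
  have [W [b' [Wx _ bb']]] := awn_inv (bV x Vx) bx.
  have hV y : oset (ointer V W) y -> b y <> 0.
    by move=> [_ /bb' e] b0; move: e; rewrite b0 mul0r => /esym/eqP; rewrite oner_eq0.
  (* The germ from [awn_inv] at x is controlled only at x. The pointwise inverse is controlled at
     every nearby y, since near y it coincides with the germ that [awn_inv] provides there. *)
  exists (ointer V W), (fun y => (b y)^-1); split=> // y [Vy Wy].
  have by0 : b y <> 0 by apply: hV.
  split; last by apply: divff; exact/eqP.
  have [W' [c [W'y hc bc]]] := awn_inv (bV y Vy) by0.
  apply: awn_loc W'y _ hc => t /bc e.
  have bt0 : b t != 0.
    by apply/eqP => b0; move/eqP: e; rewrite b0 mul0r eq_sym oner_eq0.
  by apply: (mulfI bt0); rewrite e divff.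
- by move=> x /invertible_field; rewrite eqxx.
- move=> x u v /invertible_field uv.
  have [u0|u0] := eqVneq (u : kperf x) 0; [right|left]; apply/invertible_field => //.
  by move: uv; rewrite u0 add0r.
Defined.

Definition awn_lrs : lrs := lspace awn_data.

Definition awn_fun U (s : sec U) : lsec (D := awn_data) U :=
  @lmk awn_data U (value s : tfun K) (fun x Ux => awn_reg (reg_value s Ux)).

Lemma awn_funE U (s : sec U) x : awn_fun s x = value s x.
Proof.
have [Ux|nUx] := pselect (oset U x); first exact: lmkE.
by rewrite lval_out // value_out.
Qed.

Lemma awn_fun_additive U : zmod_morphism (@awn_fun U).
Proof.
by move=> s t; apply: lsecP => x Ux; rewrite lsecD lsecN !awn_funE; exact: valueB.
Qed.

Lemma awn_fun_multiplicative U : monoid_morphism (@awn_fun U).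
Proof.
split=> [|s t]; apply: lsecP => x Ux; last by rewrite lsecM !awn_funE; exact: valueM.
by rewrite awn_funE value1 // lsec1.
Qed.

HB.instance Definition _ U :=
  GRing.isZmodMorphism.Build _ _ (@awn_fun U) (@awn_fun_additive U).
HB.instance Definition _ U :=
  GRing.isMonoidMorphism.Build _ _ (@awn_fun U) (@awn_fun_multiplicative U).

Lemma awn_germ_unit x U (s : lsec (D := awn_data) U) :
  @germ_unit awn_lrs x U s <-> s x <> 0.
Proof.
have [Ux|nUx] := pselect (oset U x); last first.
  by split=> [/germ_unit_dom //|]; rewrite lval_out.
by rewrite (@lgerm_unitP awn_data x U s Ux) invertible_field; split=> /eqP.
Qed.

Let sub_preim V : opreim (f := @idfun X) (fun S oS => oS) V `<=` V.
Proof. by []. Qed.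

Definition awn_proj : morphism awn_lrs X.
refine (@Morphism awn_lrs X idfun (fun S oS => oS)
  (fun V => (lres (D := awn_data) (@sub_preim V) \o @awn_fun V : {rmorphism _ -> _})) _ _).
- move=> V W h h' s; apply: lsecP => x Wx.
  rewrite [LHS]lresE // [RHS]lresE // [RHS]lresE //; last exact: h'.
  by rewrite [LHS]awn_funE [RHS]awn_funE; exact: value_res.
- move=> x V s hs; have Vx := germ_unit_dom hs; move: hs => /awn_germ_unit.
  rewrite [X in X <> _]lresE // [X in X <> _]awn_funE => h.
  by apply: contrapT => /value_eq0.
Defined.

Lemma awn_proj_fun (x : X) : awn_proj x = x.
Proof. by []. Qed.

End RegularGerms.

(** * The absolute weak normalization of an affine open is affine *)

Lemma spanZ (R : comPzRingType) (S E : set R) a r :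
  (forall s, S s -> S (a * s)) -> span S E r -> span S E (a * r).
Proof.
move=> hS; elim=> [|s u t Ss Eu _ IH]; first by rewrite mulr0; exact: span0.
by rewrite mulrDr mulrA; apply: span_cons => //; exact: hS.
Qed.

Section Clearing.
Variable X : lrs.
Let K (x : X) : comPzRingType := kperf x.
Variable U : opens X.
Hypothesis aU : affine U.
Implicit Types (r t c : tfun K) (f g a : sec U).

Let fv f : tfun K := value f.

Let fvM f g : fv (f * g) = fv f * fv g.
Proof. by apply: tfunP => y; exact: valueM. Qed.

Let regU : set (tfun K) := [set r | exists a, r = fv a].

Lemma clear_regular x r (N : set X) : oset U x -> open N -> N x -> reg x r ->
  exists f, [/\ germ_unit x f, nonvan f `<=` N & exists a, fv f * r = fv a].
Proof.
move=> Ux oN Nx [V [s [Vx rs]]]; have [base _ _ loc] := aU.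
have [|g [gx gVN]] := base x (V `&` N) Ux _ (conj Vx Nx).
  by apply: openI => //; exact: oopen.
have gV : nonvan g `<=` V by move=> y /gVN[].
have [//|_ l2 _] := loc g (nonvan g) (@nonvan_sub _ _ g).
have [a [n e]] := l2 (res gV s).
(* The extra factor g makes both sides vanish off D(g), so the identity holds at all points although
   r is known only on V. It also keeps the locus inside N when n = 0. *)
exists (g ^+ n.+1); split.
- exact: germ_unitX.
- move=> y; rewrite /nonvan /= exprS => /germ_unitM[gy _].
  by case: (gVN y gy).
exists (g * a); rewrite exprS !fvM; apply: tfunP => y; rewrite /fv !tfunE.
have [gy|/value_eq0 ->] := pselect (germ_unit y g); last by rewrite !mul0r.
have Uy := germ_unit_dom gy; rewrite -mulrA; congr (_ * _).
have := congr1 (fun s => value s y) e; rewrite valueM valueX // !value_res //.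
by move=> <-; rewrite rs; [rewrite valueX // mulrC|exact: (gV y gy)].
Qed.

Lemma clear_span x E r (N : set X) : oset U x -> open N -> N x -> span (reg x) E r ->
  exists f, [/\ germ_unit x f, nonvan f `<=` N & span regU E (fv f * r)].
Proof.
move=> Ux oN Nx; elim=> [|s u t rs Eu _ [f [fx fN hf]]].
  have [f [fx fN _]] := clear_regular Ux oN Nx (reg1 x).
  by exists f; split=> //; rewrite mulr0; exact: span0.
have [g [gx gN [a ga]]] := clear_regular Ux oN Nx rs.
exists (f * g); split.
- exact/germ_unitM.
- by move=> y /germ_unitM[fy _]; exact: fN.
have -> : fv (f * g) * (s * u + t) = fv (f * a) * u + fv g * (fv f * t).
  by rewrite !fvM -ga; ring.
apply: span_cons => //; first by exists (f * a).
by apply: spanZ hf => _ [b ->]; exists (g * b); rewrite fvM.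
Qed.

Lemma clear_spans x E (L : seq (tfun K)) (N : set X) : oset U x -> open N -> N x ->
  (forall r, r \in L -> span (reg x) E r) ->
  exists f, [/\ germ_unit x f, nonvan f `<=` N &
    forall r, r \in L -> span regU E (fv f * r)].
Proof.
move=> Ux oN Nx; elim: L => [_|r L IHL hL].
  have [f [fx fN _]] := clear_regular Ux oN Nx (reg1 x).
  by exists f; split.
have [|f [fx fN hf]] := IHL; first by move=> q qL; apply: hL; rewrite inE qL orbT.
have [g [gx gN hg]] := clear_span Ux oN Nx (hL r (mem_head _ _)).
exists (f * g); split.
- exact/germ_unitM.
- by move=> y /germ_unitM[fy _]; exact: fN.
move=> q; rewrite inE fvM => /orP[/eqP ->|qL].
  by rewrite -mulrA; apply: spanZ hg => _ [b ->]; exists (f * b); rewrite fvM.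
rewrite mulrAC [X in span _ _ X]mulrC; apply: spanZ (hf q qL) => _ [b ->].
by exists (g * b); rewrite fvM.
Qed.

(* A germ of the weak normalization on V extends to U once multiplied by the square
   of a denominator: it becomes integral over the ideal of functions vanishing on the
   zeros of the denominator. *)
Lemma awn_extend (V : opens X) (t : lsec (D := awn_data X) V) x :
  V `<=` U -> oset V x -> exists f, germ_unit x f /\
    exists b : lsec (D := awn_data X) U, forall y, value f y * t y = b y.
Proof.
move=> VU Vx; have Ux := VU x Vx.
have [E [E1 tE]] := awn_integral (lval_germ t Vx).
have [|f [fx fV hf]] := @clear_spans x [set` E]
    [seq (t : tfun K) * u | u <- E] V Ux (oopen V) Vx.
  by move=> _ /mapP[u uE ->]; exact: tE.
exists (f * f); split; first exact/germ_unitM.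
pose b : tfun K := fv (f * f) * (t : tfun K).
have bU y : oset U y -> ld_germ (l := awn_data X) y b.
  move=> Uy; have [fy|fy] := pselect (germ_unit y f).
    apply: awnM; first exact/awn_reg/reg_value.
    by apply: (lval_germ t); exact: fV.
  apply: awn_rad; exists 0%N; rewrite expr1; exists E; split=> // u uE.
  have := hf _ (map_f _ uE); rewrite /b fvM -!mulrA.
  elim=> [|s v w [a ->] Ev _ IH]; first by rewrite mulr0; exact: span0.
  rewrite mulrDr mulrA; apply: span_cons => //; split.
    by apply: regM; exact: reg_value.
  by rewrite tfunM /fv; move/value_eq0: fy => ->; rewrite mul0r.
exists (@lmk (awn_data X) U b bU) => y; have [Uy|nUy] := pselect (oset U y); first by rewrite lmkE.
by rewrite (@lval_out (awn_data X) _ _ _ nUy) (lval_out t) ?mulr0 // => /VU.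
Qed.

Let Wsec := lsec (D := awn_data X) U.

Let bX (b : Wsec) n y : oset U y -> (b ^+ n) y = b y ^+ n.
Proof. exact: (@lsecX (awn_data X)). Qed.

Section PrimeEvaluation.
Variables (Q : prime_ideal Wsec) (x : X).
Hypothesis Ux : oset U x.
Hypothesis QU : forall f, pideal Q (awn_fun f) <-> ~ germ_unit x f.

(** Clearing denominators in h c^j turns h into a regular section a vanishing at x and c^j into a
    power of [gam]. The result is a multiple of a, which lies in Q because Q meets the regular
    sections in those vanishing at x. *)
Lemma prime_span c r g (gam : Wsec) : germ_unit x g ->
  (forall y, value g y * c y = gam y) -> span (vreg x) (powers c) r ->
  exists f (rho : Wsec), [/\ germ_unit x f, pideal Q rho &
    forall y, value f y * r y = rho y].
Proof.
move=> gx gc; elim=> [|h _ t [hr h0] [j ->] _ [f2 [rho2 [f2x Q2 E2]]]].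
  by exists g, 0; split=> // [|y]; [exact: pideal0|rewrite lsec0 mulr0].
have [f1 [f1x _ [a fa]]] := clear_regular Ux (oopen U) Ux hr.
have fay y : value f1 y * h y = value a y.
  by have := congr1 (fun r : tfun K => r y) fa.
exists (f1 * g ^+ j * f2), (awn_fun f2 * gam ^+ j * awn_fun a + awn_fun (f1 * g ^+ j) * rho2).
split.
- by rewrite !germ_unitM; split=> //; split=> //; exact: germ_unitX.
- apply: pidealD; last exact: pidealM.
  by apply: pidealM; apply/QU/value_eq0; rewrite -fay h0 mulr0.
move=> y; have [Uy|nUy] := pselect (oset U y); last first.
  by rewrite value_out // (@lval_out (awn_data X) _ _ _ nUy) mul0r.
rewrite lsecD !lsecM lsecX // !awn_funE tfunD tfunM tfunX !valueM valueX //.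
have key (R : comPzRingType) (u v w p z o : R) :
    u * v ^+ j * w * (p * z ^+ j + o) = w * (v * z) ^+ j * (u * p) + u * v ^+ j * (w * o).
  by rewrite exprMn; ring.
by rewrite -fay -gc -E2; exact: (key (kperf y)).
Qed.

(** A prime of the weakly normal sections is determined by its trace on regular sections. The
    cleared error [gam] lies in Q, by its relation and [prime_span]; so modulo Q, g b^q is the
    regular section a', for which membership in Q means vanishing at x. *)
Lemma prime_evaluation (b : Wsec) : pideal Q b <-> b x = 0.
Proof.
have [k [a [ra hc bx]]] := awn_power (lval_germ b Ux).
set q := (chexp x ^ k)%N in hc bx.
have q0 : (0 < q)%N by exact: chexp_gt0.
have [g [gx _ [a' ga]]] := clear_regular Ux (oopen U) Ux ra.
have gay y : value g y * a y = value a' y.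
  by have := congr1 (fun r : tfun K => r y) ga.
set c := _ - a in hc; pose gam : Wsec := awn_fun g * b ^+ q - awn_fun a'.
have gc y : value g y * c y = gam y.
  have [Uy|nUy] := pselect (oset U y); last first.
    by rewrite value_out // (@lval_out (awn_data X) _ _ _ nUy) mul0r.
  rewrite lsecD lsecN lsecM (bX _ _ Uy) !awn_funE -gay /c tfunD tfunN tfunX.
  by rewrite mulrBr.
have [d hd] := rad_power hc.
have [f [rho [fx Qrho E]]] := prime_span gx gc hd.
have Qgam : pideal Q gam.
  have : pideal Q (awn_fun f * gam ^+ d.+1).
    have -> : awn_fun f * gam ^+ d.+1 = awn_fun g ^+ d.+1 * rho.
      apply: lsecP => y Uy; rewrite !lsecM.
      rewrite !(bX _ _ Uy).
      have eX : gam y ^+ d.+1 = value g y ^+ d.+1 * c y ^+ d.+1.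
        by rewrite -gc; exact: (exprMn (R := kperf y)).
      have eR : rho y = value f y * c y ^+ d.+1 by rewrite -E tfunX.
      by rewrite eX eR !awn_funE; exact: (mulrCA (R := kperf y)).
    exact: pidealM.
  by case/pideal_prime => [/QU //|/pidealX].
have nQg : ~ pideal Q (awn_fun g) by move=> /QU; apply.
have gx0 : value g x != 0 by apply/eqP => /value_eq0.
have bE : awn_fun g * b ^+ q = gam + awn_fun a' by rewrite /gam subrK.
have a'E : awn_fun a' = awn_fun g * b ^+ q - gam by rewrite bE addrC addKr.
split=> [Qb|b0].
  have : pideal Q (awn_fun a').
    rewrite a'E; apply: pidealD; last exact: pidealN.
    by apply: pidealM; rewrite -(prednK q0) exprSr; exact: pidealM.
  move=> /QU/value_eq0; rewrite -gay -bx => /eqP.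
  by rewrite mulf_eq0 (negPf gx0) expf_eq0 /= => /andP[_ /eqP].
have : pideal Q (awn_fun g * b ^+ q).
  rewrite bE; apply: pidealD => //; apply/QU/value_eq0.
  by rewrite -gay -bx b0 expr0n gtn_eqF // mulr0.
by case/pideal_prime => // /pidealX.
Qed.

End PrimeEvaluation.

Lemma awn_affine : affine (X := awn_lrs X) U.
Proof.
have [base prim inj loc] := aU.
have gu (x : X) f : @germ_unit (awn_lrs X) x U (awn_fun f) <-> germ_unit x f.
  rewrite awn_germ_unit awn_funE; split=> h; first by apply: contrapT => /value_eq0.
  by move=> /value_eq0.
have evalQ (Q : prime_ideal Wsec) : exists x, oset U x /\ forall b, pideal Q b <-> b x = 0.
  have [x [Ux Qx]] := prim (contraction (@awn_fun X U) Q).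
  by exists x; split=> // b; apply: prime_evaluation.
split.
- move=> x V Ux oV Vx; have [s [sx sV]] := base x V Ux oV Vx.
  by exists (awn_fun s); split=> [|y /gu]; [exact/gu|exact: sV].
- move=> Q; have [x [Ux Qx]] := evalQ Q; exists x; split=> // s.
  by rewrite Qx awn_germ_unit; split=> [->|]; [apply|exact: contrapT].
- by move=> x y Ux Uy h; apply: inj => // s; rewrite -!gu.
move=> s W h Ws; split.
- by apply: invertible_germ_unit => x /Ws.
(* [I] is the ideal of denominators of t. A prime containing [I] but not s would sit at a point of
   W, where [awn_extend] yields a denominator outside that prime. *)
- move=> t; pose I : set Wsec := [set r | exists c : Wsec, forall y, r y * t y = c y].
  apply: contrapT => none.
  have [||Q IQ nQs] := @prime_avoiding_powers Wsec I s.
  + split=> [|r r' [c e] [c' e']|r r' [c e]].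
    * by exists 0 => y; rewrite !lsec0 mul0r.
    * by exists (c + c') => y; rewrite !lsecD mulrDl e e'.
    * by exists (r * c) => y; rewrite !lsecM -mulrA e.
  + move=> n [c e]; apply: none; exists c, n; apply: lsecP => y Wy.
    have Uy := h y Wy.
    by rewrite lsecM lsecX // [lres h s y]lresE // [RHS]lresE // -e lsecX // mulrC.
  have [x [Ux Qx]] := evalQ Q.
  have Wx : oset W x by apply/Ws/awn_germ_unit => s0; exact/nQs/Qx.
  have [f [fx [b fb]]] := @awn_extend W t x h Wx.
  have : pideal Q (awn_fun f) by apply: IQ; exists b => y; rewrite awn_funE; exact: fb.
  by move=> /Qx; rewrite awn_funE => /value_eq0.
(* The exponent 1 suffices for functions: r vanishes on W, and s vanishes on the rest of U. *)
- move=> r r0; exists 1%N; rewrite expr1; apply: lsecP => y Uy; rewrite lsecM lsec0.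
  have [sy|/awn_germ_unit/contrapT ->] := pselect (@germ_unit (awn_lrs X) y U s);
    last by rewrite mul0r.
  have Wy : oset W y by exact/Ws.
  have := congr1 (fun u : lsec W => u y) r0.
  by rewrite [lres h r y]lresE // lsec0 => ->; rewrite mulr0.
Qed.

End Clearing.

Definition awn (X : scheme) : scheme.
refine (@Scheme (awn_lrs X) _) => x.
have [U [Ux _ aU]] := affine_basis (X := X) (x := x) openT I.
by exists U => //; apply/affineP; exact: awn_affine.
Defined.

(** * Functoriality and idempotence of the absolute weak normalization *)

Lemma rmorphism_inverse (A B : comPzRingType) (f : {rmorphism A -> B}) :
  injective f -> (forall b, exists a, f a = b) ->
  exists g : {rmorphism B -> A}, cancel f g /\ cancel g f.
Proof.
move=> inj /choice[g fg].
have gf : cancel f g by move=> a; apply: inj; rewrite fg.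
have ga : zmod_morphism g by move=> a b; apply: inj; rewrite rmorphB !fg.
have gm : monoid_morphism g.
  by split=> [|a b]; apply: inj; rewrite ?rmorph1 ?rmorphM !fg.
pose m1 := GRing.isZmodMorphism.Build B A g ga.
pose m2 := GRing.isMonoidMorphism.Build B A g gm.
by exists (HB.pack g m1 m2 : {rmorphism B -> A}).
Qed.

Section Pull.
Variables (T X : lrs) (g : morphism T X).
Implicit Types (r : tfun (fun x : X => kperf x)).

Definition pull (r : tfun (fun x : X => kperf x)) : tfun (fun t : T => kperf t) :=
  fun t => kmap g t (r (g t)).

Lemma pull_additive : zmod_morphism pull.
Proof. by move=> r r'; apply: tfunP => t; exact: rmorphB. Qed.

Lemma pull_multiplicative : monoid_morphism pull.
Proof.
by split=> [|r r']; apply: tfunP => t; [exact: rmorph1|exact: rmorphM].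
Qed.

HB.instance Definition _ := GRing.isZmodMorphism.Build _ _ pull pull_additive.
HB.instance Definition _ := GRing.isMonoidMorphism.Build _ _ pull pull_multiplicative.

Lemma reg_pull t r : reg (g t) r -> reg t (pull r).
Proof.
move=> [V [s [Vx rs]]]; exists (opreim (mcts g) V), (msharp g V s); split=> // y Vy.
by rewrite -kmapE -rs.
Qed.

Lemma awn_pull t r : awn_germ (g t) r -> awn_germ t (pull r).
Proof.
apply: wsub_morph; [exact: reg_pull| |exact/esym/chexp_map].
move=> a [ra a0]; split; first exact: reg_pull.
by rewrite -(rmorph0 (kmap g t)) -a0.
Qed.

Let awn_map_sharp (V : opens (awn_lrs X)) (b : lsec (D := awn_data X) V) :
    lsec (D := awn_data T) (opreim (mcts g) V) :=
  @lmk (awn_data T) (opreim (mcts g) V) (pull b) (fun t Vt => awn_pull (lval_germ b Vt)).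

Let awn_map_sharpE V b t : oset (opreim (mcts g) V) t ->
  awn_map_sharp (V := V) b t = kmap g t (b (g t)).
Proof. by move=> Vt; rewrite [LHS]lmkE. Qed.

Let awn_map_additive V : zmod_morphism (@awn_map_sharp V).
Proof.
move=> b b'; apply: lsecP => t Vt; rewrite lsecD lsecN !awn_map_sharpE //.
by rewrite lsecD lsecN rmorphB.
Qed.

Let awn_map_multiplicative V : monoid_morphism (@awn_map_sharp V).
Proof.
split=> [|b b']; apply: lsecP => t Vt; last first.
  by rewrite lsecM !awn_map_sharpE // lsecM rmorphM.
by rewrite awn_map_sharpE // !lsec1 // rmorph1.
Qed.

HB.instance Definition _ V :=
  GRing.isZmodMorphism.Build _ _ (@awn_map_sharp V) (@awn_map_additive V).
HB.instance Definition _ V :=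
  GRing.isMonoidMorphism.Build _ _ (@awn_map_sharp V) (@awn_map_multiplicative V).

Definition awn_map : morphism (awn_lrs T) (awn_lrs X).
refine (@Morphism (awn_lrs T) (awn_lrs X) g (mcts g)
  (fun V => (@awn_map_sharp V : {rmorphism _ -> _})) _ _).
- move=> V W h h' s; apply: lsecP => t Wt.
  rewrite [LHS]awn_map_sharpE // [RHS]lresE // [RHS]awn_map_sharpE; last exact: h'.
  by rewrite [X in kmap g t X]lresE.
- move=> t V s ht; have Vt := germ_unit_dom ht; move: ht => /awn_germ_unit.
  rewrite [X in X <> _]awn_map_sharpE // => h; apply/awn_germ_unit => s0; apply: h.
  by rewrite s0 rmorph0.
Defined.

Lemma awn_map_proj : mcomp g (awn_proj T) = mcomp (awn_proj X) awn_map.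
Proof.
apply: morphism_ext => // V s W h h'; apply: lsecP => t Wt.
rewrite [LHS]lresE // [RHS]lresE // [RHS]awn_map_sharpE; last exact: h'.
rewrite [X in kmap g t X]lresE; last exact: h'.
rewrite [LHS]lresE; last exact: h.
by rewrite [LHS]awn_funE [X in kmap g t X]awn_funE kmapE.
Qed.

End Pull.

Section Projection.
Variable X : lrs.
Let W : lrs := awn_lrs X.

Lemma awn_projE (V : opens X) (s : sec V) x : oset V x ->
  (msharp (awn_proj X) V s : lsec (D := awn_data X) _) x = value s x.
Proof. by move=> Vx; rewrite [LHS]lresE // awn_funE. Qed.

(** A section of X^awn has two evaluations at x: as a function, in K(x) for X, and as a section of a
    locally ringed space, in K(x) for X^awn. A common p-power of both comes from one regular section
    of X. *)
Lemma awn_proj_power (V : opens W) (s : sec V) x : oset V x ->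
  exists k (U : opens X) (a : sec U), [/\ oset U x,
    (s : lsec (D := awn_data X) V) x ^+ (chexp (X := X) x ^ k) = value a x &
    value s x ^+ (chexp (X := W) x ^ k) = value (msharp (awn_proj X) U a) x].
Proof.
move=> Vx; have [k [r [[U [a [Ux ra]]] _ E]]] := awn_power (lval_germ s Vx).
exists k, U, a; split=> //; first by rewrite E ra.
rewrite [chexp _](chexp_map (awn_proj X)); set q := (_ ^ k)%N.
pose I : opens W := ointer V (opreim (mcts (awn_proj X)) U).
have hV : I `<=` V by move=> y [].
have hU : I `<=` opreim (mcts (awn_proj X)) U by move=> y [].
have Ix : oset I x by split.
rewrite -(value_res hV s Ix) -(value_res hU _ Ix) -valueX //.
apply/eqP; rewrite -subr_eq0 -valueB; apply/eqP/value_eq0 => /awn_germ_unit; apply.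
rewrite lsecD lsecN lsecX // [lres hV s x]lresE // [lres hU _ x]lresE //.
rewrite awn_projE //.
by rewrite -ra // -E subrr.
Qed.

Lemma awn_proj_radicial : radicial (awn_proj X).
Proof.
move=> x V s Vx; have [k [U [a [Ux _ E]]]] := awn_proj_power s Vx.
by exists k, U, a.
Qed.

(** The two evaluations correspond under the map of perfect fields: they agree after a p-power, and
    that power is injective. *)
Lemma awn_value (V : opens W) (s : sec V) x : oset V x ->
  kmap (awn_proj X) x ((s : lsec (D := awn_data X) V) x) = value s x.
Proof.
move=> Vx; have [k [U [a [Ux E E']]]] := awn_proj_power s Vx.
apply: (@kperf_exp_inj W x k); rewrite /= E' -kmapE -E.
by rewrite [chexp _](chexp_map (awn_proj X)) rmorphXn.
Qed.

Lemma awn_reduced (U : opens W) (s : sec U) n : s ^+ n = 0 -> s = 0.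
Proof.
move=> sn; apply: lsecP => x Ux; have := congr1 (fun t : lsec U => t x) sn.
rewrite [X in X = _]lsecX // !lsec0 => /eqP.
by rewrite expf_eq0 => /andP[_ /eqP].
Qed.

End Projection.

Lemma awn_scheme_reduced (X : scheme) : reduced (awn X).
Proof. by move=> U s n; exact: awn_reduced. Qed.

Lemma kperf_has_root (X : lrs) (x : X) (u : kperf x) k : exists v, v ^+ (chexp x ^ k) = u.
Proof.
elim: k => [|k [v vu]]; first by exists u; rewrite expn0.
suff [w wv] : exists w : kperf x, w ^+ chexp x = v.
  by exists w; rewrite expnS exprM wv.
have [e1|[pe e0]] := char_exponentP (residue_field x).
  by exists v; rewrite /chexp e1.
have chP : char_exponent (residue_field x) \in [pchar perfect_closure (residue_field x)].
  rewrite (fmorph_pchar (to_perfect_closure (residue_field x))).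
  by apply/andP; split=> //; exact/eqP.
have [w wv] := perfect_closure_perfect chP (@kperf_perfect X x v).
by exists (@perfect_kperf X x w); rewrite -rmorphXn wv kperf_perfectK.
Qed.

Section RadicialInverse.
Variables (Y X : lrs) (f : morphism Y X).
Hypotheses (f_inj : injective f) (f_surj : forall x, exists y, f y = x).
Hypothesis f_rad : radicial f.

(** Some p-power of u is the value of a section, a further one is a value coming from X, and the
    required root exists in the perfect field at f y. *)
Lemma kmap_surj (y : Y) (u : kperf y) : exists v, kmap f y v = u.
Proof.
have [k [V [s [Vy us]]]] := kperf_root u.
have [k' [W [a [Wx sa]]]] := f_rad s Vy.
have [v va] := kperf_has_root (value a (f y)) (k + k').
exists v; apply: (@kperf_exp_inj Y y (k + k')) => /=.
have := congr1 (kmap f y) va; rewrite rmorphXn -(chexp_map f) => ->.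
by rewrite kmapE -sa -us -exprM -expnD.
Qed.

Lemma pull_inj : injective (pull f).
Proof.
move=> r r' e; apply: tfunP => x; have [y <-] := f_surj x.
by apply: (fmorph_inj (kmap f y)); exact: (tfun_eq y e).
Qed.

Lemma pull_surj (c : tfun (fun y : Y => kperf y)) : exists r, pull f r = c.
Proof.
(* The fields depend on the point, so the value is chosen at x and compared with c y by transport
   along x = f y; injectivity leaves only one such y. *)
have h : forall x : X, exists w : kperf x, forall y (e : x = f y),
    kmap f y (eq_rect x (fun x => kperf x : Type) w (f y) e) = c y.
  move=> x; have [y yx] := f_surj x; subst x; have [v vc] := kmap_surj (c y).
  exists v => y' e; have ?: y = y' by exact: f_inj.
  by subst y'; rewrite (Prop_irrelevance e erefl).
exists (fun x => sval (cid (h x))); apply: tfunP => y.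
exact: (svalP (cid (h (f y))) y erefl).
Qed.

Lemma pull_inverse :
  exists push : {rmorphism tfun (fun y : Y => kperf y) -> tfun (fun x : X => kperf x)},
    cancel (pull f) push /\ cancel push (pull f).
Proof. exact: rmorphism_inverse pull_inj pull_surj. Qed.

End RadicialInverse.

Section ClosedUnderGerms.
Variable W : lrs.
Hypothesis value_surj : forall (V : opens W) (c : tfun (fun x : W => kperf x)),
  (forall x, oset V x -> awn_germ x c) ->
  exists s : sec V, forall x, oset V x -> value s x = c x.
Hypothesis value_inj : forall (V : opens W) (s t : sec V),
  (forall x, oset V x -> value s x = value t x) -> s = t.

Let cts (S : set W) (oS : open S) : open (@idfun W @^-1` S) := oS.

Let sharp (V : opens W) (c : lsec (D := awn_data W) V) :
    sec (opreim (f := @idfun W) cts V) :=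
  sval (cid (@value_surj (opreim (f := @idfun W) cts V) c (@lval_germ _ _ c))).

Let sharpE V (c : lsec (D := awn_data W) V) x : oset V x -> value (sharp c) x = c x.
Proof. by rewrite /sharp; case: cid => s /= h; exact: h. Qed.

Let sharp_additive V : zmod_morphism (@sharp V).
Proof.
move=> c c'; apply: value_inj => x Vx.
by rewrite valueB !sharpE // lsecD lsecN.
Qed.

Let sharp_multiplicative V : monoid_morphism (@sharp V).
Proof.
split=> [|c c']; apply: value_inj => x Vx.
  by rewrite sharpE // lsec1 // value1.
by rewrite valueM !sharpE // lsecM.
Qed.

HB.instance Definition _ V :=
  GRing.isZmodMorphism.Build _ _ (@sharp V) (@sharp_additive V).
HB.instance Definition _ V :=
  GRing.isMonoidMorphism.Build _ _ (@sharp V) (@sharp_multiplicative V).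

Definition awn_section : morphism W (awn_lrs W).
refine (@Morphism W (awn_lrs W) idfun cts (fun V => (@sharp V : {rmorphism _ -> _})) _ _).
- move=> V U h h' s; apply: value_inj => x Ux.
  rewrite value_res // [RHS]sharpE; last exact: h Ux.
  by rewrite [LHS]sharpE // [LHS]lresE.
- move=> x V s hs; have Vx := germ_unit_dom hs.
  by apply/awn_germ_unit; rewrite -(sharpE s Vx) => /value_eq0.
Defined.

Lemma awn_section_fun x : awn_section x = x.
Proof. by []. Qed.

Lemma awn_proj_iso : isomorphism (awn_proj W).
Proof.
exists awn_section; split; apply: morphism_ext.
- by move=> x; rewrite mcomp_fun awn_section_fun awn_proj_fun mid_fun.
- move=> V s U h h'.
  apply: lsecP => x Ux; have Vx := h x Ux.
  apply: etrans (@lresE (awn_data W) _ U h _ x Ux) _.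
  apply: etrans (awn_projE (sharp s) Vx) _.
  apply: etrans (sharpE s Vx) _.
  by apply: esym; rewrite (msharp_mid s h' h); exact: (@lresE (awn_data W) V U h s x Ux).
- by move=> x; rewrite mcomp_fun awn_section_fun awn_proj_fun mid_fun.
- move=> V s U h h'; apply: value_inj => x Ux; have Vx := h x Ux.
  rewrite (value_res h _ Ux); apply: etrans (sharpE _ Vx) _.
  rewrite awn_projE //.
  by apply: esym; rewrite (msharp_mid s h' h) value_res.
Qed.

End ClosedUnderGerms.

Section Idempotent.
Variable X : lrs.
Let W : lrs := awn_lrs X.
Let p : morphism W X := awn_proj X.

Let vawn (x : X) : set (tfun (fun x : X => kperf x)) :=
  [set r | awn_germ x r /\ r x = 0].

Let awn_germs (x : X) : germ_ring (tfun (fun x : X => kperf x)).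
refine (@GermRing _ (@awn_germ X x) (vawn x) (chexp x) (awn1 x) (awnN1 x) (@awnD X x)
  (@awnM X x) _ _ _ _ _).
- by split=> //; exact/awn_reg/reg0.
- by move=> r [].
- by move=> r r' [h e] [h' e']; split; [exact: awnD|rewrite tfunD e e' addr0].
- by move=> r r' h [h' e']; split; [exact: awnM|rewrite tfunM e' mulr0].
- by case: (vreg_chexp x) => [|[? [? ?]]]; [left|right; do 2!split=> //; exact: awn_reg].
Defined.

Let push_subproof := cid (@pull_inverse W X p (fun x y e => e)
  (fun x => ex_intro _ x erefl) (@awn_proj_radicial X)).

Let push : {rmorphism tfun (fun x : W => kperf x) -> tfun (fun x : X => kperf x)} :=
  sval push_subproof.

Let pK : cancel (pull p) push. Proof. by case: (svalP push_subproof). Qed.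
Let Kp : cancel push (pull p). Proof. by case: (svalP push_subproof). Qed.

(** Carried back to X, the regular functions of X^awn are weakly normal on X, and those vanishing at
    x lie in the radical there. So [wsub_trans] applies with [awn_germs] as the intermediate germ
    ring. *)
Lemma awn_germ_idem (x : X) (b : tfun (fun x : X => kperf x)) :
  awn_germ (X := W) x (pull p b) -> awn_germ x b.
Proof.
move=> h; rewrite -[b]pK.
have regp r : reg (X := W) x r -> awn_germ x (push r).
  move=> [V [s [Vx rs]]]; apply: (@awn_loc X x s _ V Vx) (lval_germ s Vx) => y Vy.
  apply: (fmorph_inj (kmap p y)); rewrite awn_value // -rs //.
  exact: (tfun_eq y (esym (Kp r))).
apply: (@wsub_trans _ (regular_germs x) (awn_germs x)) => // [r [hr r0]|].
  have [k [a [ra hc ax]]] := awn_power hr.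
  have [n en] : exists n, (chexp x ^ k)%N = n.+1.
    by exists (chexp x ^ k).-1; rewrite prednK // chexp_gt0.
  apply: (@rad_root _ _ _ n); rewrite -en -(subrK a (_ ^+ _)); apply: radD => //.
  by apply: rad_id; split=> //; rewrite -ax r0 expr0n en.
apply: (@wsub_morph _ _ push _ (awn_germs x)) h.
- exact: regp.
- move=> r [hr r0]; split; first exact: regp.
  apply: (fmorph_inj (kmap p x)); rewrite rmorph0 -r0.
  exact: (tfun_eq x (Kp r)).
- exact: (@chexp_map W X p x).
Qed.

Lemma awn_value_surj (V : opens W) (c : tfun (fun x : W => kperf x)) :
  (forall x, oset V x -> awn_germ x c) ->
  exists s : sec V, forall x, oset V x -> value s x = c x.
Proof.
move=> cV; have pV (x : X) : oset V x -> awn_germ x (push c).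
  by move=> Vx; apply: awn_germ_idem; rewrite Kp; exact: cV.
exists (@lmk (awn_data X) V (push c) pV) => x Vx.
by rewrite -awn_value // lmkE //; exact: (tfun_eq x (Kp c)).
Qed.

End Idempotent.

Lemma awn_idem (X : lrs) : isomorphism (awn_proj (awn_lrs X)).
Proof.
apply: awn_proj_iso; first exact: awn_value_surj.
move=> V s t st; apply: lsecP => x Vx; apply: (fmorph_inj (kmap (awn_proj X) x)).
by rewrite !awn_value //; exact: st.
Qed.

Lemma mcompA (X Y Z T : lrs) (h : morphism Z T) (g : morphism Y Z) (f : morphism X Y) :
  mcomp h (mcomp g f) = mcomp (mcomp h g) f.
Proof. by apply: morphism_ext => // V s W k k'; exact: res_irr. Qed.

Lemma mcomp1m (X Y : lrs) (f : morphism X Y) : mcomp (mid Y) f = f.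
Proof.
apply: morphism_ext => // V s W k k'.
have h0 : opreim (mcts (mid Y)) V `<=` V by [].
have h1 : opreim (mcts f) (opreim (mcts (mid Y)) V) `<=` opreim (mcts f) V by [].
rewrite -(res_comp h1 k k').
transitivity (res k (msharp f (opreim (mcts (mid Y)) V) (res h0 s))).
  by congr (res k (msharp f (opreim (mcts (mid Y)) V) _)); exact: res_irr.
by rewrite (msharp_res h0 h1).
Qed.

Lemma mcompm1 (X Y : lrs) (f : morphism X Y) : mcomp f (mid X) = f.
Proof.
apply: morphism_ext => // V s W k k'.
have h0 : opreim (mcts (mid X)) (opreim (mcts f) V) `<=` opreim (mcts f) V by [].
transitivity (res k (res h0 (msharp f V s))); last exact: res_comp.
by congr (res k _); exact: res_irr.
Qed.

Lemma awn_proj_injective (X : lrs) : injective (awn_proj X).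
Proof. by move=> x y. Qed.

Lemma awn_mono (Z : scheme) (X : lrs) (g1 g2 : morphism Z (awn_lrs X)) :
  reduced Z -> mcomp (awn_proj X) g1 = mcomp (awn_proj X) g2 -> g1 = g2.
Proof.
apply: radicial_mono; [exact: awn_proj_injective|exact: awn_proj_radicial].
Qed.

Lemma awn_proj_universal_homeomorphism (X : scheme) :
  universal_homeomorphism (awn_proj X : morphism (awn X) X).
Proof.
move=> T P g p q [pq univ].
have [v [[pv qv] _]] := univ (awn T) (awn_map g) (awn_proj T) (esym (awn_map_proj g)).
(* By uniqueness in the pullback it suffices to compare both components. Those in T agree by
   naturality; those in X^awn agree because P^awn is reduced and the projection is monic on reduced
   schemes. As projections are the identity on points, this gives v (q z) = z. *)
have vq : mcomp v (awn_map q) = awn_proj P.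
  have e : mcomp (awn_proj X : morphism (awn X) X) (mcomp p (awn_proj P)) = mcomp g (mcomp q (awn_proj P)).
    by rewrite mcompA pq mcompA.
  have [w [_ wu]] := univ (awn P) _ _ e.
  rewrite -(wu (awn_proj P)) //; apply/esym/wu.
  have e2 : mcomp q (mcomp v (awn_map q)) = mcomp q (awn_proj P).
    by rewrite mcompA qv awn_map_proj.
  split=> //; apply: (@awn_mono (awn P) X); first exact: awn_scheme_reduced.
  apply: (etrans (mcompA (awn_proj X : morphism (awn X) X) p _)).
  by rewrite pq -mcompA e2 -e.
have vqE (z : P) : v (q z) = z.
  by have := congr1 (fun f : morphism (awn P) P => mfun f z) vq.
have qvE (t : T) : q (v t) = t.
  by have := congr1 (fun f : morphism (awn T) T => mfun f t) qv.
have qinj : injective q by move=> z z' /(congr1 v); rewrite !vqE.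
split; first by exists v.
move=> U; split=> [oU|oU].
  rewrite (_ : U = q @^-1` (q @` U)); first exact: mcts.
  by apply/seteqP; split=> [z Uz|z [z' Uz' /qinj <-]] //; exists z.
rewrite (_ : q @` U = v @^-1` U); first exact: (mcts v oU).
apply/seteqP; split=> [_ [z Uz <-]|t Ut] /=; first by rewrite vqE.
by exists (v t).
Qed.

(** * Affine schemes *)

Section LocalRing.
Local Open Scope quotient_scope.
Variables (R : comPzRingType) (P : prime_ideal R).

Let dom : Type := {s : R | ~ pideal P s}.
HB.instance Definition _ := gen_eqMixin dom.
HB.instance Definition _ := gen_choiceMixin dom.

Let mkdom s (hs : ~ pideal P s) : dom := exist (fun s => ~ pideal P s) s hs.
Let domM (s t : dom) : dom :=
  mkdom (s := sval s * sval t) (fun h => match pideal_prime h with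
    | or_introl hs => svalP s hs | or_intror ht => svalP t ht end).
Let dom1 : dom := mkdom (@pideal1 _ P).

Let fr_rel : rel (R * dom) := fun x y =>
  `[< exists u : dom, sval u * (x.1 * sval y.2) = sval u * (y.1 * sval x.2) >].

Let fr_equiv : equiv_class_of fr_rel.
Proof.
split=> [x|x y|y x z].
- by apply/asboolP; exists dom1.
- by apply/asboolP/asboolP => -[u e]; exists u.
- move=> /asboolP[u e] /asboolP[v e']; apply/asboolP; exists (domM (domM u v) y.2).
  case: u v e e' => [u hu] [v hv] /=.
  case: x y z => [a [s hs]] [b [t ht]] [c [w hw]] /= e e'.
  transitivity (v * w * (u * (a * t))); first by ring.
  by rewrite e; transitivity (u * s * (v * (b * w))); [ring|rewrite e'; ring].
Qed.

Let fr_canonical := EquivRelPack fr_equiv.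
Canonical fr_canonical.
Let loc : Type := {eq_quot fr_canonical}.
HB.instance Definition _ := Choice.on loc.

Let frac (a : R) (s : dom) : loc := \pi_{eq_quot fr_canonical} (a, s).

Let fracP a s b t : frac a s = frac b t <->
  exists u : dom, sval u * (a * sval t) = sval u * (b * sval s).
Proof. by split=> [/eqquotP/asboolP //|h]; apply/eqquotP/asboolP. Qed.

Let frac_surj (u : loc) : exists a s, u = frac a s.
Proof. by case E: (repr u) => [a s]; exists a, s; rewrite /frac -E [RHS]reprK. Qed.

Let ladd (u v : loc) : loc :=
  frac ((repr u).1 * sval (repr v).2 + (repr v).1 * sval (repr u).2)
       (domM (repr u).2 (repr v).2).
Let lmul (u v : loc) : loc :=
  frac ((repr u).1 * (repr v).1) (domM (repr u).2 (repr v).2).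
Let lopp (u : loc) : loc := frac (- (repr u).1) (repr u).2.

Let repr_frac a s : exists b t (u : dom), repr (frac a s) = (b, t) /\
  sval u * (a * sval t) = sval u * (b * sval s).
Proof.
case E: (repr (frac a s)) => [b t]; exists b, t.
suff /esym/fracP[u e] : frac b t = frac a s by exists u.
by rewrite {1}/frac -E [LHS]reprK.
Qed.

Let laddE a s b t : ladd (frac a s) (frac b t) = frac (a * sval t + b * sval s) (domM s t).
Proof.
have [a' [s' [u [E e]]]] := repr_frac a s; have [b' [t' [v [E' e']]]] := repr_frac b t.
rewrite /ladd E E' /=; apply/esym/fracP; exists (domM u v).
case: s s' t t' u v {E E'} e e' => [s hs] [s' hs'] [t ht] [t' ht'] [u hu] [v hv] /= e e'.
transitivity (v * t * t' * (u * (a * s')) + u * s * s' * (v * (b * t'))); first by ring.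
by rewrite e e'; ring.
Qed.

Let lmulE a s b t : lmul (frac a s) (frac b t) = frac (a * b) (domM s t).
Proof.
have [a' [s' [u [E e]]]] := repr_frac a s; have [b' [t' [v [E' e']]]] := repr_frac b t.
rewrite /lmul E E' /=; apply/esym/fracP; exists (domM u v).
case: s s' t t' u v {E E'} e e' => [s hs] [s' hs'] [t ht] [t' ht'] [u hu] [v hv] /= e e'.
transitivity ((u * (a * s')) * (v * (b * t'))); first by ring.
by rewrite e e'; ring.
Qed.

Let loppE a s : lopp (frac a s) = frac (- a) s.
Proof.
have [a' [s' [u [E e]]]] := repr_frac a s.
rewrite /lopp E /=; apply/esym/fracP; exists u.
by rewrite !mulNr !mulrN e.
Qed.

Let frac_eq a s b t : a * sval t = b * sval s -> frac a s = frac b t.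
Proof. by move=> e; apply/fracP; exists dom1; rewrite e. Qed.

Let laddA : associative ladd.
Proof.
move=> x y z; have [a [s ->]] := frac_surj x; have [b [t ->]] := frac_surj y.
have [c [u ->]] := frac_surj z; rewrite !laddE; apply: frac_eq => /=; ring.
Qed.
Let laddC : commutative ladd.
Proof.
move=> x y; have [a [s ->]] := frac_surj x; have [b [t ->]] := frac_surj y.
by rewrite !laddE; apply: frac_eq => /=; ring.
Qed.
Let ladd0 : left_id (frac 0 dom1) ladd.
Proof. by move=> x; have [a [s ->]] := frac_surj x; rewrite laddE; apply: frac_eq => /=; ring. Qed.
Let laddN : left_inverse (frac 0 dom1) lopp ladd.
Proof.
by move=> x; have [a [s ->]] := frac_surj x; rewrite loppE laddE; apply: frac_eq => /=; ring.
Qed.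
Let lmulA : associative lmul.
Proof.
move=> x y z; have [a [s ->]] := frac_surj x; have [b [t ->]] := frac_surj y.
have [c [u ->]] := frac_surj z; rewrite !lmulE; apply: frac_eq => /=; ring.
Qed.
Let lmulC : commutative lmul.
Proof.
move=> x y; have [a [s ->]] := frac_surj x; have [b [t ->]] := frac_surj y.
by rewrite !lmulE; apply: frac_eq => /=; ring.
Qed.
Let lmul1 : left_id (frac 1 dom1) lmul.
Proof. by move=> x; have [a [s ->]] := frac_surj x; rewrite lmulE; apply: frac_eq => /=; ring. Qed.
Let lmulD : left_distributive lmul ladd.
Proof.
move=> x y z; have [a [s ->]] := frac_surj x; have [b [t ->]] := frac_surj y.
have [c [u ->]] := frac_surj z; rewrite ?(laddE, lmulE); apply: frac_eq => /=; ring.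
Qed.

HB.instance Definition _ := GRing.isZmodule.Build loc laddA laddC ladd0 laddN.
HB.instance Definition _ := GRing.Zmodule_isComPzRing.Build loc lmulA lmulC lmul1 lmulD.

Let to_loc (a : R) : loc := frac a dom1.

Let to_loc_additive : zmod_morphism to_loc.
Proof.
move=> a b; rewrite -[RHS]/(ladd _ (lopp _)) loppE laddE; apply: frac_eq => /=; ring.
Qed.

Let to_loc_multiplicative : monoid_morphism to_loc.
Proof.
by split=> // a b; rewrite -[RHS]/(lmul _ _) lmulE; apply: frac_eq => /=; ring.
Qed.

HB.instance Definition _ := GRing.isZmodMorphism.Build R loc to_loc to_loc_additive.
HB.instance Definition _ := GRing.isMonoidMorphism.Build R loc to_loc to_loc_multiplicative.

(** The quotient construction is hidden here; afterwards the localization is known only by units,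
    fractions and kernel. *)
Lemma local_ring_subproof : {L : comPzRingType & {f : {rmorphism R -> L} |
  [/\ forall s, ~ pideal P s -> invertible (f s),
      forall x, exists a s, ~ pideal P s /\ x * f s = f a
    & forall a, f a = 0 -> exists s, ~ pideal P s /\ s * a = 0]}}.
Proof.
exists loc, to_loc; split=> [s hs|x|a].
- exists (frac 1 (mkdom hs)); rewrite -[LHS]/(lmul _ _) lmulE.
  by apply: frac_eq => /=; ring.
- have [a [s ->]] := frac_surj x; exists a, (sval s); split; first by case: s.
  by rewrite -[LHS]/(lmul _ _) lmulE; apply: frac_eq => /=; ring.
- move=> /fracP[u /= e]; exists (sval u); split; first by case: u {e}.
  by move: e; rewrite mulr1 mul0r mulr0.
Qed.

Definition local_ring : comPzRingType := projT1 local_ring_subproof.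

Definition to_local : {rmorphism R -> local_ring} := sval (projT2 local_ring_subproof).

Lemma to_local_inv s : ~ pideal P s -> invertible (to_local s).
Proof. by have [h _ _] := svalP (projT2 local_ring_subproof); exact: h. Qed.

Lemma local_ring_frac x : exists a s, ~ pideal P s /\ x * to_local s = to_local a.
Proof. by case: (svalP (projT2 local_ring_subproof)). Qed.

Lemma to_local_eq0 a : to_local a = 0 -> exists s, ~ pideal P s /\ s * a = 0.
Proof. by have [_ _ h] := svalP (projT2 local_ring_subproof); exact: h. Qed.

Lemma to_local_invP a : invertible (to_local a) <-> ~ pideal P a.
Proof.
split=> [[y ay] Pa|]; last exact: to_local_inv.
have [b [s [hs e]]] := local_ring_frac y.
have [|u [hu eu]] := @to_local_eq0 (a * b - s).
  by rewrite rmorphB rmorphM -e mulrA ay mul1r subrr.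
move: eu => /eqP; rewrite mulrBr subr_eq0 => /eqP eu.
have : pideal P (u * s) by rewrite -eu [a * b]mulrC mulrA; exact: pidealM.
by case/pideal_prime.
Qed.

End LocalRing.

Section Spectrum.
Variable R : comPzRingType.

Definition spectrum : Type := prime_ideal R.
HB.instance Definition _ := gen_eqMixin spectrum.
HB.instance Definition _ := gen_choiceMixin spectrum.

Let zopen : set_system spectrum := [set S | zariski_open S].

Let zopenT : zopen setT.
Proof.
by exists [set 1]; apply/seteqP; split=> // P _ /(_ 1 erefl); exact: pideal1.
Qed.

Let zopenI : setI_closed zopen.
Proof.
move=> S T [E ->] [F ->].
exists [set r | exists a b, [/\ E a, F b & r = a * b]]; apply/seteqP; split=> P.
  move=> [/existsNP[a /not_implyP[Ea na]] /existsNP[b /not_implyP[Fb nb]]] h.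
  have [|//|//] := @pideal_prime _ P a b; by apply: h; exists a, b.
move=> /existsNP[_ /not_implyP[[a [b [Ea Fb ->]]] nab]]; split=> h; apply: nab.
  by rewrite mulrC; apply: pidealM; exact: h.
by apply: pidealM; exact: h.
Qed.

Let zopenU (I : Type) (f : I -> set spectrum) :
  (forall i, zopen (f i)) -> zopen (\bigcup_i f i).
Proof.
move=> /choice[E fE]; exists (\bigcup_i E i); apply/seteqP; split=> P.
  move=> [i _]; rewrite fE => /existsNP[a /not_implyP[Ea na]] h.
  by apply: na; apply: h; exists i.
move=> /existsNP[a /not_implyP[[i _ Ea] na]]; exists i => //.
by rewrite fE => /(_ a Ea).
Qed.

HB.instance Definition _ := isOpenTopological.Build spectrum zopenT zopenI zopenU.

Lemma spectrum_basic_open (f : R) : open (basic_open f : set spectrum).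
Proof.
exists [set f]; apply/seteqP; split=> P /=; first by move=> nPf /(_ f erefl).
by move=> h Pf; apply: h => _ ->.
Qed.

Definition basic (f : R) : opens spectrum := Opens (spectrum_basic_open f).

Lemma spectrum_base (V : set spectrum) (P : spectrum) : open V -> V P ->
  exists f : R, ~ pideal P f /\ basic f `<=` V.
Proof.
move=> [E ->] /existsNP[f /not_implyP[Ef nf]]; exists f; split=> // Q nQ h.
exact/nQ/h.
Qed.

Let K (P : spectrum) : comPzRingType := local_ring P.

Definition frac_germ (P : spectrum) : set (tfun K) :=
  [set b | exists (V : opens spectrum) a s, oset V P /\
     forall Q, oset V Q -> ~ pideal Q s /\ b Q * to_local Q s = to_local Q a].

Let tot : opens spectrum := Opens openT.

Let germ1 P : frac_germ P 1.
Proof. by exists tot, 1, 1; split=> // Q _; split; [exact: pideal1|rewrite mul1r]. Qed.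

Let germN1 P : frac_germ P (- 1).
Proof.
exists tot, (- 1), 1; split=> // Q _; split; first exact: pideal1.
by rewrite tfunN rmorphN rmorph1 mulr1.
Qed.

Let germD P (b b' : tfun K) : frac_germ P b -> frac_germ P b' -> frac_germ P (b + b').
Proof.
move=> [V [a [s [VP h]]]] [V' [a' [s' [VP' h']]]].
exists (ointer V V'), (a * s' + a' * s), (s * s'); split=> // Q [VQ VQ'].
have [ns e] := h Q VQ; have [ns' e'] := h' Q VQ'; split; first by case/pideal_prime.
by rewrite tfunD rmorphD !rmorphM -e -e'; ring.
Qed.

Let germM P (b b' : tfun K) : frac_germ P b -> frac_germ P b' -> frac_germ P (b * b').
Proof.
move=> [V [a [s [VP h]]]] [V' [a' [s' [VP' h']]]].
exists (ointer V V'), (a * a'), (s * s'); split=> // Q [VQ VQ'].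
have [ns e] := h Q VQ; have [ns' e'] := h' Q VQ'; split; first by case/pideal_prime.
by rewrite tfunM !rmorphM -e -e'; ring.
Qed.

Let germ_loc P (b b' : tfun K) (V : opens spectrum) : oset V P ->
  (forall Q, oset V Q -> b Q = b' Q) -> frac_germ P b -> frac_germ P b'.
Proof.
move=> VP bb' [W [a [s [WP h]]]]; exists (ointer V W), a, s; split=> // Q [VQ WQ].
by rewrite -bb' //; exact: h.
Qed.

Definition spec_data : local_data.
refine (@LocalData spectrum K frac_germ germ1 germN1 germD germM germ_loc _ _ _).
- move=> P b V VP /(_ P VP)[W [a [s [WP h]]]] bP.
  pose b' : tfun K := fun Q => if pselect (invertible (b Q)) is left i
    then sval (cid i) else 0.
  exists (ointer W (basic a)), b'; split.
    split=> //; apply/to_local_invP; have [ns <-] := h P WP.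
    by apply/invertibleM; split=> //; exact: to_local_inv.
  have bb' Q : oset W Q -> ~ pideal Q a -> b Q * b' Q = 1.
    move=> WQ na; rewrite /b'; case: pselect => [i|[]]; first exact: svalP (cid i).
    have [_ e] := h Q WQ; have := to_local_inv na; rewrite -e.
    by case/invertibleM.
  move=> Q [WQ na]; split; last exact: bb'.
  exists (ointer W (basic a)), s, a; split=> // Q' [WQ' na']; split=> //.
  have [_ <-] := h Q' WQ'.
  by rewrite mulrA [b' Q' * _]mulrC bb' // mul1r.
- by move=> P; rewrite -(rmorph0 (to_local P)) => /to_local_invP; apply; exact: pideal0.
- move=> P u v uv; have [a [s [ns e]]] := local_ring_frac u.
  have [a' [s' [ns' e']]] := local_ring_frac v.
  have : invertible (to_local P (a * s' + a' * s)).
    rewrite (_ : to_local P _ = (u + v) * to_local P (s * s')).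
      by apply/invertibleM; split=> //; apply: to_local_inv; case/pideal_prime.
    by rewrite rmorphD !rmorphM -e -e'; ring.
  move=> /to_local_invP nP; have [Pa|na] := pselect (pideal P a); [right|left].
    suff : invertible (v * to_local P s') by case/invertibleM.
    rewrite e'; apply: to_local_inv => Pa'; apply: nP; apply: pidealD.
      by rewrite mulrC; exact: pidealM.
    by rewrite mulrC; exact: pidealM.
  suff : invertible (u * to_local P s) by case/invertibleM.
  by rewrite e; exact: to_local_inv.
Defined.

Definition spec_lrs : lrs := lspace spec_data.

End Spectrum.

Section SpecScheme.
Variable R : comPzRingType.
Let D := spec_data R.
Implicit Types (f g a s : R) (P Q : spectrum R) (U V : opens D).

Let spec_germ a Q : @ld_germ D Q (fun Q => to_local Q a).
Proof.
exists (Opens openT), a, 1; split=> // Q' _; split; first exact: pideal1.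
by rewrite rmorph1 mulr1.
Qed.

Definition spec_fun U a : lsec (D := D) U :=
  @lmk D U (fun Q => to_local Q a) (fun Q _ => spec_germ a Q).

Lemma spec_funE U a Q : oset U Q -> spec_fun U a Q = to_local Q a.
Proof. by move=> UQ; rewrite [LHS]lmkE. Qed.

Lemma spec_fun_additive U : zmod_morphism (spec_fun U).
Proof.
by move=> a b; apply: lsecP => Q UQ; rewrite lsecD lsecN !spec_funE // rmorphB.
Qed.

Lemma spec_fun_multiplicative U : monoid_morphism (spec_fun U).
Proof.
split=> [|a b]; apply: lsecP => Q UQ; first by rewrite spec_funE // lsec1 // rmorph1.
by rewrite lsecM !spec_funE // rmorphM.
Qed.

HB.instance Definition _ U :=
  GRing.isZmodMorphism.Build R _ (spec_fun U) (@spec_fun_additive U).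
HB.instance Definition _ U :=
  GRing.isMonoidMorphism.Build R _ (spec_fun U) (@spec_fun_multiplicative U).

Lemma spec_germ_unit Q U (s : lsec (D := D) U) : oset U Q ->
  @germ_unit (spec_lrs R) Q U s <-> invertible (s Q).
Proof. exact: (@lgerm_unitP D). Qed.

Lemma cover_span (E : set R) f :
  (forall Q : prime_ideal R, ~ pideal Q f -> exists g, E g /\ ~ pideal Q g) ->
  exists n, span setT E (f ^+ n).
Proof.
move=> cov; apply: contrapT => none.
have [||Q IQ nQ] := @prime_avoiding_powers R (span setT E) f.
- split=> [|a b|a b]; [exact: span0|exact: spanD|exact: spanZ].
- by move=> n h; apply: none; exists n.
have [g [Eg ng]] := cov Q nQ; apply/ng/IQ; rewrite -[g]mul1r; exact: span1.
Qed.

Lemma span_finite (E : set R) r : span setT E r ->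
  exists L : seq R, (forall g, g \in L -> E g) /\ span setT [set` L] r.
Proof.
elim=> [|s u t _ Eu _ [L [LE hL]]]; first by exists [::]; split=> //; exact: span0.
exists (u :: L); split=> [g|]; first by rewrite inE => /orP[/eqP ->|/LE].
apply: span_cons => //; first by rewrite /= inE eqxx.
by apply: spanW hL => // v /= vL; rewrite inE vL orbT.
Qed.

Lemma span_prime (L : seq R) (Q : prime_ideal R) r : span setT [set` L] r ->
  ~ pideal Q r -> exists g, g \in L /\ ~ pideal Q g.
Proof.
elim=> [|s u t _ uL _ IH] nQ; first by case: nQ; exact: pideal0.
have [Qu|nu] := pselect (pideal Q u); last by exists u.
by apply: IH => Qt; apply: nQ; apply: pidealD => //; exact: pidealM.
Qed.

Lemma basic_eq0 f a : (forall Q : prime_ideal R, ~ pideal Q f -> to_local Q a = 0) ->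
  exists n, f ^+ n * a = 0.
Proof.
move=> a0; apply: contrapT => none.
have [||Q IQ nQ] := @prime_avoiding_powers R [set r | r * a = 0] f.
- split=> [|b c /= b0 c0|b c /= c0]; first by rewrite /= mul0r.
  + by rewrite mulrDl b0 c0 addr0.
  + by rewrite -mulrA c0 mulr0.
- by move=> n h; apply: none; exists n.
by have [s [ns sa]] := to_local_eq0 (a0 Q nQ); exact/ns/IQ.
Qed.

(** Sections over D(f) are fractions c/f^n. Otherwise some prime Q contains all denominators of t
    but not f. Near Q, t is a fraction whose formula t g = g0 a is valid on D(g); the task is to
    extend it to D(f) after multiplying by a power of g, which makes that power a denominator
    outside Q. *)
Lemma basic_section f (t : tfun (@ld_K D)) :
  (forall Q, ~ pideal Q f -> frac_germ Q t) ->
  exists n c, forall Q, ~ pideal Q f -> t Q * to_local Q f ^+ n = to_local Q c.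
Proof.
move=> tf.
pose I : set R := [set r | exists c, forall Q, ~ pideal Q f ->
  t Q * to_local Q r = to_local Q c].
suff [n [c h]] : exists n, I (f ^+ n).
  by exists n, c => Q nQ; rewrite -rmorphXn h.
apply: contrapT => none; have [||Q IQ nQ] := @prime_avoiding_powers R I f.
- split=> [|r r' [c h] [c' h']|r r' [c h]].
  + by exists 0 => Q _; rewrite !rmorph0 mulr0.
  + by exists (c + c') => Q nQ; rewrite !rmorphD mulrDr h // h'.
  + by exists (r * c) => Q nQ; rewrite !rmorphM -h // mulrCA.
- by move=> n h; apply: none; exists n.
have [V [a [s [VQ h]]]] := tf Q nQ.
have [g0 [g0Q gV]] := spectrum_base (oopen V) VQ.
pose g := g0 * s.
have hg Q' : ~ pideal Q' g -> t Q' * to_local Q' g = to_local Q' (g0 * a).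
  move=> ng; have VQ' : oset V Q'.
    by apply: gV => /= g0Q'; apply: ng; rewrite /g mulrC; exact: pidealM.
  by have [_ e] := h Q' VQ'; rewrite !rmorphM mulrCA e.
have gE : g = g0 * s by [].
(* [E] collects the g' for which one power of g validates the formula on D(g') inside D(f). These
   cover D(f); finitely many suffice, and the powers can then be made uniform. *)
clearbody g; pose E : set R := [set g' | exists n, forall Q', ~ pideal Q' g' -> ~ pideal Q' f ->
  to_local Q' g ^+ n * (t Q' * to_local Q' g - to_local Q' (g0 * a)) = 0].
have [n /span_finite[L [LE Lf]]] : exists n, span setT E (f ^+ n).
  apply: cover_span => Q' nQ'; have [V' [a' [s' [VQ' h']]]] := tf Q' nQ'.
  have [g' [g'Q' gV']] := spectrum_base (oopen V') VQ'.
  exists g'; split=> //.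
  have [Q2|n en] := @basic_eq0 (g * g') (a' * g - g0 * a * s').
    move=> ngg; have ng : ~ pideal Q2 g by move=> g2; apply: ngg; rewrite mulrC; exact: pidealM.
    have ng' : ~ pideal Q2 g' by move=> g2; apply: ngg; exact: pidealM.
    have [_ e] := h' Q2 (gV' Q2 ng').
    have := hg Q2 ng; rewrite rmorphM => e2.
    by rewrite rmorphB !rmorphM -e -e2 mulrAC subrr.
  exists n => Q2 ng' _; have [ns' e] := h' Q2 (gV' Q2 ng').
  apply: (invertible_cancel (to_local_inv ns')); rewrite mul0r.
  apply: (invertible_cancel (invertibleX n (to_local_inv ng'))); rewrite mul0r.
  have := congr1 (to_local Q2) en; rewrite rmorph0 rmorphM rmorphXn rmorphM exprMn => <-.
  by rewrite rmorphB !rmorphM -e; ring.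
have [N hN] : exists N, forall g' Q', g' \in L -> ~ pideal Q' g' -> ~ pideal Q' f ->
    to_local Q' g ^+ N * (t Q' * to_local Q' g - to_local Q' (g0 * a)) = 0.
  elim: L LE {Lf} => [_|g' L IHL LE]; first by exists 0%N.
  have [|N hN] := IHL; first by move=> k kL; apply: LE; rewrite inE kL orbT.
  have [m hm] := LE g' (mem_head _ _); exists (N + m)%N => k Q' kL nk nf.
  move: kL; rewrite inE exprD => /orP[/eqP kg|kL]; last first.
    by rewrite mulrAC (hN k Q' kL nk nf) mul0r.
  by rewrite -mulrA hm ?mulr0 // -kg.
(* g^(N+1) t = g^N g0 a holds on all of D(f), so g^(N+1) is a denominator of t. *)
have : pideal Q (g ^+ N.+1).
  apply: IQ; exists (g ^+ N * (g0 * a)) => Q' nQ'.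
  have [|g' [g'L ng']] := span_prime Lf (Q := Q'); first by move=> /pidealX.
  have /eqP := hN g' Q' g'L ng' nQ'; rewrite mulrBr subr_eq0 => /eqP e.
  by rewrite rmorphM !rmorphXn -e exprS; ring.
move=> /pidealX; rewrite gE => /pideal_prime[//|]; have [ns _] := h Q VQ; exact: ns.
Qed.

Let tot : opens (spec_lrs R) := Opens openT.

Lemma spec_affine_open : affine_open tot.
Proof.
exists R, (fun P : prime_ideal R => P : spec_lrs R), (spec_fun tot : {rmorphism R -> lsec tot}).
split=> //.
- by apply/seteqP; split=> // P _; exists P.
move=> f W h Wf.
have WE Q : oset W Q <-> ~ pideal Q f.
  by rewrite Wf; split=> [[P nP <-] //|nQ]; exists Q.
have resE a Q : oset W Q -> (res h (spec_fun tot a) : lsec W) Q = to_local Q a.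
  by move=> WQ; rewrite [LHS]lresE // spec_funE.
split.
- apply: invertible_germ_unit => Q WQ; apply/spec_germ_unit => //.
  by rewrite spec_funE //; apply/to_local_invP/WE.
- move=> b; have [|n [c bc]] := @basic_section f b.
    by move=> Q /WE WQ; exact: (lval_germ b WQ).
  exists c, n; apply: lsecP => Q WQ; rewrite lsecM lsecX // !resE //.
  exact/bc/WE.
- move=> a a0; apply: basic_eq0 => Q /WE WQ.
  by rewrite -resE // a0 lsec0.
Qed.

Definition Spec : scheme.
refine (@Scheme (spec_lrs R) _) => x.
by exists tot => //; exact: spec_affine_open.
Defined.

End SpecScheme.

Lemma germ_unit_msharp (Z X : lrs) (f : morphism Z X) (z : Z) (V : opens X) (s : sec V) :
  germ_unit z (msharp f V s) <-> germ_unit (f z) s.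
Proof.
split; first exact: mlocal.
move=> [W [h [Wz inv]]].
have h' : opreim (mcts f) W `<=` opreim (mcts f) V by move=> y /h.
exists (opreim (mcts f) W), h'; split=> //.
by rewrite -(msharp_res h h'); exact: invertible_morph.
Qed.

Definition total (Z : ringed_space) : opens Z := Opens openT.

Section AffineTarget.
Variables (X : lrs) (U : opens X).
Hypothesis aU : affine U.

Lemma nonvanM_subl (Y : ringed_space) (V : opens Y) (g g' : sec V) :
  nonvan (g * g') `<=` nonvan g.
Proof. by move=> x /germ_unitM[]. Qed.

Lemma nonvanM_subr (Y : ringed_space) (V : opens Y) (g g' : sec V) :
  nonvan (g * g') `<=` nonvan g'.
Proof. by move=> x /germ_unitM[]. Qed.

Lemma affine_fraction (V : opens X) (t : sec V) x : oset U x -> oset V x ->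
  exists (g a : sec U) (h : nonvan g `<=` V), germ_unit x g /\
    res h t * res (@nonvan_sub _ _ g) g = res (@nonvan_sub _ _ g) a.
Proof.
move=> Ux Vx; have [base _ _ loc] := aU.
have [g [gx gV]] := base x V Ux (oopen V) Vx.
have [//|_ l2 _] := loc g (nonvan g) (@nonvan_sub _ _ g).
have [a [n e]] := l2 (res gV t).
(* The power n + 1 is needed because the locus of g^n is all of U when n = 0; the numerator is
   multiplied by g accordingly. *)
have hg : nonvan (g ^+ n.+1) `<=` nonvan g by rewrite exprS; exact: nonvanM_subl.
exists (g ^+ n.+1), (a * g), (subset_trans hg gV); split; first exact: germ_unitX.
have := congr1 (res hg) e; rewrite rmorphM rmorphXn (res_comp _ _ (subset_trans hg gV)).
rewrite !(res_comp _ _ (@nonvan_sub _ _ (g ^+ n.+1))) => {}e.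
rewrite rmorphM rmorphXn.
exact: etrans (congr1 ( *%R _) (exprSr _ _)) (etrans (mulrA _ _ _) (congr1 (fun u => u * _) e)).
Qed.

(** Points of U are told apart by which sections of U are units there, and every section near such a
    point is a fraction a/g with a and g over U. Both are determined by the pullbacks of sections
    over U. *)
Lemma affine_map_unique (Z : lrs) (h1 h2 : morphism Z X) :
  (forall z, oset U (h1 z)) -> (forall z, oset U (h2 z)) ->
  (forall (s : sec U) (k1 : total Z `<=` opreim (mcts h1) U)
     (k2 : total Z `<=` opreim (mcts h2) U),
     res k1 (msharp h1 U s) = res k2 (msharp h2 U s)) ->
  h1 = h2.
Proof.
move=> h1U h2U eqU.
have k1 : total Z `<=` opreim (mcts h1) U by move=> z _; exact: h1U.
have k2 : total Z `<=` opreim (mcts h2) U by move=> z _; exact: h2U.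
have {}eqU s := eqU s k1 k2.
have h12 : h1 =1 h2.
  have [_ _ inj _] := aU; move=> z; apply: inj => // s.
  rewrite -!germ_unit_msharp -(germ_unit_res k1) // eqU.
  by rewrite germ_unit_res.
apply: morphism_ext => // V t W w1 w2; apply: sec_local_eq => z Wz.
have [g [a [gV [gx e]]]] := affine_fraction t (h1U z) (w1 z Wz : oset V (h1 z)).
have n1 : oset (opreim (mcts h1) (nonvan g)) z by [].
have n2 : oset (opreim (mcts h2) (nonvan g)) z by rewrite /= -h12.
pose N := ointer W (ointer (opreim (mcts h1) (nonvan g)) (opreim (mcts h2) (nonvan g))).
have NW : N `<=` W by move=> y [].
have N1 : N `<=` opreim (mcts h1) (nonvan g) by move=> y [_ []].
have N2 : N `<=` opreim (mcts h2) (nonvan g) by move=> y [_ []].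
have NT : N `<=` total Z by [].
exists N, NW; split; first by split.
have key (f : morphism Z X) (w : W `<=` opreim (mcts f) V)
    (k : total Z `<=` opreim (mcts f) U) (Nf : N `<=` opreim (mcts f) (nonvan g)) :
    res NW (res w (msharp f V t)) * res NT (res k (msharp f U g)) =
    res NT (res k (msharp f U a)).
  have fU : opreim (mcts f) (nonvan g) `<=` opreim (mcts f) U.
    by move=> y /germ_unit_dom.
  have fV : opreim (mcts f) (nonvan g) `<=` opreim (mcts f) V by move=> y /gV.
  have NV : N `<=` opreim (mcts f) V by move=> y /Nf/fV.
  have NU : N `<=` opreim (mcts f) U by move=> y /Nf/fU.
  have := congr1 (fun s => res Nf (msharp f (nonvan g) s)) e.
  rewrite !rmorphM (msharp_res gV fV) !(msharp_res (@nonvan_sub _ _ g) fU).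
  by rewrite !(res_comp _ _ NU) !(res_comp _ _ NV).
have e1 := key h1 w1 k1 N1; have e2 := key h2 w2 k2 N2.
apply: (@invertible_cancel _ (res NT (res k1 (msharp h1 U g)))).
  rewrite res_comp; first by move=> y /N1/germ_unit_dom.
  move=> NU; apply: invertible_germ_unit => y /N1 gy; exact/germ_unit_msharp.
by rewrite e1 [in RHS]eqU e2 eqU.
Qed.

Section Lift.
Variables (Z : lrs) (psi : {rmorphism sec U -> sec (total Z)}).

Let pt_ex (z : Z) : exists x : X, oset U x /\
  forall s : sec U, germ_unit x s <-> germ_unit z (psi s).
Proof.
have [_ prim _ _] := aU.
have [x [Ux Qx]] := prim (contraction psi (point_prime (I : oset (total Z) z))).
exists x; split=> // s; split=> h; first by apply: contrapT => /Qx; exact.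
by apply: contrapT => /Qx /=; exact.
Qed.

Let pt z : X := sval (cid (pt_ex z)).

Let ptU z : oset U (pt z).
Proof. by rewrite /pt; case: cid => x /= []. Qed.

Let ptE z (s : sec U) : germ_unit (pt z) s <-> germ_unit z (psi s).
Proof. by rewrite /pt; case: cid => x /= []. Qed.

Let pt_cts (V : set X) : open V -> open (pt @^-1` V).
Proof.
move=> oV; rewrite (_ : _ @^-1` _ = \bigcup_(s in [set s : sec U | nonvan s `<=` V])
    (nonvan (psi s) : set Z)).
  by apply: bigcup_open => s _; exact: oopen.
apply/seteqP; split=> [z Vz|z [s sV /ptE sz]]; last exact: sV.
have [base _ _ _] := aU; have [s [sx sV]] := base _ V (ptU z) oV Vz.
by exists s => //; exact/ptE.
Qed.

(* tau is the pullback of t on N: locally t = a/g and tau = psi a / psi g. *)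
Let pullback (V : opens X) (t : sec V) (N : opens Z) (tau : sec N) : Prop :=
  forall z, oset N z -> exists (g a : sec U) (h : nonvan g `<=` V) (M : opens Z)
    (k : M `<=` N) (kT : M `<=` total Z),
    [/\ oset M z, germ_unit z (psi g),
        res h t * res (@nonvan_sub _ _ g) g = res (@nonvan_sub _ _ g) a
      & res k tau * res kT (psi g) = res kT (psi a)].

Let fraction_eq (V : opens X) (t : sec V) (g a g' a' : sec U)
    (h : nonvan g `<=` V) (h' : nonvan g' `<=` V) :
  res h t * res (@nonvan_sub _ _ g) g = res (@nonvan_sub _ _ g) a ->
  res h' t * res (@nonvan_sub _ _ g') g' = res (@nonvan_sub _ _ g') a' ->
  exists n, (g * g') ^+ n * (a * g' - a' * g) = 0.
Proof.
have [_ _ _ loc] := aU; move=> e e'.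
have [//|_ _ l3] := loc (g * g') (nonvan (g * g')) (@nonvan_sub _ _ _).
apply: l3; have hl := @nonvanM_subl _ _ g g'; have hr := @nonvanM_subr _ _ g g'.
have hV : nonvan (g * g') `<=` V by move=> x /hl/h.
have := congr1 (res hl) e; have := congr1 (res hr) e'.
rewrite !rmorphM !(res_comp _ _ hV) !(res_comp _ _ (@nonvan_sub _ _ (g * g'))).
by rewrite rmorphB !rmorphM => <- <-; ring.
Qed.

Let pullback_unique (V : opens X) (t : sec V) (N : opens Z) (tau tau' : sec N) :
  pullback t tau -> pullback t tau' -> tau = tau'.
Proof.
move=> C C'; apply: sec_local_eq => z Nz.
have [g [a [h [M [k [kT [Mz gz e f]]]]]]] := C z Nz.
have [g' [a' [h' [M' [k' [kT' [Mz' gz' e' f']]]]]]] := C' z Nz.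
have [n E] := fraction_eq e e'.
pose P := ointer (ointer M M') (nonvan (psi (g * g'))).
have PM : P `<=` M by move=> y [[]].
have PM' : P `<=` M' by move=> y [[]].
have PN : P `<=` N by move=> y /PM/k.
have PT : P `<=` total Z by [].
have unit_P : invertible (res PT (psi (g * g'))).
  by apply: invertible_germ_unit => y [_].
exists P, PN; split; first by split; [split|rewrite /= rmorphM; exact/germ_unitM].
have := congr1 (fun s => res PT (psi s)) E; rewrite !rmorphM !rmorphB !rmorph0 !rmorphXn.
rewrite -[X in _ = X](mulr0 (res PT (psi (g * g')) ^+ n)) => E'.
move: E'; rewrite ![_ ^+ n * _]mulrC => /(invertible_cancel (invertibleX n unit_P))/eqP.
rewrite subr_eq0 !rmorphM => /eqP {}E'.
have := congr1 (res PM) f; have := congr1 (res PM') f'.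
rewrite !rmorphM !(res_comp _ _ PN) !(res_comp _ _ PT) => F' F.
apply: (invertible_cancel unit_P); rewrite !rmorphM.
by rewrite mulrA F E' -F' -!mulrA [X in _ * X]mulrC.
Qed.

Let pullback_res (V : opens X) (t : sec V) (N N' : opens Z) (h : N' `<=` N) (tau : sec N) :
  pullback t tau -> pullback t (res h tau).
Proof.
move=> C z N'z; have [g [a [hg [M [k [kT [Mz gz e f]]]]]]] := C z (h z N'z).
have l : ointer M N' `<=` M by exact: subIsetl.
have r : ointer M N' `<=` N' by exact: subIsetr.
have T : ointer M N' `<=` total Z by [].
exists g, a, hg, (ointer M N'), r, T; split=> //.
have := congr1 (res l) f.
by rewrite rmorphM !(res_comp _ _ T) !(res_comp _ _ (subset_trans r h)).
Qed.

Let pullback_ex (V : opens X) (t : sec V) :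
  exists tau : sec (opreim pt_cts V), pullback t tau.
Proof.
set N := opreim pt_cts V.
pose I := {M : opens Z & {kM : M `<=` N & {tau : sec M | pullback t tau}}}.
pose M (i : I) := projT1 i; pose k (i : I) : M i `<=` N := projT1 (projT2 i).
pose tau (i : I) : sec (M i) := sval (projT2 (projT2 i)).
have Ctau i : pullback t (tau i) by exact: (svalP (projT2 (projT2 i))).
have cov : N `<=` \bigcup_i M i.
  move=> z Nz; have [g [a [h [gx e]]]] := affine_fraction t (ptU z) Nz.
  pose Mz := nonvan (psi g); have MT : Mz `<=` total Z by [].
  have [b gb] : invertible (res MT (psi g)) by apply: invertible_germ_unit.
  have kz : Mz `<=` N by move=> y /ptE gy; exact: (h _ gy).
  have C : pullback t (res MT (psi a) * b).
    move=> y gy; exists g, a, h, Mz, (fun _ x => x), MT; split=> //.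
    by rewrite res_id -mulrA [b * _]mulrC gb mulr1.
  exists (existT _ Mz (existT _ kz (exist _ _ C))) => //=; exact/ptE.
have [|r [rE _]] := @sheaf Z I M N k cov tau.
  move=> i j; apply: (@pullback_unique V t); exact: pullback_res.
exists r => z Nz; have [i _ Mz] := cov z Nz.
have [g [a [h [M' [k' [kT [M'z gz e f]]]]]]] := Ctau i z Mz.
exists g, a, h, M', (subset_trans k' (k i)), kT; split=> //.
by rewrite -(res_comp (k i) k') rE.
Qed.

Let sharp (V : opens X) (t : sec V) : sec (opreim pt_cts V) := sval (cid (pullback_ex t)).

Let sharpP V (t : sec V) : pullback t (sharp t).
Proof. exact: (svalP (cid (pullback_ex t))). Qed.

(** Subtraction and multiplication at once: [num] gives the numerator over the common denominator g
    g', and commutes with ring morphisms. *)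
Let pullback_op (V : opens X) (t t' : sec V) (N : opens Z) (tau tau' : sec N)
    (op : forall A : comPzRingType, A -> A -> A) (num : forall A : comPzRingType, A -> A -> A -> A -> A) :
  (forall (A B : comPzRingType) (f : {rmorphism A -> B}) a b, f (op A a b) = op B (f a) (f b)) ->
  (forall (A B : comPzRingType) (f : {rmorphism A -> B}) a g a' g',
     f (num A a g a' g') = num B (f a) (f g) (f a') (f g')) ->
  (forall (A : comPzRingType) (t g t' g' : A),
     op A t t' * (g * g') = num A (t * g) g (t' * g') g') ->
  pullback t tau -> pullback t' tau' -> pullback (op _ t t') (op _ tau tau').
Proof.
move=> opM numM opE C C' z Nz.
have [g [a [h [M [k [kT [Mz gz e f]]]]]]] := C z Nz.
have [g' [a' [h' [M' [k' [kT' [Mz' gz' e' f']]]]]]] := C' z Nz.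
have hl := @nonvanM_subl _ _ g g'; have hr := @nonvanM_subr _ _ g g'.
have hV : nonvan (g * g') `<=` V by move=> x /hl/h.
pose P := ointer M M'.
have PM : P `<=` M by move=> y [].
have PM' : P `<=` M' by move=> y [].
have PN : P `<=` N by move=> y /PM/k.
have PT : P `<=` total Z by [].
exists (g * g'), (num _ a g a' g'), hV, P, PN, PT; split=> //.
- by rewrite rmorphM; exact/germ_unitM.
- have := congr1 (res hl) e; have := congr1 (res hr) e'.
  rewrite !rmorphM !(res_comp _ _ hV) !(res_comp _ _ (@nonvan_sub _ _ (g * g'))).
  by move=> E' E; rewrite opM opE numM E E'.
- have := congr1 (res PM) f; have := congr1 (res PM') f'.
  rewrite !rmorphM !(res_comp _ _ PN) !(res_comp _ _ PT).
  by move=> E' E; rewrite opM opE !numM E E'.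
Qed.

Let sharp_additive V : zmod_morphism (@sharp V).
Proof.
move=> t t'; apply: pullback_unique (sharpP _) _.
apply: (@pullback_op V t t' _ _ _ (fun A a b => a - b) (fun A a g a' g' => a * g' - a' * g)).
- by move=> A B f a b; rewrite rmorphB.
- by move=> A B f a g a' g'; rewrite rmorphB !rmorphM.
- by move=> A u g u' g'; ring.
- exact: sharpP.
- exact: sharpP.
Qed.

Let sharp_multiplicative V : monoid_morphism (@sharp V).
Proof.
split=> [|t t']; apply: pullback_unique (sharpP _) _.
  move=> z Nz; have [g [a [h [gx e]]]] := affine_fraction (1 : sec V) (ptU z) Nz.
  pose M := ointer (opreim pt_cts V) (nonvan (psi g)).
  have k : M `<=` opreim pt_cts V by exact: subIsetl.
  have kT : M `<=` total Z by [].
  exists g, g, h, M, k, kT; split; rewrite ?rmorph1 ?mul1r //; last exact/ptE.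
  by split=> //; exact/ptE.
apply: (@pullback_op V t t' _ _ _ (fun A a b => a * b) (fun A a g a' g' => a * a')).
- by move=> A B f a b; rewrite rmorphM.
- by move=> A B f a g a' g'; rewrite rmorphM.
- by move=> A u g u' g'; rewrite mulrACA.
- exact: sharpP.
- exact: sharpP.
Qed.

HB.instance Definition _ V :=
  GRing.isZmodMorphism.Build _ _ (@sharp V) (@sharp_additive V).
HB.instance Definition _ V :=
  GRing.isMonoidMorphism.Build _ _ (@sharp V) (@sharp_multiplicative V).

(** One direction of the adjunction between global sections and spectra, for an affine open U of X
    in place of a spectrum: a point goes to the contraction of its prime, a fraction a/g to psi a /
    psi g. *)
Definition affine_lift : morphism Z X.
refine (@Morphism Z X pt pt_cts (fun V => (@sharp V : {rmorphism _ -> _})) _ _).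
- move=> V W h h' t; apply: pullback_unique (sharpP _) _ => z Wz.
  have [g [a [hg [M [k [kT [Mz gz e f]]]]]]] := sharpP t (h (pt z) Wz).
  have [base _ _ _] := aU; have [g1 [g1x g1W]] := base _ W (ptU z) (oopen W) Wz.
  have hl := @nonvanM_subl _ _ g g1; have hr := @nonvanM_subr _ _ g g1.
  have hW : nonvan (g * g1) `<=` W by move=> x /hr/g1W.
  have hV : nonvan (g * g1) `<=` V := subset_trans hW h.
  pose P := ointer M (opreim pt_cts W).
  have PM : P `<=` M by exact: subIsetl.
  have PW : P `<=` opreim pt_cts W by exact: subIsetr.
  have PV : P `<=` opreim pt_cts V by move=> y /PM/k.
  have PT : P `<=` total Z by [].
  exists (g * g1), (a * g1), hW, P, PW, PT; split=> //.
  + by rewrite rmorphM; apply/germ_unitM; split=> //; exact/ptE.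
  + have := congr1 (res hl) e.
    rewrite !rmorphM !(res_comp _ _ hV) !(res_comp _ _ (@nonvan_sub _ _ (g * g1))).
    by move=> <-; rewrite mulrA.
  + have := congr1 (res PM) f; rewrite !rmorphM !(res_comp _ _ PV) !(res_comp _ _ PT).
    by move=> <-; rewrite mulrA.
- move=> z V t hz; have Nz := germ_unit_dom hz.
  have [g [a [hg [M [k [kT [Mz gz e f]]]]]]] := sharpP t Nz.
  have gx : oset (nonvan g) (pt z) by exact/ptE.
  have : germ_unit z (psi a).
    rewrite -(germ_unit_res kT) // -f; apply/germ_unitM.
    by split; apply/germ_unit_res.
  move=> /ptE; rewrite -(germ_unit_res (@nonvan_sub _ _ g)) // -e => /germ_unitM[].
  by move=> /germ_unit_res h _; exact: h.
Defined.

Lemma affine_lift_in z : oset U (affine_lift z).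
Proof. exact: ptU. Qed.

Lemma affine_lift_sharp (s : sec U) (k : total Z `<=` opreim (mcts affine_lift) U) :
  res k (msharp affine_lift U s) = psi s.
Proof.
apply: (@pullback_unique U s); first exact/pullback_res/sharpP.
move=> z _.
have h1 : nonvan (1 : sec U) `<=` U by exact: nonvan_sub.
have kT : total Z `<=` total Z by [].
exists 1, s, h1, (total Z), kT, kT; split=> //.
- by rewrite rmorph1; exact: germ_unit1.
- by rewrite rmorph1 mulr1; exact: res_irr.
- by rewrite !rmorph1 mulr1.
Qed.

End Lift.
End AffineTarget.

(** * Base change along the affine line *)

(** Polynomials are formed over rings typed as nonzero, whereas rings of sections may be zero. The
    chart rings below are therefore handled through isomorphisms with nonzero copies. *)
Lemma nonzero_ring (A : comPzRingType) : (1 : A) <> 0 ->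
  {A' : comNzRingType & {f : {rmorphism A -> A'} & {g : {rmorphism A' -> A} |
    cancel f g /\ cancel g f}}}.
Proof.
case: A => T c A1; pose A : comPzRingType := GRing.ComPzRing.Pack c.
pose m := GRing.PzSemiRing_isNonZero.Build A (introN eqP A1).
pose A' : comNzRingType := HB.pack T c m.
by exists A', (idfun : {rmorphism A -> A}), (idfun : {rmorphism A -> A}).
Qed.

Lemma zero_ring_morphism (A B : comPzRingType) : (1 : B) = 0 ->
  exists f : {rmorphism A -> B}, forall a, f a = 0.
Proof.
move=> B10; have triv (x y : B) : x = y by rewrite -[x]mulr1 -[y]mulr1 B10 !mulr0.
pose f (a : A) : B := 0.
have fa : zmod_morphism f by move=> a b; exact: triv.
have fm : monoid_morphism f by split=> [|a b]; rewrite /f ?mul0r //; exact: (esym B10).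
pose m1 := GRing.isZmodMorphism.Build A B f fa.
pose m2 := GRing.isMonoidMorphism.Build A B f fm.
by exists (HB.pack f m1 m2 : {rmorphism A -> B}).
Qed.

(** The target, a ring of global sections, may be zero; that case is settled apart, and the other
    reduces to evaluation of polynomials in a nonzero copy. *)
Lemma poly_lift (A : comNzRingType) (S : comPzRingType) (f : {rmorphism A -> S}) (y : S) :
  exists F : {rmorphism {poly A} -> S}, (forall a, F a%:P = f a) /\ F 'X = y.
Proof.
have [S10|/eqP S1] := eqVneq (1 : S) 0.
  have triv (x z : S) : x = z by rewrite -[x]mulr1 -[z]mulr1 S10 !mulr0.
  have [F _] := @zero_ring_morphism {poly A} S S10.
  by exists F; split=> *; exact: triv.
have [S' [i [k [ik ki]]]] := nonzero_ring S1.
have cy : commr_rmorph (i \o f) (i y) by move=> a; exact: mulrC.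
exists (k \o horner_morph cy : {rmorphism _ -> _}); split=> [a|] /=.
  by rewrite horner_morphC /= ik.
by rewrite horner_morphX ik.
Qed.

Lemma poly_morph_ext (A : comNzRingType) (S : comPzRingType)
    (F G : {rmorphism {poly A} -> S}) :
  (forall a, F a%:P = G a%:P) -> F 'X = G 'X -> F =1 G.
Proof.
move=> FG FGX p; elim/poly_ind: p => [|p c IHp]; first by rewrite !rmorph0.
by rewrite !rmorphD !rmorphM IHp FG FGX.
Qed.

Section GlobalSections.
Variables (Z X : lrs) (h : morphism Z X) (U : opens X).
Hypothesis hU : forall z, oset U (h z).

Let gsub : total Z `<=` opreim (mcts h) U. Proof. by move=> z _; exact: hU. Qed.

Definition gsec : {rmorphism sec U -> sec (total Z)} := res gsub \o msharp h U.

Lemma gsecE (s : sec U) (k : total Z `<=` opreim (mcts h) U) :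
  gsec s = res k (msharp h U s).
Proof. exact: res_irr. Qed.

Lemma germ_unit_gsec z (s : sec U) : germ_unit z (gsec s) <-> germ_unit (h z) s.
Proof. by rewrite -germ_unit_msharp; exact: germ_unit_res. Qed.

End GlobalSections.

Lemma gsec_comp_in (Z Y X : lrs) (h : morphism Z Y) (f : morphism Y X) (U : opens X)
    (hU : forall z, oset U (mcomp f h z)) (hV : forall z, oset (opreim (mcts f) U) (h z))
    (s : sec U) : gsec hU s = gsec hV (msharp f U s).
Proof. exact: res_irr. Qed.

Lemma gsec_comp (Z Y X : lrs) (h : morphism Z Y) (f : morphism Y X) (U : opens X)
    (hU : forall z, oset U (mcomp f h z)) (fU : forall y, oset U (f y))
    (hT : forall z, oset (total Y) (h z)) (s : sec U) :
  gsec hU s = gsec hT (gsec fU s).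
Proof.
rewrite /gsec /=; set k := (X in res X (msharp f U s)).
have k' : opreim (mcts h) (total Y) `<=` opreim (mcts h) (opreim (mcts f) U).
  by move=> z _; exact: fU.
by rewrite (msharp_res k k') res_comp; exact: res_irr.
Qed.

Lemma gsec_eq (Z X : lrs) (h h' : morphism Z X) (U : opens X) (hU : forall z, oset U (h z))
    (hU' : forall z, oset U (h' z)) (s : sec U) : h = h' -> gsec hU s = gsec hU' s.
Proof. by move=> e; subst h'; exact: res_irr. Qed.

Lemma affine_map_ext (X : lrs) (U : opens X) (aU : affine U) (Z : lrs)
    (h1 h2 : morphism Z X) (h1U : forall z, oset U (h1 z)) (h2U : forall z, oset U (h2 z)) :
  (forall s : sec U, gsec h1U s = gsec h2U s) -> h1 = h2.
Proof.
move=> e; apply: (affine_map_unique aU) => // s k1 k2.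
by rewrite -(gsecE h1U) -(gsecE h2U).
Qed.

Section SpecMaps.
Variable R : comPzRingType.

Let tot : opens (Spec R) := total (Spec R).

Definition spec_sec : {rmorphism R -> sec tot} := spec_fun (R := R) tot.

Lemma spec_sec_bij : exists k : {rmorphism sec tot -> R}, cancel spec_sec k /\ cancel k spec_sec.
Proof.
apply: rmorphism_inverse => [a b /eqP|t].
  rewrite -subr_eq0 -rmorphB => /eqP e.
  have [Q _|n] := @basic_eq0 R 1 (a - b).
    have := congr1 (fun t : lsec (D := spec_data R) tot => t Q) e.
    by rewrite [X in X = _]spec_funE // lsec0.
  by rewrite expr1n mul1r => /eqP; rewrite subr_eq0 => /eqP.
have [Q _|n [c tc]] := @basic_section R 1 (t : lsec (D := spec_data R) tot).
  exact: (lval_germ t).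
exists c; apply: lsecP => Q _; rewrite [LHS]spec_funE // -tc; last exact: pideal1.
by rewrite rmorph1 expr1n mulr1.
Qed.

Lemma spec_total_affine : affine (X := Spec R) tot.
Proof. exact/affineP/spec_affine_open. Qed.

Lemma germ_unit_spec_sec (P : Spec R) (r : R) :
  germ_unit P (spec_sec r) <-> ~ pideal (P : prime_ideal R) r.
Proof.
rewrite (@spec_germ_unit R P tot (spec_sec r)) // [X in invertible X]spec_funE //.
exact: to_local_invP.
Qed.

Lemma spec_lift (Z : lrs) (F : {rmorphism R -> sec (total Z)}) :
  exists h : morphism Z (Spec R), forall (hT : forall z, oset tot (h z)) r,
    gsec hT (spec_sec r) = F r.
Proof.
have [k [ck kc]] := spec_sec_bij.
exists (affine_lift spec_total_affine (F \o k : {rmorphism _ -> _})) => hT r.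
by rewrite [LHS]affine_lift_sharp /= ck.
Qed.

Lemma spec_map_ext (Z : lrs) (h1 h2 : morphism Z (Spec R)) (h1T : forall z, oset tot (h1 z))
    (h2T : forall z, oset tot (h2 z)) :
  (forall r, gsec h1T (spec_sec r) = gsec h2T (spec_sec r)) -> h1 = h2.
Proof.
move=> e; apply: (affine_map_ext spec_total_affine (h1U := h1T) (h2U := h2T)) => s.
by have [k [_ kc]] := spec_sec_bij; rewrite -(kc s).
Qed.

End SpecMaps.

Arguments spec_sec {R}.

Section AffineLine.
Variables (Y X : scheme) (f : morphism Y X) (U : opens X).
Let V : opens Y := opreim (mcts f) U.
Hypotheses (aU : affine U) (aV : affine V).
Variables (A B : comNzRingType) (iA : {rmorphism sec U -> A}) (kA : {rmorphism A -> sec U})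
  (iB : {rmorphism sec V -> B}) (kB : {rmorphism B -> sec V}).
Hypotheses (iAK : cancel iA kA) (kAK : cancel kA iA) (iBK : cancel iB kB) (kBK : cancel kB iB).

Let phi : {rmorphism A -> B} := iB \o (msharp f U \o kA).
Let Phi : {rmorphism {poly A} -> {poly B}} := map_poly phi.

Let gpsi : {rmorphism sec U -> sec (total (Spec {poly A}))} :=
  @spec_sec {poly A} \o (@polyC A \o iA).
Let ppsi : {rmorphism sec V -> sec (total (Spec {poly B}))} :=
  @spec_sec {poly B} \o (@polyC B \o iB).

Let g : morphism (Spec {poly A}) X := affine_lift aU gpsi.
Let p : morphism (Spec {poly B}) Y := affine_lift aV ppsi.

Let gU z : oset U (g z). Proof. exact: affine_lift_in. Qed.
Let pV z : oset V (p z). Proof. exact: affine_lift_in. Qed.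
Let gE s : gsec gU s = spec_sec (iA s)%:P. Proof. exact: affine_lift_sharp. Qed.
Let pE s : gsec pV s = spec_sec (iB s)%:P. Proof. exact: affine_lift_sharp. Qed.

Let q_ex : exists q : morphism (Spec {poly B}) (Spec {poly A}),
  forall (qT : forall z, oset (total _) (q z)) r, gsec qT (spec_sec r) = spec_sec (Phi r).
Proof. exact: (@spec_lift {poly A} _ (@spec_sec {poly B} \o Phi : {rmorphism _ -> _})). Qed.

(** The base change of f along the affine line over U, followed by the inclusion of U. A map from Z
    to Spec B[X] is a ring morphism from B[X]: the component to Y prescribes it on B, the component
    to Spec A[X] prescribes the image of the variable, and equality over X makes these compatible on
    A[X]. *)
Lemma affine_line_pullback : exists (g : morphism (Spec {poly A}) X)
    (p : morphism (Spec {poly B}) Y) (q : morphism (Spec {poly B}) (Spec {poly A})),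
  is_pullback p q f g /\ forall (P : Spec {poly B}) r,
    pideal (q P : prime_ideal {poly A}) r <-> pideal (P : prime_ideal {poly B}) (Phi r).
Proof.
have [q qE] := q_ex.
have qT z : oset (total (Spec {poly A})) (q z) by [].
exists g, p, q; split; last first.
  move=> P r; have h := germ_unit_gsec qT P (spec_sec r).
  rewrite qE !germ_unit_spec_sec in h.
  by split=> h'; apply: contrapT => n; [exact: (h.1 n h')|exact: (h.2 n h')].
have fpgq : mcomp f p = mcomp g q.
  have fpU z : oset U (mcomp f p z) by exact: pV.
  have gqU z : oset U (mcomp g q z) by exact: gU.
  apply: (affine_map_ext aU (h1U := fpU) (h2U := gqU)) => s.
  rewrite (gsec_comp_in _ pV) (gsec_comp _ gU qT) pE gE qE; congr (spec_sec _).
  by rewrite /Phi /= map_polyC /= iAK.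
split=> // Z a b fagb.
have bT z : oset (total (Spec {poly A})) (b z) by [].
(* f a = g b has its image in U, so a lands in the preimage V and is governed by the ring B. *)
have aV' z : oset V (a z).
  have := congr1 (fun h : morphism Z X => mfun h z) fagb.
  by rewrite /= /V /= => ->; exact: gU.
have [F [FC FX]] := poly_lift (gsec aV' \o kB : {rmorphism _ -> _}) (gsec bT (spec_sec 'X)).
have FPhi r : F (Phi r) = gsec bT (spec_sec r).
  apply: (@poly_morph_ext A _ (F \o Phi : {rmorphism _ -> _})
    (gsec bT \o @spec_sec {poly A} : {rmorphism _ -> _})) => [s|].
    transitivity (gsec aV' (msharp f U (kA s))); first by rewrite /Phi /= map_polyC FC /= iBK.
    transitivity (gsec bT (spec_sec s%:P)); last by [].
    have faU z : oset U (mcomp f a z) by exact: aV'.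
    have gbU z : oset U (mcomp g b z) by exact: gU.
    rewrite -(gsec_comp_in faU) (gsec_eq _ gbU _ fagb) (gsec_comp _ gU bT) gE.
    by rewrite kAK.
  by rewrite /Phi /= map_polyX.
have [u uE] := @spec_lift {poly B} Z F.
have uT z : oset (total (Spec {poly B})) (u z) by [].
exists u; split; first split.
- have puV z : oset V (mcomp p u z) by exact: pV.
  apply: (affine_map_ext aV (h1U := puV) (h2U := aV')) => s.
  by rewrite (gsec_comp _ pV uT) pE uE FC /= iBK.
- have quT z : oset (total (Spec {poly A})) (mcomp q u z) by [].
  apply: (spec_map_ext (h1T := quT) (h2T := bT)) => r.
  by rewrite (gsec_comp _ qT uT) qE uE FPhi.
move=> u' [pu' qu'].
have u'T z : oset (total (Spec {poly B})) (u' z) by [].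
apply: (spec_map_ext (h1T := uT) (h2T := u'T)) => r; rewrite uE.
apply: (@poly_morph_ext B _ F (gsec u'T \o @spec_sec {poly B} : {rmorphism _ -> _})) => [s|].
  have puV z : oset V (mcomp p u' z) by exact: pV.
  transitivity (gsec aV' (kB s)); first by rewrite FC.
  transitivity (gsec u'T (spec_sec s%:P)); last by [].
  by rewrite -(gsec_eq puV _ _ pu') (gsec_comp _ pV u'T) pE kBK.
have quT z : oset (total (Spec {poly A})) (mcomp q u' z) by [].
transitivity (gsec u'T (spec_sec 'X)); last by [].
rewrite FX -(gsec_eq quT _ _ qu') (gsec_comp _ qT u'T) qE.
by congr (gsec u'T (spec_sec _)); exact: map_polyX.
Qed.

End AffineLine.

(** * Consequences of being a universal homeomorphism *)

Section Closedness.
Variables (A B : comNzRingType) (phi : {rmorphism A -> B}).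
Hypothesis closed_map : forall (c : {poly B}) (N : prime_ideal {poly A}),
  (~ exists P : prime_ideal {poly B}, pideal P c /\
     forall r, pideal N r <-> pideal P (map_poly phi r)) ->
  exists r, ~ pideal N r /\
    forall P : prime_ideal {poly B}, pideal P c -> pideal P (map_poly phi r).

(** The sum is formally c^n times the value at 1/c, which kills c X - 1. Written with reversed
    powers it needs no inverse of c, and it telescopes. *)
Lemma reverse_evaluation (c : B) (G : {poly B}) n : (size G <= n)%N ->
  \sum_(i < n.+1) ((c *: 'X - 1) * G)`_i * c ^+ (n - i) = 0.
Proof.
move=> sG; pose u i := if i is j.+1 then G`_j * c ^+ (n - j) else 0.
rewrite (eq_bigr (fun i : 'I_n.+1 => - (u i.+1 - u i))); last first.
  move=> [i /= ni] _; rewrite mulrBl mul1r coefB -scalerAl coefZ coefXM opprB mulrBl /u.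
  case: i ni => [|i] ni /=; first by rewrite mulr0 mul0r.
  by rewrite mulrAC -exprS subnSK // mulrC.
rewrite sumrN -(big_mkord xpredT (fun i => u i.+1 - u i)) telescope_sumr // /u.
by rewrite nth_default // mul0r subr0 oppr0.
Qed.

(* The closed subset c X = 1 of Spec B[X] has closed image in Spec A[X], avoiding the
   fibre over p since c vanishes there. Hence some s outside p becomes, modulo p[X],
   a multiple of c X - 1; comparing coefficients in reverse order gives the equation. *)
Lemma integral_equation (c : B) (p : prime_ideal A) :
  (forall p' : prime_ideal B, (forall a, pideal p' (phi a) <-> pideal p a) -> pideal p' c) ->
  exists s M (h : nat -> A), [/\ ~ pideal p s, forall i, pideal p (h i)
    & phi s * c ^+ M.+1 = \sum_(i < M.+1) phi (h i) * c ^+ i].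
Proof.
move=> cp; pose Phi : {rmorphism {poly A} -> {poly B}} := map_poly phi; pose F : {poly B} := c *: 'X - 1.
pose inp (h : {poly A}) := forall i, pideal p h`_i.
pose J : set {poly A} := [set G | exists H, inp H /\ exists K, Phi (G - H) = F * K].
have Jid : is_ideal J.
  split.
  - exists 0; split=> [i|]; first by rewrite coef0; exact: pideal0.
    by exists 0; rewrite subr0 mulr0 rmorph0.
  - move=> G G' [H [Hp [K e]]] [H' [Hp' [K' e']]]; exists (H + H'); split=> [i|].
      by rewrite coefD; exact: pidealD.
    by exists (K + K'); rewrite opprD addrACA rmorphD e e' mulrDr.
  - move=> G G' [H [Hp [K e]]]; exists (G * H); split=> [i|].
      by rewrite coefM; apply: ideal_sum; [exact: prime_ideal_is_ideal|move=> *; exact: pidealM].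
    by exists (Phi G * K); rewrite -mulrBr rmorphM e mulrCA.
have [[s [ns [H [Hp [K e]]]]]|none] :=
    pselect (exists s, ~ pideal p s /\ J s%:P).
  pose n := (size K).+1.
  have := @reverse_evaluation c K n (leqnSn _); rewrite -/F -e.
  rewrite big_ord_recl subn0 coef_map coefB coefC eqxx.
  under eq_bigr => i _ do rewrite coef_map coefB coefC /= sub0r rmorphN mulNr.
  rewrite sumrN => /eqP; rewrite subr_eq0 => /eqP E.
  exists (s - H`_0), (size K), (fun i => H`_(n - i)); split=> //.
    by move=> h; apply: ns; rewrite -(subrK H`_0 s); exact: pidealD.
  rewrite E (reindex_inj rev_ord_inj) /=.
  apply: eq_bigr => i _; rewrite /bump /= add1n subSS /n.
  have iK : (i <= size K)%N by rewrite -ltnS ltn_ord.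
  by rewrite subSS subKn // subSn.
(* In the remaining case a prime N of A[X] contains [J] and lies over p. It is not the image of a
   prime containing F, since c would vanish there. Closedness then gives r outside N that vanishes
   on the image; but a power of [Phi r] is a multiple of F, so r is in N. *)
have [|||N JN NS] := @prime_avoiding {poly A} J [set G | exists2 s, ~ pideal p s & G = s%:P] Jid.
- by exists 1 => //; exact: pideal1.
- by move=> _ _ [s ns ->] [t nt ->]; exists (s * t); [case/pideal_prime|rewrite polyCM].
- by move=> G JG [s ns e]; apply: none; exists s; split=> //; rewrite -e.
have Np a : pideal N a%:P <-> pideal p a.
  split=> [Na|pa]; first by apply: contrapT => na; apply: (NS _ Na); exists a.
  apply: JN; exists a%:P; split=> [i|]; last by exists 0; rewrite subrr rmorph0 mulr0.
  by rewrite coefC; case: eqP => // _; exact: pideal0.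
have [|r [nr rP]] := closed_map (c := F) (N := N).
  move=> [P [PF PN]]; pose p' := contraction (@polyC B) P.
  have p'c : pideal p' c.
    by apply: cp => a; rewrite /= -map_polyC -PN; exact: Np.
  apply: (@pideal1 _ P); have -> : (1 : {poly B}) = c *: 'X - F by rewrite opprB addrC subrK.
  by apply: pidealD; [rewrite -mul_polyC mulrC; exact: pidealM|exact: pidealN].
exfalso; apply: nr.
have [m [K e]] : exists m, exists K, Phi r ^+ m = F * K.
  apply: contrapT => no.
  have [||Q QF nQ] := @prime_avoiding_powers {poly B} [set G | exists K, G = F * K] (Phi r).
  - split=> [|_ _ [K ->] [K' ->]|a _ [K ->]].
    + by exists 0; rewrite mulr0.
    + by exists (K + K'); rewrite mulrDr.
    + by exists (a * K); rewrite mulrCA.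
  - by move=> m [K e]; apply: no; exists m, K.
  by apply/nQ/rP/QF; exists 1; rewrite mulr1.
apply: (@pidealX _ _ _ m); apply: JN; exists 0; split=> [i|].
  by rewrite coef0; exact: pideal0.
by exists K; rewrite subr0 rmorphXn.
Qed.

End Closedness.

Section PurelyInseparable.
Variables (K L : fieldType) (j : {rmorphism K -> L}).
Hypothesis inj_map : forall M1 M2 : prime_ideal {poly L},
  (forall g : {poly K}, pideal M1 (map_poly j g) <-> pideal M2 (map_poly j g)) -> M1 = M2.

Let ev_prime (y : L) : prime_ideal {poly L}.
Proof.
refine (@PrimeIdeal _ [set g : {poly L} | g.[y] = 0] _ _ _ _ _) => /=.
- exact: horner0.
- by move=> g h gy hy; rewrite hornerD gy hy addr0.
- by move=> g h hy; rewrite hornerM hy mulr0.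
- by rewrite hornerC => /eqP; rewrite oner_eq0.
- by move=> g h /eqP; rewrite hornerM mulf_eq0 => /orP[]/eqP; [left|right].
Defined.

Let zero_prime_poly : prime_ideal {poly L}.
Proof.
refine (@PrimeIdeal _ [set (0 : {poly L})] _ _ _ _ _) => //=.
- by move=> g h -> ->; rewrite addr0.
- by move=> g h ->; rewrite mulr0.
- by move=> /eqP; rewrite oner_eq0.
- by move=> g h /eqP; rewrite mulf_eq0 => /orP[]/eqP ->; [left|right].
Defined.

(* Injectivity on Spec L[X] rules out y transcendental and forces y to be the only root
   of its minimal polynomial. *)
Lemma minimal_linear_power (y : L) : exists (m : {poly K}) n,
  m \is monic /\ map_poly j m = ('X - y%:P) ^+ n.+1.
Proof.
have [g0 [g0n g0y]] : exists g : {poly K}, g != 0 /\ (map_poly j g).[y] = 0.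
  apply: contrapT => none.
  have e : ev_prime y = zero_prime_poly.
    apply: inj_map => g /=; split=> [gy|->]; last exact: horner0.
    apply/eqP; rewrite map_poly_eq0; apply/eqP; apply: contrapT => /eqP gn.
    by apply: none; exists g.
  have : pideal (ev_prime y) ('X - y%:P) by rewrite /= hornerXsubC subrr.
  by rewrite e /= => /eqP; rewrite polyXsubC_eq0.
pose pr n := `[< exists g : {poly K}, [/\ g != 0, (map_poly j g).[y] = 0 & size g = n] >].
have ex : exists n, pr n by exists (size g0); apply/asboolP; exists g0.
case: (ex_minnP ex) => n /asboolP[m0 [m0n m0y sm0]] min.
pose m := (lead_coef m0)^-1 *: m0.
have lm0 : lead_coef m0 != 0 by rewrite lead_coef_eq0.
have mm : m \is monic by rewrite monicE lead_coefZ mulVf.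
have sm : size m = n by rewrite size_scale ?invr_eq0.
have my : (map_poly j m).[y] = 0 by rewrite map_polyZ hornerZ m0y mulr0.
have {}min g : (map_poly j g).[y] = 0 -> (size g < size m)%N -> g = 0.
  move=> gy sg; apply/eqP; apply: contraTT sg => gn; rewrite -leqNgt sm.
  by apply: min; apply/asboolP; exists g.
have m_neq0 : m != 0 by exact: monic_neq0.
have jm0 : map_poly j m != 0 by rewrite map_poly_eq0.
have dvd_m g : (map_poly j g).[y] = 0 -> m %| g.
  move=> gy; rewrite /dvdp; apply/eqP/min; last by rewrite ltn_modp.
  have := congr1 (fun h => (map_poly j h).[y]) (divp_eq g m).
  by rewrite rmorphD rmorphM hornerD hornerM my mulr0 add0r gy => <-.
have [k [G + mG]] := multiplicity_XsubC (map_poly j m) y.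
rewrite jm0 /= => Gy.
have G0 : G != 0 by apply: contraNneq jm0 => G0; rewrite mG G0 mul0r.
have sG : size G = 1%N.
  apply/eqP; apply: contrapT => /negP sG.
  (* If the cofactor G of (X - y)^k is not constant, a prime M contains it. M and evaluation at y
     contract to the same ideal of K[X]: a g in M with g(y) nonzero would be coprime to m, and
     Bezout would put 1 in M. Injectivity then makes y a root of G. *)
  have [||||M GM _] := @prime_avoiding {poly L} [set h | G %| h] [set 1].
  - split=> [|a b|a b]; [exact: dvdp0|exact: dvdp_add|exact: dvdp_mull].
  - by [].
  - by move=> a b -> ->; rewrite mulr1.
  - by move=> a Ga a1; move: Ga; rewrite /= a1 dvdp1 (negPf sG).
  have e : ev_prime y = M.
    apply: inj_map => g /=; split=> [/dvd_m/dvdpP[h ->]|Mg].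
      rewrite rmorphM; apply: pidealM; apply: GM => /=; rewrite mG.
      exact: dvdp_mulIl.
    apply: contrapT => gy.
    have cop : coprimep m g.
      apply/coprimepP => d dm dg; have d0 : d != 0 by apply: contraTneq dm => ->; rewrite dvd0p.
      have [h hm] := dvdpP _ _ dm; have dy : (map_poly j d).[y] != 0.
        apply/eqP => dy; apply: gy; have [h' ->] := dvdpP _ _ dg.
        by rewrite rmorphM hornerM dy mulr0.
      have /dvd_m mh : (map_poly j h).[y] = 0.
        have := my; rewrite hm rmorphM hornerM => /eqP.
        by rewrite mulf_eq0 (negPf dy) orbF => /eqP.
      have h0 : h != 0 by apply: contraNneq m_neq0 => h0; rewrite hm h0 mul0r.
      have := dvdp_leq h0 mh; rewrite hm size_mul // => le.
      rewrite -size_poly_eq1 eqn_leq size_poly_gt0 d0 andbT.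
      move: le; case: (size d) => // [[//|s]]; rewrite addnS /= addnS.
      by rewrite ltnNge leq_addr.
    have /Bezout_coprimepP[[u v] /= /eqpP[[a b] /= /andP[a0 b0] e]] := cop.
    apply: (@pideal1 _ M).
    have e1 : map_poly j (b^-1 *: (a *: (u * m + v * g))) = 1.
      by rewrite e scalerA mulVf // scale1r rmorph1.
    rewrite -e1 map_polyZ -mul_polyC; apply: pidealM; rewrite map_polyZ -mul_polyC.
    apply: pidealM; rewrite rmorphD !rmorphM; apply: pidealD; apply: pidealM => //.
    by apply: GM => /=; rewrite mG; exact: dvdp_mulIl.
  have : pideal (ev_prime y) G by rewrite e; apply: GM; exact: dvdpp.
  by move=> /= /eqP; rewrite -rootE (negPf Gy).
have /size_poly1P[c c0 Gc] : size G == 1%N by apply/eqP.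
have mE : map_poly j m = ('X - y%:P) ^+ k.
  rewrite mG Gc; suff -> : c = 1 by rewrite mul1r.
  have := congr1 lead_coef mG; rewrite lead_coef_map (monicP mm) rmorph1 Gc.
  by rewrite lead_coefM lead_coefC (monicP (monic_exp _ (monicXsubC _))) mulr1.
exists m, k.-1; split=> //; rewrite mE; case: k mE {mG} => // mE.
by have := my; rewrite mE expr0 hornerC => /eqP; rewrite oner_eq0.
Qed.

(** The exponent n + 1 in m = (X - y)^(n+1) is written as q (r + 1) with q a power of p and r + 1
    prime to p. Then m = (X^q - y^q)^(r+1), and a coefficient of m is -(r + 1) y^q, so y^q comes
    from K. In characteristic 0, q = 1. *)
Lemma purely_inseparable (y : L) : exists k x, y ^+ (char_exponent K ^ k) = j x.
Proof.
have [m [n [mm mE]]] := minimal_linear_power y.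
(* The subleading coefficient, minus the sum of the r + 1 equal roots. *)
have coef_pow (b : L) r : (('X - b%:P) ^+ r.+1)`_r = - (r.+1%:R * b).
  have -> : ('X - b%:P) ^+ r.+1 = \prod_(c <- nseq r.+1 b) ('X - c%:P).
    by rewrite big_nseq -Monoid.iteropE.
  have := @coefPn_prod_XsubC L (nseq r.+1 b); rewrite size_nseq => -> //.
  by rewrite big_nseq iter_addr_0 mulr_natl.
have root_in (b : L) r q : (0 < q)%N -> map_poly j m = ('X^q - b%:P) ^+ r.+1 ->
    (r.+1%:R : K) != 0 -> exists x, b = j x.
  move=> q0 e r0.
  have := congr1 (fun g : {poly L} => g`_(r * q)) e.
  have -> : ('X^q - b%:P) ^+ r.+1 = (('X - b%:P) ^+ r.+1) \Po 'X^q.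
    by rewrite rmorphXn /= comp_polyB comp_polyX comp_polyC.
  rewrite coef_comp_poly_Xn // dvdn_mull // mulnK // coef_pow coef_map => e1.
  exists (- (r.+1%:R^-1 * m`_(r * q))).
  rewrite rmorphN rmorphM fmorphV rmorph_nat [j m`_ _]e1 mulrN opprK mulrA mulVf ?mul1r //.
  by rewrite -(rmorph_nat j) fmorph_eq0.
have [[p pK]|nop] := pselect (exists p, p \in [pchar K]).
  have pr : prime p by case/andP: pK.
  have [r cop nE] := pfactor_coprime pr (ltn0Sn n).
  case: r cop nE => [|r] cop nE; first by rewrite mul0n in nE.
  exists (logn p n.+1); rewrite (char_exponentE pK).
  have pq : p.-nat (p ^ logn p n.+1)%N by rewrite pnatX pnat_id.
  have q0 : (0 < p ^ logn p n.+1)%N by rewrite expn_gt0 prime_gt0.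
  move: nE pq q0; set q := (p ^ _)%N => nE pq q0.
  apply: (root_in _ r _ q0).
    rewrite mE nE mulnC exprM; congr (_ ^+ _).
    have pL : p \in [pchar {poly L}].
      apply/andP; split=> //; rewrite -(rmorph_nat (@polyC L)) -(rmorph_nat j).
      by rewrite (pcharf0 pK) !rmorph0.
    have qL : [pchar {poly L}].-nat q by rewrite (eq_pnat _ (pcharf_eq pL)).
    rewrite exprDn_pchar // polyC_exp; congr (_ + _); apply/eqP.
    by rewrite -addr_eq0 -exprDn_pchar // addNr expr0n gtn_eqF.
  rewrite -(dvdn_pcharf pK); apply: contraL cop => pr'.
  by rewrite prime_coprime // negbK.
exists 0%N; rewrite expn0 expr1; apply: (root_in y n 1%N) => //.
apply/eqP => n0; apply: nop.
by have [p pK] := natf0_pchar (ltn0Sn n) (introT eqP n0); exists p.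
Qed.

End PurelyInseparable.

Lemma universal_homeomorphism_homeo (Y X : scheme) (f : morphism Y X) :
  universal_homeomorphism f -> homeomorphism f.
Proof.
move=> uf; apply: (uf X Y (mid X) (mid Y) f); split.
  by rewrite mcompm1 mcomp1m.
move=> Z a b fab; exists a; split; first by rewrite mcomp1m fab mcomp1m.
by move=> u [<- _]; rewrite mcomp1m.
Qed.

Lemma sec_nonzero (X : lrs) (U : opens X) (x : X) : oset U x -> (1 : sec U) <> 0.
Proof. by move=> Ux e; apply: (germ_unit0 Ux); rewrite -e; exact: germ_unit1. Qed.

Section UniversalHomeomorphism.
Variables (Y X : scheme) (f : morphism Y X).
Hypothesis uf : universal_homeomorphism f.

Let f_inj : injective f.
Proof. by have [bf _] := universal_homeomorphism_homeo uf; exact: bij_inj. Qed.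

(** Inside an affine U0 around f y, the image of an affine V1 around y is open, so it contains a
    principal open D(s) of U0. By injectivity the preimage of D(s) lies in V1 and is principal
    there, hence affine. *)
Lemma uh_affine_nbhd (y : Y) (V : set Y) (W : set X) : open V -> V y -> open W -> W (f y) ->
  exists U : opens X, [/\ oset U (f y), U `<=` W, opreim (mcts f) U `<=` V,
    affine U & affine (opreim (mcts f) U)].
Proof.
move=> oV Vy oW Wy; have [_ fo] := universal_homeomorphism_homeo uf.
have [U0 [U0y U0W aU0]] := affine_basis oW Wy.
have [V1 [V1y V1V aV1]] := @affine_basis Y y (V `&` f @^-1` U0)
  (openI oV (mcts f (oopen U0))) (conj Vy U0y).
have [base _ _ _] := aU0.
have [||s [sy sV]] := base (f y) (f @` V1) U0y _ _.
- by apply/fo; exact: oopen.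
- by exists y.
have hV y' : germ_unit (f y') s -> oset V1 y'.
  by move=> sy'; have [y'' V1y'' /f_inj <-] : (f @` V1) (f y') by exact: sV.
have h : V1 `<=` opreim (mcts f) U0 by move=> y' /V1V[].
exists (nonvan s); split=> //.
- by move=> x /germ_unit_dom/U0W.
- by move=> y' /= sy'; have [] := V1V _ (hV _ sy').
- exact: (affine_nonvan (s := s) aU0).
- apply: (affine_nonvan (U := V1) (s := res h (msharp f U0 s))) => // y'.
  split=> [sy'|].
    by rewrite germ_unit_res; [exact/germ_unit_msharp|exact: hV].
  move=> sy'; have V1y' := germ_unit_dom sy'; apply/germ_unit_msharp.
  by move: sy'; rewrite germ_unit_res.
Qed.

Section Chart.
Variable U : opens X.
Let V := opreim (mcts f) U.
Hypotheses (aU : affine U) (aV : affine V).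
Variables (A B : comNzRingType) (iA : {rmorphism sec U -> A}) (kA : {rmorphism A -> sec U})
  (iB : {rmorphism sec V -> B}) (kB : {rmorphism B -> sec V}).
Hypotheses (iAK : cancel iA kA) (kAK : cancel kA iA) (iBK : cancel iB kB) (kBK : cancel kB iB).

Let phi : {rmorphism A -> B} := iB \o (msharp f U \o kA).

Lemma line_injective (P1 P2 : prime_ideal {poly B}) :
  (forall r, pideal P1 (map_poly phi r) <-> pideal P2 (map_poly phi r)) -> P1 = P2.
Proof.
have [g [p [q [pb qE]]]] := affine_line_pullback aU aV iAK kAK iBK kBK.
have [bq _] := uf pb; move=> e; apply: (bij_inj bq); apply: prime_ideal_eq.
by apply/seteqP; split=> r /qE/e h; apply/qE.
Qed.

(** For a bijection, closedness of the image of V(c) is openness of the image of D(c); a prime N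
    outside the former lies in the latter, and r cuts out a basic neighbourhood of it. *)
Lemma line_closed (c : {poly B}) (N : prime_ideal {poly A}) :
  (~ exists P : prime_ideal {poly B}, pideal P c /\
     forall r, pideal N r <-> pideal P (map_poly phi r)) ->
  exists r, ~ pideal N r /\
    forall P : prime_ideal {poly B}, pideal P c -> pideal P (map_poly phi r).
Proof.
have [g [p [q [pb qE]]]] := affine_line_pullback aU aV iAK kAK iBK kBK.
have [bq oq] := uf pb; move=> none; have [q' qK q'K] := bq.
have oI : open (q @` (basic c : set (spectrum {poly B}))) by apply/oq; exact: oopen.
have NI : (q @` (basic c : set (spectrum {poly B}))) N.
  exists (q' N); last exact: q'K.
  move=> Nc; apply: none; exists (q' N); split=> // r.
  by have := qE (q' N) r; rewrite q'K.
have [r [nr rI]] := spectrum_base oI NI; exists r; split=> // P Pc.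
apply: contrapT => nP; have [|P' nP' /(bij_inj bq) e] := rI (q P).
  by move=> /qE.
by apply: nP'; rewrite e.
Qed.

End Chart.

Lemma affine_residue (Z : scheme) (W : opens Z) (aW : affine W) (z : Z) (Wz : oset W z)
    (u : residue_field z) : exists a g : sec W,
  residue_eval Wz g != 0 /\ u * residue_eval Wz g = residue_eval Wz a.
Proof.
have [[N Nz] [t0 ->]] := fproj_surj u; pose t : sec N := t0; rewrite -/(residue_eval Nz t).
have [g [a [h [gz e]]]] := affine_fraction aW t Wz Nz; exists a, g; split.
  by apply/eqP => /residue_eval_eq0.
have gz' : oset (nonvan g) z by [].
have := congr1 (residue_eval gz') e; rewrite rmorphM (residue_eval_res h Nz gz').
by rewrite !(residue_eval_res (@nonvan_sub _ _ g) Wz gz').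
Qed.

(** [purely_inseparable] asks for injectivity on primes of the polynomial ring over the residue
    field at y, while the pullback gives it for B[X]. Contraction to B[X] bridges the two. *)
Lemma uh_purely_inseparable (y : Y) (b : residue_field y) :
  exists k x, b ^+ (chexp (f y) ^ k) = residue_map f y x.
Proof.
have [U [Uy _ _ aU aV]] := @uh_affine_nbhd y setT setT openT I openT I.
set V := opreim (mcts f) U in aV; pose Vy : oset V y := Uy.
have [A [iA [kA [iAK kAK]]]] := nonzero_ring (sec_nonzero Uy).
have [B [iB [kB [iBK kBK]]]] := nonzero_ring (sec_nonzero Vy).
pose j := residue_map f y.
pose evA : {rmorphism A -> residue_field (f y)} := residue_eval Uy \o kA.
pose evB : {rmorphism B -> residue_field y} := residue_eval Vy \o kB.
pose phi : {rmorphism A -> B} := iB \o (msharp f U \o kA).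
have evE a : evB (phi a) = j (evA a) by rewrite /= iBK /j residue_mapE.
apply: (purely_inseparable (j := j)) => M1 M2 e.
pose mB : {rmorphism {poly B} -> {poly residue_field y}} := map_poly evB.
have mC c : mB c%:P = (evB c)%:P by exact: map_polyC.
have mX : mB 'X = 'X by exact: map_polyX.
have evP r : mB (map_poly phi r) = map_poly j (map_poly evA r).
  by apply/polyP => i; rewrite !coef_map; exact: evE.
have P12 : contraction mB M1 = contraction mB M2.
  apply: (line_injective aU aV iAK kAK iBK kBK) => r.
  by rewrite /= -/phi evP; exact: e.
(* Up to a nonzero constant coming from B, every polynomial over the residue field comes from B[X];
   so a prime is determined by its contraction. *)
have clear (g : {poly residue_field y}) : exists d (G : {poly B}),
    evB d != 0 /\ (evB d)%:P * g = mB G.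
  elim/poly_ind: g => [|g c [d [G [d0 dG]]]].
    by exists 1, 0; rewrite !rmorph0 mulr0 rmorph1 oner_eq0.
  have [a [s [s0 sa]]] := affine_residue aV Vy c.
  have sE : evB (iB s) = residue_eval Vy s by rewrite /= iBK.
  have aE : evB (iB a) = c * evB (iB s) by rewrite sE /= iBK sa.
  exists (d * iB s), ((iB s)%:P * G * 'X + (d * iB a)%:P); split.
    by rewrite (rmorphM evB) mulf_neq0 // sE.
  rewrite (rmorphD mB) !(rmorphM mB) !mC mX -dG !(rmorphM evB) aE !polyCM; ring.
have sub (N1 N2 : prime_ideal {poly residue_field y}) :
    contraction mB N1 = contraction mB N2 -> pideal N1 `<=` pideal N2.
  move=> N12 g N1g; have [d [G [d0 dG]]] := clear g.
  have : pideal (contraction mB N1) G by rewrite /= -dG; exact: pidealM.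
  rewrite N12 /= -dG => /pideal_prime[|//] N2d; exfalso; apply: (@pideal1 _ N2).
  have -> : 1 = ((evB d)^-1)%:P * (evB d)%:P by rewrite -polyCM mulVf.
  exact: pidealM.
by apply: prime_ideal_eq; apply/seteqP; split; exact: sub.
Qed.

End UniversalHomeomorphism.

(** * Factoring the absolute weak normalization through a universal homeomorphism *)

Section UniversalHomeomorphismLift.
Variables (Y X : scheme) (f : morphism Y X).
Hypothesis uf : universal_homeomorphism f.

Lemma universal_homeomorphism_inj : injective f.
Proof. by have [bf _] := universal_homeomorphism_homeo uf; exact: bij_inj. Qed.

(** By injectivity, y is the only point over f y, so every prime over that of f y contains c. This
    is the hypothesis of [integral_equation]. *)
Lemma uh_equation (y : Y) (U : opens X) (V := opreim (mcts f) U) (c : sec V) :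
  affine U -> affine V -> oset U (f y) -> ~ germ_unit y c ->
  exists (s : sec U) M (h : nat -> sec U), [/\ germ_unit (f y) s,
    forall i, ~ germ_unit (f y) (h i)
    & msharp f U s * c ^+ M.+1 = \sum_(i < M.+1) msharp f U (h i) * c ^+ i].
Proof.
move=> aU aV Uy cy; pose Vy : oset V y := Uy.
have [A [iA [kA [iAK kAK]]]] := nonzero_ring (sec_nonzero Uy).
have [B [iB [kB [iBK kBK]]]] := nonzero_ring (sec_nonzero Vy).
pose phi : {rmorphism A -> B} := iB \o (msharp f U \o kA).
have [|s [M [h [ns ph e]]]] := @integral_equation A B phi
    (line_closed uf aU aV iAK kAK iBK kBK) (iB c) (contraction kA (point_prime Uy)).
  move=> p' p'E; have [_ prim _ _] := aV; have [_ _ inj _] := aU.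
  have [y' [Vy' p'y]] := prim (contraction iB p').
  apply/p'y; suff -> : y' = y by [].
  apply: universal_homeomorphism_inj; apply: inj => // t.
  have := p'E (iA t); have := p'y (msharp f U t).
  rewrite /= /phi /= iAK germ_unit_msharp => h1 h2.
  by split=> ht; apply: contrapT => nt;
    [have /h1 := (proj2 h2 nt)|have /h2 := (proj2 h1 nt)].
exists (kA s), M, (kA \o h); split=> //; first exact: contrapT.
have := congr1 kB e; rewrite rmorphM rmorphXn rmorph_sum /= /phi /= !iBK => ->.
by apply: eq_bigr => i _; rewrite rmorphM rmorphXn /= !iBK.
Qed.

Lemma universal_homeomorphism_radicial : radicial f.
Proof.
move=> y V s Vy; have [k [x e]] := uh_purely_inseparable uf (residue_eval Vy s).
have [[W Wy] [a0 xE]] := fproj_surj x; pose a : sec W := a0.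
have {xE}xE : x = residue_eval Wy a by [].
exists k, W, a; split=> //.
rewrite (value_in s Vy) (value_in (U := opreim (mcts f) W) _ Wy).
by rewrite (chexp_map f) -rmorphXn e xE residue_mapE.
Qed.

Lemma universal_homeomorphism_surj (x : X) : exists y, f y = x.
Proof.
have [[g _ gK] _] := universal_homeomorphism_homeo uf.
by exists (g x); exact: gK.
Qed.

Let push_subproof := cid (pull_inverse universal_homeomorphism_inj
  universal_homeomorphism_surj universal_homeomorphism_radicial).

Let push : {rmorphism tfun (fun y : Y => kperf y) -> tfun (fun x : X => kperf x)} :=
  sval push_subproof.

Let pushK : cancel push (pull f). Proof. by case: (svalP push_subproof). Qed.

Let kmap_push (b : tfun (fun y : Y => kperf y)) y : kmap f y (push b (f y)) = b y.
Proof. exact: (tfun_eq y (pushK b)). Qed.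

(** Pure inseparability makes s^q equal at y to a regular a', and the difference c satisfies the
    equation of [uh_equation]. Carried to X and divided by its leading coefficient, which is
    invertible near f y, the equation is monic with coefficients vanishing at f y. *)
Lemma push_awn (y : Y) (V : opens Y) (s : sec V) : oset V y ->
  awn_germ (f y) (push (value s : tfun (fun y : Y => kperf y))).
Proof.
move=> Vy; have [k [W [a [Wy sa]]]] := universal_homeomorphism_radicial s Vy.
have [U [Uy UW UV aU aV]] := uh_affine_nbhd uf (oopen V) Vy (oopen W) Wy.
rewrite (chexp_map f) in sa; set q := (_ ^ k)%N in sa.
pose V' := opreim (mcts f) U; pose a' := res (UW : U `<=` W) a.
have V'y : oset V' y by exact: Uy.
pose c : sec V' := (res (UV : V' `<=` V) s) ^+ q - msharp f U a'.
have cE z : oset V' z -> value c z = value s z ^+ q - value (msharp f U a') z.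
  by move=> V'z; rewrite valueB valueX // value_res.
have cy : ~ germ_unit y c.
  by apply/value_eq0; rewrite cE // sa -!kmapE value_res // subrr.
have [s0 [M [h [s0y hy e]]]] := uh_equation aU aV Uy cy.
pose b : tfun (fun x : X => kperf x) := push (value s : tfun (fun y : Y => kperf y)).
pose C : tfun (fun x : X => kperf x) := b ^+ q - (value a' : tfun (fun x : X => kperf x)).
have CE z : oset U (f z) -> kmap f z (C (f z)) = value c z.
  move=> Uz; rewrite cE // /C tfunD tfunN tfunX rmorphB rmorphXn kmapE.
  by rewrite /b kmap_push.
have eX x : oset U x ->
    value s0 x * C x ^+ M.+1 = \sum_(i < M.+1) value (h i) x * C x ^+ i.
  have [z <-] := universal_homeomorphism_surj x => Uz.
  apply: (fmorph_inj (kmap f z)); rewrite rmorphM rmorphXn CE // kmapE.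
  have V'z : oset V' z by exact: Uz.
  rewrite -(valueX _ _ V'z) -valueM e value_sum rmorph_sum; apply: eq_bigr => i _.
  by rewrite valueM valueX // rmorphM rmorphXn CE // kmapE.
have [|W' [r' [W'y rr' s0r']]] := reg_inv (reg_value s0 Uy).
  by move=> /value_eq0; apply.
pose K x := kperf (X := X) x.
pose hr i : tfun K := r' * (value (h i) : tfun K).
have hrI i : vreg (f y) (hr i).
  apply: vregM => //; split; first exact: reg_value.
  by apply/value_eq0; exact: hy.
(* The monic equation holds only near f y, but an identity of total functions is required. The
   discrepancy vanishes near f y, hence lies in the ideal, and is absorbed by the constant
   coefficient. *)
pose err : tfun K := C ^+ M.+1 - \sum_(i < M.+1) hr i * C ^+ i.
have errI : vreg (f y) err.
  apply: (vreg_local (V := ointer U W')) => // x [Ux W'x].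
  rewrite /err tfunD tfunN tfunX tfun_sum.
  rewrite (eq_bigr (fun i : 'I_M.+1 => r' x * (value (h i) x * C x ^+ i))); last first.
    by move=> i _; rewrite tfunM tfunX mulrA.
  by rewrite -mulr_sumr -eX // mulrA [r' x * _]mulrC s0r' // mul1r subrr.
exists k, (value a' : tfun K); split; first exact: reg_value.
exists M.
pose h' i : tfun K := if i is 0%N then hr 0%N + err else hr i.
apply: (@monic_integral _ (reg (f y)) (vreg (f y)) _ _ C M h').
- exact: vreg_reg.
- exact: vregM.
- by case=> [|i]; [exact: vregD|exact: hrI].
- rewrite big_ord_recl /= expr0 mulr1 addrAC /err big_ord_recl /= expr0 mulr1.
  by rewrite [RHS]addrC subrK.
Qed.

Let section_subproof : {g : X -> Y | cancel g f}.
Proof.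
by apply: cid; have [[g _ gK] _] := universal_homeomorphism_homeo uf; exists g.
Qed.

Let g : X -> Y := sval section_subproof.
Let gK : cancel g f := svalP section_subproof.

Let cts (S : set Y) : open S -> open (g @^-1` S).
Proof.
have [_ fo] := universal_homeomorphism_homeo uf; move=> /fo; congr open.
apply/seteqP; split=> [_ [y Sy <-]|x Sx] /=; last by exists (g x).
by rewrite (_ : g (f y) = y) //; apply: universal_homeomorphism_inj; rewrite gK.
Qed.

Let germs (V : opens Y) (s : sec V) x : oset (opreim cts V) x ->
  awn_germ x (push (value s : tfun (fun y : Y => kperf y))).
Proof. by move=> Vx; rewrite -(gK x); exact: push_awn. Qed.

Let sharp (V : opens Y) (s : sec V) : lsec (D := awn_data X) (opreim cts V) :=
  @lmk (awn_data X) (opreim cts V) (push (value s : tfun (fun y : Y => kperf y)))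
    (@germs V s).

Let sharpE (V : opens Y) (s : sec V) y : oset V y -> kmap f y (sharp s (f y)) = value s y.
Proof.
move=> Vy; rewrite /sharp lmkE; last first.
  by rewrite /= (_ : g (f y) = y) //; apply: universal_homeomorphism_inj; rewrite gK.
exact: kmap_push.
Qed.

Let sharpP (V : opens Y) (W : opens X) (h : W `<=` opreim cts V)
    (b c : lsec (D := awn_data X) W) :
  (forall y, oset V y -> oset W (f y) -> kmap f y (b (f y)) = kmap f y (c (f y))) -> b = c.
Proof.
move=> bc; apply: lsecP => x Wx; move: (Wx); rewrite -(gK x) => Wy.
by apply: (fmorph_inj (kmap f (g x))); apply: bc => //; exact: h.
Qed.

Let sharp_additive V : zmod_morphism (@sharp V).
Proof.
move=> s t; apply: (sharpP (V := V)) => // y Vy _.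
by rewrite lsecD lsecN rmorphB !sharpE // valueB.
Qed.

Let sharp_multiplicative V : monoid_morphism (@sharp V).
Proof.
split=> [|s t]; apply: (sharpP (V := V)) => // y Vy Wy.
  by rewrite sharpE // value1 // lsec1 // rmorph1.
by rewrite lsecM rmorphM !sharpE // valueM.
Qed.

HB.instance Definition _ V :=
  GRing.isZmodMorphism.Build _ _ (@sharp V) (@sharp_additive V).
HB.instance Definition _ V :=
  GRing.isMonoidMorphism.Build _ _ (@sharp V) (@sharp_multiplicative V).

Definition uh_lift : morphism (awn_lrs X) Y.
refine (@Morphism (awn_lrs X) Y g cts (fun V => (@sharp V : {rmorphism _ -> _})) _ _).
- move=> V W h h' s; apply: (sharpP (V := W)) => // y Wy Wfy.
  rewrite [X in _ = kmap f y X]lresE // !sharpE //; last exact: h.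
  exact: value_res.
- move=> x V s hs; have Vx := germ_unit_dom hs.
  move: hs => /awn_germ_unit sx; apply: contrapT => /value_eq0 s0; apply: sx.
  rewrite -(gK x); apply: (fmorph_inj (kmap f (g x))).
  by rewrite rmorph0 [LHS]sharpE.
Defined.

Lemma uh_lift_proj : mcomp f uh_lift = awn_proj X.
Proof.
apply: morphism_ext => [x|V s W h h'].
  by rewrite mcomp_fun awn_proj_fun; exact: gK.
apply: (sharpP (V := opreim (mcts f) V)) => // y Vy Wy.
have Vfy : oset V (f y) by [].
apply: etrans (congr1 (kmap f y) (@lresE (awn_data X) _ W h _ (f y) Wy)) _.
apply: etrans (sharpE (msharp f V s) Vy) _.
apply: etrans (esym (kmapE f y s)) _.
apply: etrans (esym (congr1 (kmap f y) (awn_projE s Vfy))) _.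
exact: esym (congr1 (kmap f y) (@lresE (awn_data X) _ W h' _ (f y) Wy)).
Qed.

End UniversalHomeomorphismLift.

(** * The weak normalization under the generic points *)

Lemma uh_mono (Z Y X : scheme) (f : morphism Y X) (g1 g2 : morphism Z Y) :
  universal_homeomorphism f -> reduced Z -> mcomp f g1 = mcomp f g2 -> g1 = g2.
Proof.
move=> uf; apply: radicial_mono.
- exact: universal_homeomorphism_inj.
- exact: universal_homeomorphism_radicial.
Qed.

Section Points.
Variables (X : scheme) (I : choiceType) (x : I -> X).

Let K i := perfect_closure (residue_field (x i)).
Let Z := coprod_spec K.

Let cts (S : set X) : open S -> open ((x : Z -> X) @^-1` S).
Proof. by move=> _; exact: fopen. Qed.

Let sharp (V : opens (awn_lrs X)) (b : lsec (D := awn_data X) V) :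
  fsec K (opreim (S := Z) (f := x) cts V) := fun i _ => @kperf_perfect X (x i) (b (x i)).

Let sharp_additive V : zmod_morphism (@sharp V).
Proof.
move=> s t; apply: fsecP => i Vi.
transitivity (@kperf_perfect X (x i) (s (x i) - t (x i))); last exact: rmorphB.
by congr (@kperf_perfect X (x i) _); rewrite lsecD lsecN.
Qed.

Let sharp_multiplicative V : monoid_morphism (@sharp V).
Proof.
split=> [|s t]; apply: fsecP => i Vi.
  transitivity (@kperf_perfect X (x i) 1); last exact: rmorph1.
  by congr (@kperf_perfect X (x i) _); rewrite lsec1.
transitivity (@kperf_perfect X (x i) (s (x i) * t (x i))); last exact: rmorphM.
by congr (@kperf_perfect X (x i) _); rewrite lsecM.
Qed.

HB.instance Definition _ V :=
  GRing.isZmodMorphism.Build _ (fsec K (opreim (S := Z) (f := x) cts V))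
    (@sharp V) (@sharp_additive V).
HB.instance Definition _ V :=
  GRing.isMonoidMorphism.Build _ (fsec K (opreim (S := Z) (f := x) cts V))
    (@sharp V) (@sharp_multiplicative V).

(** On sections this is evaluation at the points x i: the values of weakly normal functions already
    lie in the perfect closures. *)
Definition awn_points : morphism Z (awn_lrs X).
refine (@Morphism Z (awn_lrs X) x cts
  (fun V => (@sharp V : {rmorphism _ -> fsec K (opreim (S := Z) (f := x) cts V)})) _ _).
- move=> V W h h' s; apply: fsecP => i Wi.
  apply: (congr1 (@kperf_perfect X (x i))).
  exact: (@lresE (awn_data X) V W h s (x i) Wi).
- move=> i V s hs; have Vi : oset (opreim (S := Z) (f := x) cts V) i.
    by case: hs => W [h [Wi _]]; exact: h.
  move: hs => /(coprod_germ_unit Vi) si; apply/awn_germ_unit => s0.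
  by move/eqP: si; apply; rewrite /= /sharp s0 rmorph0.
Defined.

Lemma awn_points_proj : mcomp (awn_proj X) awn_points =
  coprod_map (fun i => to_perfect_closure (residue_field (x i))).
Proof.
refine (@morphism_ext Z X _ _ _ _); first by move=> i; exact: (erefl (x i)).
move=> V s W h h'; refine (@fsecP I K _ _ _ _) => i Wi.
have Vi : oset V (x i) by exact: h'.
transitivity (@kperf_perfect X (x i) (value s (x i))).
  by apply: (congr1 (@kperf_perfect X (x i))); apply: awn_projE.
rewrite (value_in s Vi) /to_kperf /= perfect_kperfK.
by congr (to_perfect_closure _ (residue_eval _ _)); exact: Prop_irrelevance.
Qed.

End Points.

Lemma coprod_reduced (I : choiceType) (K : I -> fieldType) : reduced (coprod_spec K).
Proof.
move=> U s n sn; apply: fsecP => i Ui; apply/eqP.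
have : (s i Ui) ^+ n == 0.
  apply/eqP; transitivity ((s ^+ n : fsec K U) i Ui); last by rewrite sn.
  elim: n {sn} => [|n IHn]; first by rewrite !expr0.
  by rewrite !exprS IHn.
by rewrite expf_eq0 => /andP[].
Qed.

(** Universal homeomorphisms are monic on reduced sources. Since Xi and X^awn are reduced, both the
    compatibility of the lift with the maps from Xi and its uniqueness can be checked over X. *)
Lemma awn_weak_normalization (X : scheme) :
  weak_normalization (Xi_map X) (awn_points _ : morphism (Xi X) (awn X))
    (awn_proj X : morphism (awn X) X).
Proof.
split; [exact: awn_points_proj|exact: awn_proj_universal_homeomorphism|].
move=> X' i' p' pi' up'; exists (uh_lift up' : morphism (awn X) X'); split.
  split; last exact: uh_lift_proj.
  apply: (uh_mono up'); first exact: coprod_reduced.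
  by rewrite mcompA uh_lift_proj awn_points_proj pi'.
move=> u [_ pu]; apply: (uh_mono up'); first exact: awn_scheme_reduced.
by rewrite uh_lift_proj pu.
Qed.

(** The lift of (X^awn)^awn through f, composed with the inverse of its projection, is a section of
    f; f is monic on the reduced W, so the section is an inverse. Coherence concerns only the space,
    which is that of X. *)
Lemma awn_topologically_rigid (X : scheme) : coherent X -> topologically_rigid (awn X).
Proof.
move=> cX; split; first exact: cX.
move=> W f redW uf; have [r [rp pr]] := awn_idem X.
exists (mcomp (uh_lift uf) r).
have fu : mcomp f (mcomp (uh_lift uf) r) = mid (awn X).
  by rewrite mcompA uh_lift_proj.
split=> //; apply: (uh_mono uf) => //.
by rewrite mcompA fu mcomp1m mcompm1.
Qed.

Lemma awn_topological_rigidification (X : scheme) : coherent X ->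
  topological_rigidification (awn_proj X : morphism (awn X) X).
Proof.
move=> cX; split; first exact: awn_topologically_rigid.
move=> T g [_ rigT].
have [s [_ ps]] := rigT (awn T) (awn_proj T) (@awn_scheme_reduced T)
  (@awn_proj_universal_homeomorphism T).
exists (mcomp (awn_map g) s); split=> [|w pw].
  by rewrite mcompA -awn_map_proj -mcompA ps mcompm1.
(* T itself is not assumed reduced, so uniqueness is checked on T^awn and brought back along the
   isomorphism with T. *)
have <- : mcomp w (awn_proj T) = awn_map g.
  apply: (@awn_mono (awn T)); first exact: awn_scheme_reduced.
  by rewrite mcompA pw awn_map_proj.
by rewrite -mcompA ps mcompm1.
Qed.

(** * Invariance of the topological rigidification under isomorphism *)

Section Transport.
Variables (Y W : scheme) (u : morphism Y W) (v : morphism W Y).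
Hypotheses (uv : mcomp u v = mid W) (vu : mcomp v u = mid Y).

Let uvK : cancel v u.
Proof. by move=> w; have := congr1 (fun h : morphism W W => mfun h w) uv. Qed.
Let vuK : cancel u v.
Proof. by move=> y; have := congr1 (fun h : morphism Y Y => mfun h y) vu. Qed.

Lemma cover_compact_image (S T : topologicalType) (f : S -> T) (A : set S) :
  (forall B, open B -> open (f @^-1` B)) -> cover_compact A -> cover_compact (f @` A).
Proof.
move=> fc cA I D g go cov; have [||D' D'D cov'] := cA I D (fun i => f @^-1` g i).
- by move=> i Di; apply/fc/go.
- by move=> a Aa; have [i Di gi] := cov (f a) (ex_intro2 _ _ a Aa erefl); exists i.
exists D' => // _ [a Aa <-]; exact: cov'.
Qed.

Let imv (A : set W) : u @` (v @` A) = A.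
Proof.
apply/seteqP; split=> [_ [_ [w Aw <-] <-]|w Aw]; first by rewrite uvK.
by exists (v w); [exists w|exact: uvK].
Qed.

Let openv (A : set W) : open A -> open (v @` A).
Proof.
move=> oA; rewrite (_ : v @` A = u @^-1` A); first exact: mcts.
apply/seteqP; split=> [_ [w Aw <-]|y Ay] /=; first by rewrite uvK.
by exists (u y).
Qed.

Lemma coherent_transport : coherent Y -> coherent W.
Proof.
move=> [qc qs]; split.
  rewrite /quasicompact (_ : setT = u @` setT).
    by apply: (cover_compact_image _ qc) => B; exact: mcts.
  by apply/seteqP; split=> // w _; exists (v w).
move=> A B oA oB cA cB; rewrite -(imv (A `&` B)).
apply: cover_compact_image => [C|]; first exact: mcts.
rewrite (_ : v @` (A `&` B) = v @` A `&` v @` B).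
  by apply: qs; try exact: openv; apply: cover_compact_image => // C; exact: mcts.
apply/seteqP; split=> [_ [w [Aw Bw] <-]|_ [[w Aw <-] [w' Bw' /(can_inj uvK) ww']]].
  by split; exists w.
by subst w'; exists w.
Qed.

(** A pullback of v f along g is a pullback of f along u g, so v f is again a universal
    homeomorphism, and rigidity of Y inverts it. *)
Lemma topologically_rigid_transport : topologically_rigid Y -> topologically_rigid W.
Proof.
move=> [cY rigY]; split; first exact: coherent_transport.
move=> Z f redZ uf; have [|r [rf fr]] := rigY Z (mcomp v f) redZ.
  move=> T P g p q [pq univ]; apply: (uf T P (mcomp u g) p q); split.
    by rewrite -mcompA -pq -mcompA mcompA uv mcomp1m.
  move=> R a b ab; apply: univ.
  by rewrite -mcompA ab -mcompA mcompA vu mcomp1m.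
exists (mcomp r v); split; first by rewrite -mcompA.
by rewrite -(mcomp1m f) -uv -!mcompA [mcomp v (mcomp f _)]mcompA (mcompA (mcomp v f)) fr mcomp1m.
Qed.

Lemma topological_rigidification_transport (X : scheme) (p : morphism Y X)
    (p' : morphism W X) : mcomp p' u = p ->
  topological_rigidification p -> topological_rigidification p'.
Proof.
move=> pu [rigY univ]; split; first exact: topologically_rigid_transport.
have pv : mcomp p v = p' by rewrite -pu -mcompA uv mcompm1.
move=> T g rigT; have [w [pw wu]] := univ T g rigT.
exists (mcomp u w); split=> [|w' pw']; first by rewrite mcompA pu.
by rewrite (wu (mcomp v w')) ?mcompA ?uv ?mcomp1m // pv.
Qed.

End Transport.

Lemma weak_normalization_unique (Y X W W' : scheme) (f : morphism Y X)
    (i : morphism Y W) (p : morphism W X) (i' : morphism Y W') (p' : morphism W' X) :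
  weak_normalization f i p -> weak_normalization f i' p' ->
  exists (u : morphism W W') (v : morphism W' W),
    [/\ mcomp u v = mid W', mcomp v u = mid W & mcomp p' u = p].
Proof.
move=> [pi up univ] [pi' up' univ'].
have [u [[ui pu] _]] := univ _ _ _ pi' up'.
have [v [[vi pv] _]] := univ' _ _ _ pi up.
exists u, v; split=> //.
- have [w [_ wu]] := univ' _ _ _ pi' up'.
  rewrite -(wu (mid W')); last by rewrite mcomp1m mcompm1.
  by apply/esym/wu; rewrite -mcompA vi ui mcompA pu pv.
- have [w [_ wu]] := univ _ _ _ pi up.
  rewrite -(wu (mid W)); last by rewrite mcomp1m mcompm1.
  by apply/esym/wu; rewrite -mcompA ui vi mcompA pv pu.
Qed.

Theorem corollary8p4p1 (X : scheme) (hred : reduced X) (hcoh : coherent X)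
    (hfin : locally_finite_components X) :
  (exists (W : scheme) (i : morphism (Xi X) W) (p : morphism W X),
     weak_normalization (Xi_map X) i p) /\
  (forall (W : scheme) (i : morphism (Xi X) W) (p : morphism W X),
     weak_normalization (Xi_map X) i p -> topological_rigidification p).
Proof.
split; first by do 3!eexists; exact: awn_weak_normalization.
move=> W i p wn.
(* Initial objects are isomorphic over X, so an arbitrary weak normalization inherits the
   rigidification property from X^awn. *)
have [u [v [uv vu pu]]] := weak_normalization_unique (awn_weak_normalization X) wn.
exact: (topological_rigidification_transport uv vu pu
  (awn_topological_rigidification hcoh)).
Qed.
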